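(* Let $A=TV/(R)$ be a $3$-dimensional Artin-Schelter regular algebra with $R\subseteq V^{\otimes m}$, $m\ge 2$, and let $x_1,\ldots,x_n$ be a basis for $V$. Let $\mathsf{w}\in V^{\otimes(m+1)}$ be a $Q$-twisted superpotential such that $A=TV/(\partial_1\mathsf{w},\ldots,\partial_n\mathsf{w})$, and suppose $Q=\mathrm{diag}(q_1,\ldots,q_n)$ is diagonal with respect to the basis $x_1,\ldots,x_n$. Fix an index $1\le k\le n$, and let $\mathsf{p}=(p_1,\ldots,p_n)$ be a tuple of non-zero scalars that is good (for the index $k$), i.e. $p_k=q_k$ and the automorphism $\varphi\colon V\to V$, $\varphi(x_i)=p_ix_i$, satisfies $\varphi^{\otimes(m+1)}(\mathsf{w})=q_k\mathsf{w}$. Let $D(\mathsf{w},\mathsf{p})$ be the tensor algebra $TV$ modulo the $2(n-1)$ relations $$\partial_i\mathsf{w}=0,\qquad x_i(\partial_k\mathsf{w})-p_i(\partial_k\mathsf{w})x_i=0\qquad (i=1,\ldots,n,\ i\ne k),$$ and let $\Omega$ denote the image of $\partial_k\mathsf{w}$ in $D(\mathsf{w},\mathsf{p})$. Then: (1) $D(\mathsf{w},\mathsf{p})$ is a $4$-dimensional Artin-Schelter regular algebra and is a normal extension of $A=D(\mathsf{w},\mathsf{p})/(\Omega)$ (i.e. $\Omega$ is a regular normal element of $D(\mathsf{w},\mathsf{p})$ with quotient $A$). (2) $D(\mathsf{w},\mathsf{p})$ is noetherian if and only if $A$ is. (3) $D(\mathsf{w},\mathsf{p})$ has finite Gelfand-Kirillov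 dimension if and only if $A$ does. (4) $D(\mathsf{w},\mathsf{p})$ is a domain if $A$ is.
   Context: Fix a field $\Bbbk$; $V$ is an $n$-dimensional $\Bbbk$-vector space and $TV$ its tensor algebra, with $V$ in degree $1$. Graded algebras are $\mathbb{N}$-graded, connected ($A_0=\Bbbk$), finitely presented and generated by their degree-one components. A connected graded algebra $A$ is Gorenstein of dimension $d$ if it has left injective dimension $d$ over itself and $\mathrm{Ext}^i_A(\Bbbk,A)\cong\Bbbk(\ell)$ for $i=d$ and $0$ for $i\neq d$, for some $\ell\in\mathbb{Z}$ (the Gorenstein parameter). It is Artin-Schelter regular of dimension $d$ if it has finite global dimension $d$ and is Gorenstein of dimension $d$ (no noetherian or finite Gelfand-Kirillov dimension hypothesis). For $Q\in\mathrm{GL}(V)$, an element $\mathsf{w}\in V^{\otimes\ell}$ is a $Q$-twisted superpotential if it is invariant under the linear map $V^{\otimes\ell}\to V^{\otimes\ell}$, $v_1\otimes\cdots\otimes v_\ell\mapsto (Q^{-1}v_\ell)\otimes v_1\otimes\cdots\otimes v_{\ell-1}$. The partial derivative $\partial_i\colon TV\to TV$ is the linear map with $\partial_i(x_i\mathsf{v})=\mathsf{v}$ for a word $\mathsf v$ and $\partial_i(\mathsf{u})=0$ for words $\mathsf{u}$ not beginning with $x_i$. (For every 3-dimensional Artin-Schelter regular $A=TV/(R)$ one has $R\subseteq V^{\otimes m}$ for some $m\ge2$ without loss of generality, and such a twisted superpotential exists and is unique up to scalar, by a theorem of Dubois-Violette.) An element $\Omega$ of a ring $D$ is normal if $\Omega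 D=D\Omega$, and regular if it is not a zero-divisor. *)

(* Defs.v *)
From HB Require Import structures.
From mathcomp Require Import all_boot all_order all_algebra generic_quotient finmap.
From mathcomp Require Import boolp classical_sets reals ereal sequences exp.
(* The reserved notations of monalg clash with those of mathcomp-analysis. *)
From mathcomp Require Import -(notations) monalg.

Set Implicit Arguments.
Unset Strict Implicit.
Unset Printing Implicit Defensive.

Import Order.TTheory GRing.Theory Num.Theory.
Local Open Scope classical_set_scope.
Local Open Scope quotient_scope.
Local Open Scope ring_scope.

Section Rings.
Variable A : pzRingType.

Inductive ideal_gen (S : set A) : A -> Prop :=
| ideal_gen0 : ideal_gen S 0
| ideal_gen_add a s b x :
    S s -> ideal_gen S x -> ideal_gen S (a * s * b + x).

Lemma ideal_genD S x y : ideal_gen S x -> ideal_gen S y -> ideal_gen S (x + y).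
Proof.
move=> hx hy; elim: hx => [|a s b z hs _ ih]; first by rewrite add0r.
by rewrite -addrA; exact: (ideal_gen_add _ _ hs).
Qed.

Lemma ideal_genMl S a x : ideal_gen S x -> ideal_gen S (a * x).
Proof.
elim=> [|c s b z hs _ ih]; first by rewrite mulr0; exact: ideal_gen0.
by rewrite mulrDr !mulrA; exact: (ideal_gen_add _ _ hs).
Qed.

Lemma ideal_genMr S a x : ideal_gen S x -> ideal_gen S (x * a).
Proof.
elim=> [|c s b z hs _ ih]; first by rewrite mul0r; exact: ideal_gen0.
by rewrite mulrDl -mulrA; exact: (ideal_gen_add _ _ hs).
Qed.

Lemma ideal_genN S x : ideal_gen S x -> ideal_gen S (- x).
Proof. by rewrite -mulN1r; exact: ideal_genMl. Qed.

Definition left_ideal (J : set A) : Prop :=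
  J 0 /\ forall a x y, J x -> J y -> J (a * x + y).

Definition normal_element (x : A) : Prop :=
  [set x * a | a in [set: A]] = [set a * x | a in [set: A]].

Definition regular_element (x : A) : Prop := GRing.lreg x /\ GRing.rreg x.

End Rings.

Definition left_noetherian (A : pzRingType) : Prop :=
  forall J : nat -> set A,
    (forall i, left_ideal (J i)) -> (forall i, J i `<=` J i.+1) ->
    exists N, forall i, (N <= i)%N -> J i = J N.

Definition noetherian (A : pzRingType) : Prop :=
  left_noetherian A /\ left_noetherian A^c.

Definition domain (A : pzRingType) : Prop :=
  (1 : A) <> 0 /\ forall x y : A, x * y = 0 -> x = 0 \/ y = 0.

Section GKDim.
Variables (K : fieldType) (A : algType K).

Definition independent_at (s : seq A) (I : {set 'I_(size s)}) : Prop :=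
  forall c : 'I_(size s) -> K,
    \sum_(i in I) c i *: s`_i = 0 -> forall i, i \in I -> c i = 0.

Definition span_dim (s : seq A) : nat :=
  \max_(I : {set 'I_(size s)} | `[< independent_at I >]) #|I|.

(* For V the span of s, this family spans K + V + ... + V^N. *)
Fixpoint products (s : seq A) (N : nat) : seq A :=
  if N is N'.+1 then 1 :: [seq x * y | x <- s, y <- products s N'] else [:: 1].

Definition GKdim (R : realType) : \bar R :=
  ereal_sup [set limn_esup (fun N : nat =>
    (ln (span_dim (products s N))%:R / ln N%:R)%:E) | s in [set: seq A]].

End GKDim.

Section Homological.
Variable A : pzRingType.

Definition projective (P : lmodType A) : Prop :=
  forall (M N : lmodType A) (g : {linear M -> N}) (f : {linear P -> N}),
    (forall y, exists x, g x = y) ->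
    exists h : {linear P -> M}, forall x, g (h x) = f x.

Definition injective_module (E : lmodType A) : Prop :=
  forall (M N : lmodType A) (g : {linear M -> N}) (f : {linear M -> E}),
    injective g ->
    exists h : {linear N -> E}, forall x, h (g x) = f x.

Record proj_resolution (M : lmodType A) := ProjResolution {
  pres_mod :> nat -> lmodType A;
  pres_d : forall i, {linear pres_mod i.+1 -> pres_mod i};
  pres_aug : {linear pres_mod 0 -> M};
  pres_projective : forall i, projective (pres_mod i);
  pres_surj : forall y, exists x, pres_aug x = y;
  pres_exact0 : forall x, pres_aug x = 0 <-> exists y, pres_d 0 y = x;
  pres_exact : forall i x, pres_d i x = 0 <-> exists y, pres_d i.+1 y = x
}.

Record inj_resolution (M : lmodType A) := InjResolution {
  ires_mod :> nat -> lmodType A;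
  ires_d : forall i, {linear ires_mod i -> ires_mod i.+1};
  ires_coaug : {linear M -> ires_mod 0};
  ires_injective : forall i, injective_module (ires_mod i);
  ires_inj : injective ires_coaug;
  ires_exact0 : forall x, ires_d 0 x = 0 <-> exists y, ires_coaug y = x;
  ires_exact : forall i x, ires_d i.+1 x = 0 <-> exists y, ires_d i y = x
}.

Definition projdim_le (M : lmodType A) (d : nat) : Prop :=
  exists C : proj_resolution M, forall i, (d < i)%N -> forall x : C i, x = 0.

Definition injdim_le (M : lmodType A) (d : nat) : Prop :=
  exists C : inj_resolution M, forall i, (d < i)%N -> forall x : C i, x = 0.

(* Left global dimension; for the connected graded algebras considered here it
   coincides with the right one. *)
Definition gldim (d : nat) : Prop :=
  (forall M, projdim_le M d) /\
  (forall e, (forall M, projdim_le M e) -> (d <= e)%N).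

Definition injdim (M : lmodType A) (d : nat) : Prop :=
  injdim_le M d /\ (forall e, injdim_le M e -> (d <= e)%N).

End Homological.

Lemma malg_scalerAr (M : monomType) (K : comNzRingType) (c : K)
  (u v : malg M K) : c *: (u * v) = u * (c *: v).
Proof.
apply/malgP => k; rewrite mcoeffZ.
rewrite (mcoeffMlw k (fsubset_refl (msupp u)) (fsubset_refl (msupp v))).
rewrite (mcoeffMlw k (fsubset_refl (msupp u)) (msuppZ_le c v)).
rewrite mulr_sumr; apply: eq_bigr => i _; rewrite mulr_sumr.
by apply: eq_bigr => j _; rewrite mcoeffZ mulrnAr mulrCA.
Qed.

(* The tensor algebra of an n-dimensional space V with basis x_0, ..., x_(n-1)
   is the algebra of the free monoid on 'I_n. *)
Definition TV (K : fieldType) (n : nat) : Type := malg (fmonom 'I_n) K.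

HB.instance Definition _ (K : fieldType) (n : nat) :=
  GRing.Lalgebra.on (TV K n).

HB.instance Definition _ (K : fieldType) (n : nat) :=
  GRing.Lalgebra_isAlgebra.Build K (TV K n) (@malg_scalerAr (fmonom 'I_n) K).

Section Superpotentials.
Variables (K : fieldType) (n : nat).
Local Notation T := (TV K n).

Definition word (s : seq 'I_n) : T := mkmalgU (FMonom s) 1.

Definition gen (i : 'I_n) : T := word [:: i].

(* tpow d is the subspace of d-fold tensors. *)
Definition tpow (d : nat) : set T :=
  [set u | forall s : fmonom 'I_n, s \in msupp u -> size s = d].

(* The linear map TV -> TV with prescribed values on the basis of words. *)
Definition lin_ext (F : seq 'I_n -> T) (u : T) : T :=
  \sum_(s <- msupp u) mcoeff s u *: F s.

Definition pder (i : 'I_n) : T -> T :=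
  lin_ext (fun s =>
    if s is j :: s' then if j == i then word s' else 0 else 0).

(* A matrix M acts on V by x_j |-> \sum_i M i j x_i. *)
Definition mx_gen (M : 'M[K]_n) (j : 'I_n) : T := \sum_i M i j *: gen i.

Definition mx_tensor (M : 'M[K]_n) : T -> T :=
  lin_ext (fun s => \prod_(j <- s) mx_gen M j).

(* v_1 ... v_l |-> (Q^-1 v_l) v_1 ... v_(l-1) *)
Definition twist (Q : 'M[K]_n) : T -> T :=
  lin_ext (fun s =>
    if s is j :: s' then mx_gen (invmx Q) (last j s') * word (belast j s')
    else 1).

Definition twisted_superpotential (Q : 'M[K]_n) (l : nat) (w : T) : Prop :=
  tpow l w /\ twist Q w = w.

Definition good (q : 'rV[K]_n) (k : 'I_n) (w : T) (p : 'rV[K]_n) : Prop :=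
  p 0 k = q 0 k /\ mx_tensor (diag_mx p) w = q 0 k *: w.

Lemma lin_ext_word F s : lin_ext F (word s) = F s.
Proof. by rewrite /lin_ext msuppU1 big_seq_fset1 mcoeffUU scale1r. Qed.

Lemma tpow0 d : tpow d 0.
Proof. by move=> s; rewrite msupp0. Qed.

Lemma tpowD d u v : tpow d u -> tpow d v -> tpow d (u + v).
Proof.
move=> hu hv s /(fsubsetP (msuppD_le _ _)).
by rewrite in_fsetU => /orP[/hu|/hv].
Qed.

Lemma tpowZ d c u : tpow d u -> tpow d (c *: u).
Proof. by move=> hu s /(fsubsetP (msuppZ_le _ _)) /hu. Qed.

Lemma tpowB d u v : tpow d u -> tpow d v -> tpow d (u - v).
Proof. by move=> hu hv; rewrite -scaleN1r; apply/tpowD/tpowZ. Qed.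

Lemma tpowM d e u v : tpow d u -> tpow e v -> tpow (d + e) (u * v).
Proof.
move=> hu hv s /msuppM_le[s1 [s2 [/hu h1 /hv h2 ->]]].
by rewrite fmM size_cat h1 h2.
Qed.

Lemma tpow_word s : tpow (size s) (word s).
Proof. by move=> t; rewrite msuppU1 in_fset1 => /eqP ->. Qed.

Lemma tpow_lin_ext d e F u :
  (forall s, size s = d -> tpow e (F s)) -> tpow d u -> tpow e (lin_ext F u).
Proof.
move=> hF hu; rewrite /lin_ext big_seq; apply: big_ind.
- exact: tpow0.
- by move=> *; exact: tpowD.
- by move=> s /hu /hF; exact: tpowZ.
Qed.

Lemma tpow_pder d i u : tpow d.+1 u -> tpow d (pder i u).
Proof.
apply: tpow_lin_ext => -[//|j s] [<-]; case: eqP => _; last exact: tpow0.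
exact: tpow_word.
Qed.

End Superpotentials.

(* The standing conventions on graded algebras (connected, generated in degree
   one, finitely presented) are those of an algebra TV/(R) with R a finite list
   of homogeneous elements of positive degree. *)
Record presentation (K : fieldType) (n : nat) := Presentation {
  relators :> seq (TV K n);
  relatorsP : forall r, r \in relators -> exists2 d, (0 < d)%N & tpow d r
}.

Section QuotientAlgebra.
Variables (K : fieldType) (n : nat) (P : presentation K n).
Local Notation T := (TV K n).

Definition rel_ideal : set T := ideal_gen [set r | r \in relators P].

Lemma rel_ideal_coef1 x : rel_ideal x -> mcoeff one x = 0.
Proof.
elim=> [|a s b z /= hs _ ih]; first exact: mcoeff0.
rewrite mcoeffD ih addr0 !rmorphM /=; have [d d0 hd] := relatorsP hs.
suff -> : mcoeff one s = 0 by rewrite mulr0 mul0r.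
apply/eqP; rewrite mcoeff_eq0; apply/negP => /hd.
by rewrite fm1 => h; rewrite -h in d0.
Qed.

Definition rel_equiv (x y : T) : bool := `[< rel_ideal (x - y) >].

Lemma rel_equiv_is_equiv : equiv_class_of rel_equiv.
Proof.
split.
- by move=> x; apply/asboolP; rewrite subrr; exact: ideal_gen0.
- move=> x y; apply/asboolP/asboolP => /ideal_genN; by rewrite opprB.
- move=> y x z /asboolP h1 /asboolP h2; apply/asboolP.
  by have := ideal_genD h1 h2; rewrite addrA subrK.
Qed.

Canonical rel_equiv_equiv := EquivRelPack rel_equiv_is_equiv.
Canonical rel_equiv_encModRel := defaultEncModRel rel_equiv.

Definition palg : Type := {eq_quot rel_equiv}.
HB.instance Definition _ : EqQuotient T rel_equiv palg :=
  EqQuotient.on palg.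
HB.instance Definition _ := Choice.on palg.

Definition proj (x : T) : palg := \pi_palg x.

Lemma projE x y : proj x = proj y <-> rel_ideal (x - y).
Proof.
split=> [/eqmodP/asboolP //|h]; by apply/eqmodP/asboolP.
Qed.

Lemma proj_repr (x : palg) : proj (repr x) = x.
Proof. exact: reprK. Qed.

Lemma repr_proj x : rel_ideal (repr (proj x) - x).
Proof. by apply/projE; rewrite proj_repr. Qed.

Definition padd (x y : palg) := proj (repr x + repr y).
Definition popp (x : palg) := proj (- repr x).
Definition pmul (x y : palg) := proj (repr x * repr y).
Definition pscale (c : K) (x : palg) := proj (c *: repr x).

Lemma projD x y : padd (proj x) (proj y) = proj (x + y).
Proof.
apply/projE; rewrite opprD addrACA.
by apply: ideal_genD; exact: repr_proj.
Qed.

Lemma projN x : popp (proj x) = proj (- x).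
Proof. by apply/projE; rewrite -opprD; apply/ideal_genN/repr_proj. Qed.

Lemma projM x y : pmul (proj x) (proj y) = proj (x * y).
Proof.
apply/projE; have -> : repr (proj x) * repr (proj y) - x * y =
  (repr (proj x) - x) * repr (proj y) + x * (repr (proj y) - y).
  by rewrite mulrBl mulrBr addrA subrK.
by apply: ideal_genD; [apply/ideal_genMr|apply/ideal_genMl]; exact: repr_proj.
Qed.

Lemma projZ c x : pscale c (proj x) = proj (c *: x).
Proof.
apply/projE; rewrite -scalerBr -[X in c *: X]mul1r scalerAl.
by apply/ideal_genMl/repr_proj.
Qed.

Lemma paddA : associative padd.
Proof.
move=> x y z; rewrite -(proj_repr x) -(proj_repr y) -(proj_repr z).
by rewrite !projD addrA.
Qed.
Lemma paddC : commutative padd.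
Proof. by move=> x y; rewrite /padd addrC. Qed.
Lemma padd0 : left_id (proj 0) padd.
Proof. by move=> x; rewrite -(proj_repr x) projD add0r. Qed.
Lemma paddN : left_inverse (proj 0) popp padd.
Proof. by move=> x; rewrite -(proj_repr x) projN projD addNr. Qed.

HB.instance Definition _ :=
  GRing.isZmodule.Build palg paddA paddC padd0 paddN.

Lemma pmulA : associative pmul.
Proof.
move=> x y z; rewrite -(proj_repr x) -(proj_repr y) -(proj_repr z).
by rewrite !projM mulrA.
Qed.
Lemma pmul1l : left_id (proj 1) pmul.
Proof. by move=> x; rewrite -(proj_repr x) projM mul1r. Qed.
Lemma pmul1r : right_id (proj 1) pmul.
Proof. by move=> x; rewrite -(proj_repr x) projM mulr1. Qed.
Lemma pmulDl : left_distributive pmul padd.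
Proof.
move=> x y z; rewrite -(proj_repr x) -(proj_repr y) -(proj_repr z).
by rewrite !(projD, projM) mulrDl.
Qed.
Lemma pmulDr : right_distributive pmul padd.
Proof.
move=> x y z; rewrite -(proj_repr x) -(proj_repr y) -(proj_repr z).
by rewrite !(projD, projM) mulrDr.
Qed.
Lemma palg_oner_neq0 : proj 1 != 0.
Proof.
apply/eqP => /projE; rewrite subr0 => /rel_ideal_coef1 /eqP.
by rewrite rmorph1 oner_eq0.
Qed.

HB.instance Definition _ := GRing.Zmodule_isNzRing.Build palg
  pmulA pmul1l pmul1r pmulDl pmulDr palg_oner_neq0.

Lemma pscaleA c d x : pscale c (pscale d x) = pscale (c * d) x.
Proof. by rewrite -(proj_repr x) !projZ scalerA. Qed.
Lemma pscale1 : left_id 1 pscale.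
Proof. by move=> x; rewrite -(proj_repr x) projZ scale1r. Qed.
Lemma pscaleDr : right_distributive pscale padd.
Proof.
move=> c x y; rewrite -(proj_repr x) -(proj_repr y).
by rewrite !(projD, projZ) scalerDr.
Qed.
Lemma pscaleDl x : {morph pscale^~ x : c d / c + d >-> padd c d}.
Proof.
move=> c d; rewrite -(proj_repr x).
by rewrite !projZ projD scalerDl.
Qed.

HB.instance Definition _ := GRing.Zmodule_isLmodule.Build K palg
  pscaleA pscale1 pscaleDr pscaleDl.

Lemma pscaleAl (c : K) (x y : palg) : c *: (x * y) = (c *: x) * y.
Proof.
rewrite -(proj_repr x) -(proj_repr y).
by rewrite -[LHS]/(pscale _ (pmul _ _)) -[RHS]/(pmul (pscale _ _) _) !(projM, projZ) scalerAl.
Qed.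

HB.instance Definition _ := GRing.Lmodule_isLalgebra.Build K palg pscaleAl.

Lemma pscaleAr (c : K) (x y : palg) : c *: (x * y) = x * (c *: y).
Proof.
rewrite -(proj_repr x) -(proj_repr y).
by rewrite -[LHS]/(pscale _ (pmul _ _)) -[RHS]/(pmul _ (pscale _ _)) !(projM, projZ) scalerAr.
Qed.

HB.instance Definition _ := GRing.Lalgebra_isAlgebra.Build K palg pscaleAr.

Lemma proj_is_zmod_morphism : zmod_morphism proj.
Proof. by move=> x y; rewrite -[_ - _ in RHS]/(padd _ (popp _)) projN projD. Qed.
Lemma proj_is_monoid_morphism : monoid_morphism proj.
Proof. by split=> [|x y]; [exact: erefl|exact: (esym (projM x y))]. Qed.
Lemma proj_is_scalable : scalable proj.
Proof. by move=> c x; exact: (esym (projZ c x)). Qed.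

HB.instance Definition _ :=
  GRing.isZmodMorphism.Build T palg proj proj_is_zmod_morphism.
HB.instance Definition _ :=
  GRing.isMonoidMorphism.Build T palg proj proj_is_monoid_morphism.
HB.instance Definition _ :=
  GRing.isScalable.Build K T palg *:%R proj proj_is_scalable.

Lemma proj_eq0 x : proj x = 0 <-> rel_ideal x.
Proof. by rewrite -(rmorph0 proj) projE subr0. Qed.

Definition pdeg (d : nat) : set palg := proj @` tpow d.

(* The augmentation, with kernel the elements of positive degree. *)
Definition paug (x : palg) : K := mcoeff one (repr x).

Lemma paug_proj x : paug (proj x) = mcoeff one x.
Proof.
apply/eqP; rewrite -subr_eq0 -mcoeffB; apply/eqP.
exact/rel_ideal_coef1/repr_proj.
Qed.

Lemma paug_is_zmod_morphism : zmod_morphism paug.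
Proof.
move=> x y; rewrite -(proj_repr x) -(proj_repr y) -rmorphB.
by rewrite !paug_proj mcoeffB.
Qed.
Lemma paug_is_monoid_morphism : monoid_morphism paug.
Proof.
split=> [|x y]; first by rewrite -(rmorph1 proj) paug_proj rmorph1.
rewrite -(proj_repr x) -(proj_repr y) -rmorphM.
by rewrite !paug_proj rmorphM.
Qed.

HB.instance Definition _ :=
  GRing.isZmodMorphism.Build palg K paug paug_is_zmod_morphism.
HB.instance Definition _ :=
  GRing.isMonoidMorphism.Build palg K paug paug_is_monoid_morphism.

End QuotientAlgebra.

Section Graded.
Variables (K : fieldType) (n : nat) (P : presentation K n).
Local Notation A := (palg P).

Record grading (M : lmodType A) := Grading {
  gdeg :> int -> set M;
  gdeg0 : forall i, gdeg i 0;
  gdegB : forall i x y, gdeg i x -> gdeg i y -> gdeg i (x - y);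
  gdeg_act : forall d a i x, pdeg d a -> gdeg i x -> gdeg (d%:Z + i) (a *: x);
  gdeg_span : forall x, exists (s : seq int) (f : int -> M),
    (forall i, gdeg i (f i)) /\ x = \sum_(i <- s) f i;
  gdeg_direct : forall (s : seq int) (f : int -> M), uniq s ->
    (forall i, gdeg i (f i)) -> \sum_(i <- s) f i = 0 ->
    forall i, i \in s -> f i = 0
}.

(* The trivial module K, on which A acts through the augmentation. *)
Definition triv : Type := K.
HB.instance Definition _ := GRing.Zmodule.on triv.

Definition triv_scale (a : A) (c : triv) : triv := paug a * (c : K).

Lemma triv_scaleA a b c : triv_scale a (triv_scale b c) = triv_scale (a * b) c.
Proof. by rewrite /triv_scale rmorphM mulrA. Qed.
Lemma triv_scale1 : left_id 1 triv_scale.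
Proof. by move=> c; rewrite /triv_scale rmorph1 mul1r. Qed.
Lemma triv_scaleDr : right_distributive triv_scale +%R.
Proof. by move=> a c d; rewrite /triv_scale mulrDr. Qed.
Lemma triv_scaleDl c : {morph triv_scale^~ c : a b / a + b}.
Proof. by move=> a b; rewrite /triv_scale rmorphD mulrDl. Qed.

HB.instance Definition _ := GRing.Zmodule_isLmodule.Build A triv
  triv_scaleA triv_scale1 triv_scaleDr triv_scaleDl.

Definition triv_deg (i : int) : set triv := [set c | i = 0 \/ c = 0].

Lemma paug_pdeg d (a : A) : (0 < d)%N -> pdeg d a -> paug a = 0.
Proof.
move=> d0 [u hu <-]; rewrite paug_proj; apply/eqP; rewrite mcoeff_eq0.
by apply/negP => /hu; rewrite fm1 => h; rewrite -h in d0.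
Qed.

Lemma triv_deg0 i : triv_deg i 0. Proof. by right. Qed.
Lemma triv_degB i x y : triv_deg i x -> triv_deg i y -> triv_deg i (x - y).
Proof. by move=> [->|->] [hy|->]; [left|left|left|right; rewrite subr0]. Qed.
Lemma triv_deg_act d (a : A) i (x : triv) :
  pdeg d a -> triv_deg i x -> triv_deg (d%:Z + i) (a *: x).
Proof.
move=> ha [->|->]; last by right; rewrite scaler0.
case: d ha => [|d] ha; first by left; rewrite addr0.
by right; rewrite /GRing.scale /= /triv_scale (paug_pdeg _ ha) // mul0r.
Qed.
Lemma triv_deg_span (x : triv) : exists (s : seq int) (f : int -> triv),
  (forall i, triv_deg i (f i)) /\ x = \sum_(i <- s) f i.
Proof.
exists [:: 0], (fun i => if i == 0 then x else 0); split=> [i|].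
  by case: eqP; [left|right].
by rewrite big_seq1.
Qed.
Lemma triv_deg_direct (s : seq int) (f : int -> triv) : uniq s ->
  (forall i, triv_deg i (f i)) -> \sum_(i <- s) f i = 0 ->
  forall i, i \in s -> f i = 0.
Proof.
move=> us hf h i si; case: (hf i) => // i0.
rewrite -h (bigD1_seq i) //= big1 ?addr0 // => j ji.
by case: (hf j) => // j0; rewrite j0 i0 eqxx in ji.
Qed.

Definition triv_grading : grading (triv : lmodType A) :=
  Grading triv_deg0 triv_degB triv_deg_act triv_deg_span triv_deg_direct.

(* The Z-grading of A as a left module over itself. *)
Definition rdeg (i : int) : set A :=
  if i is Posz d then pdeg d else [set 0].

Definition graded_resolution (M : lmodType A) (gM : grading M)
    (C : proj_resolution M) (g : forall i, grading (C i)) : Prop :=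
  (forall t x, g 0 t x -> gM t (pres_aug C x)) /\
  (forall i t x, g i.+1 t x -> g i t (pres_d C i x)).

Section Ext.
Variables (M : lmodType A) (C : proj_resolution M).
Variable g : forall i, grading (C i).

(* Homogeneous A-linear maps C_i -> A of degree j, that is, degree-preserving
   maps C_i -> A(j). *)
Definition cochain (i : nat) (j : int) : set (C i -> A) :=
  [set f | (forall a x y, f (a *: x + y) = a * f x + f y) /\
           (forall t x, g i t x -> rdeg (t + j) (f x))].

Definition cocycle (i : nat) (j : int) : set (C i -> A) :=
  [set f | cochain j f /\ forall x, f (pres_d C i x) = 0].

Definition coboundary (i : nat) (j : int) : set (C i -> A) :=
  match i return set (C i -> A) with
  | 0 => [set f | forall x, f x = 0]
  | i'.+1 => [set f | exists h : C i' -> A,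
      cochain j h /\ forall x, f x = h (pres_d C i' x)]
  end.

Definition Ext_zero (i : nat) : Prop :=
  forall j (f : C i -> A), cocycle j f -> coboundary j f.

(* Ext^i(M, A) and K(l) are isomorphic graded right A-modules; in degree j the
   isomorphism is induced by phi j, from the cocycles of degree j onto
   K(l)_j = K_(l + j), with kernel the coboundaries. *)
Definition Ext_shift (i : nat) (l : int) : Prop :=
  exists phi : int -> (C i -> A) -> K,
  [/\ forall j c f h, cocycle j f -> cocycle j h ->
        phi j (fun x => c *: f x + h x) = c * phi j f + phi j h,
      forall j f d a, cocycle j f -> pdeg d a ->
        phi (j + d%:Z) (fun x => f x * a) = phi j f * paug a,
      forall j f, cocycle j f -> (phi j f = 0 <-> coboundary j f)
    & forall j, phi j @` cocycle j = triv_deg (l + j)].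

End Ext.

Definition gorenstein (d : nat) : Prop :=
  injdim (A^o : lmodType A) d /\
  exists (l : int) (C : proj_resolution (triv : lmodType A))
         (g : forall i, grading (C i)),
  [/\ graded_resolution triv_grading g,
      forall i, i != d -> Ext_zero g i
    & Ext_shift g d l].

Definition AS_regular (d : nat) : Prop := gldim A d /\ gorenstein d.

End Graded.

(* TV/(P) is a normal extension of TV/(P') by Om: the identity of TV induces an
   isomorphism from TV/(P) modulo (Om) to TV/(P'). *)
Definition normal_extension (K : fieldType) (n : nat) (P P' : presentation K n)
    (Om : palg P) : Prop :=
  [/\ normal_element Om, regular_element Om
    & exists theta : {lrmorphism palg P -> palg P'},
        (forall u, theta (proj P u) = proj P' u) /\
        (forall x, theta x = 0 <-> ideal_gen [set Om] x)].

Section Extension.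
Variables (K : fieldType) (n m : nat) (w : TV K n).
Hypotheses (hm : (2 <= m)%N) (hw : tpow m.+1 w).

Lemma superpotential_relatorsP r :
  r \in [seq pder i w | i <- enum 'I_n] -> exists2 d, (0 < d)%N & tpow d r.
Proof.
by move=> /mapP[i _ ->]; exists m; [exact: ltnW|exact: tpow_pder].
Qed.

Definition superpotential_algebra : presentation K n :=
  Presentation superpotential_relatorsP.

Variables (k : 'I_n) (p : 'rV[K]_n).

Definition D_relators : seq (TV K n) :=
  [seq pder i w | i <- enum 'I_n & i != k] ++
  [seq gen K i * pder k w - p 0 i *: (pder k w * gen K i)
     | i <- enum 'I_n & i != k].

Lemma D_relatorsP r :
  r \in D_relators -> exists2 d, (0 < d)%N & tpow d r.
Proof.
rewrite mem_cat => /orP[] /mapP[i _ ->].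
  by exists m; [exact: ltnW|exact: tpow_pder].
have hk : tpow m (pder k w) by exact: tpow_pder.
have hi : tpow 1 (gen K i) by exact: tpow_word.
exists m.+1 => //; apply: tpowB; first exact: (tpowM hi hk).
by apply: tpowZ; rewrite -addn1; exact: (tpowM hk hi).
Qed.

Definition D_algebra : presentation K n := Presentation D_relatorsP.

End Extension.

(* Main.v *)
(* Write w = \sum_i x_i f_i with f_i = \partial_i w = \sum_j F_ij x_j.  The twist
   gives f_i = \sum_j q_i^-1 x_j F_ji, so x, F, x^T are the maps of a complex of
   free A-modules on both sides.  Vanishing of Ext^0 and Ext^1 of K over A makes
   its right-hand version exact at the first two places; the remaining exactness
   statements follow from the relations of A, by induction on the degree, and
   from the bound 3 on the global dimension.

   In D the element Om = f_k satisfies u Om = Om sg(u), where sg scales x_i by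
   p_i.  Expanding Om c = 0 by means of the relations of D and using exactness
   over A gives c = \sum_j p_j x_j nu_j with Om nu_j = 0 in lower degree, so Om is
   regular.  The complex of A lifts to D up to a homotopy, and the cone of the
   multiplication by Om on the lift is exact on both sides, apart from K at the
   ends.  It gives Ext(K, D); filtering an arbitrary D-module by a basis over K
   and lifting the cone step by step gives projective dimension at most 4 for
   every module, and coinduced modules turn this into the bound on the injective
   dimension.

   The other properties pass from A to D through D / Om D = A: leading forms and
   the slices {y | Om^s y in J} for noetherianity, the expansion in powers of Om
   for the growth, and induction on the degree for domains. *)
Require Import Defs.
From HB Require Import structures.
From mathcomp Require Import all_boot all_order all_algebra generic_quotient finmap.
From mathcomp Require Import boolp classical_sets functions reals ereal sequences exp.
From mathcomp Require Import -(notations) monalg.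
From mathcomp Require Import zify lra.

Set Implicit Arguments.
Unset Strict Implicit.
Unset Printing Implicit Defensive.

Import Order.TTheory GRing.Theory Num.Theory.
Local Open Scope classical_set_scope.
Local Open Scope ring_scope.

(** * Submodules, projective and injective modules *)

(** The regularity of A supplies only some graded projective resolution of K, with nothing known
    about its terms, so the vanishing of Ext has to be carried over by hand to the matrices x, F,
    x^T. It speaks of columns only; the twisted symmetry of the second derivatives F_ij is what
    converts exactness for columns into exactness for rows. In D these matrices no longer compose to
    zero: F x = Om e_k and x^T F = q_k Om e_k^T. Both defects are divisible by Om, so constant
    matrices supported at the index k serve as the homotopy, and the cone has ranks 1, n+1, 2n, n+1,
    1. Global dimension quantifies over all modules, graded or not. A module M filtered by F_0 = M
    and F_(-1) = 0 has as associated graded module a sum of copies of K, one for each element of a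
    K-basis; hence a graded resolution of K, taken once for each basis element, deforms to a
    resolution of M of the same length. Injective dimension is then bounded by balancing Ext: finite
    projective resolutions are compared with an injective resolution built from modules Hom_K(S,
    E). *)

Section LinearMaps.
Variables (S : pzRingType) (M N : lmodType S).

Definition to_linear (f : M -> N) (hf : linear f) : {linear M -> N} :=
  HB.pack f (GRing.isLinear.Build S M N *:%R f hf).

End LinearMaps.

Section Submodules.
Variables (S : pzRingType) (M : lmodType S).

Definition submod_set (P : set M) : Prop :=
  P 0 /\ forall a x y, P x -> P y -> P (a *: x + y).

Definition mem_submod (P : set M) (hP : submod_set P) : {pred M} :=
  fun x => `[< P x >].

Variables (P : set M) (hP : submod_set P).

Lemma mem_submod_closed : submod_closed (mem_submod hP).
Proof.
case: (hP) => h0 h; split; first exact/asboolP.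
by move=> a x y /asboolP hx /asboolP hy; apply/asboolP/h.
Qed.

HB.instance Definition _ :=
  GRing.isSubmodClosed.Build S M (mem_submod hP) mem_submod_closed.

Definition submod : Type := {x : M | mem_submod hP x}.
HB.instance Definition _ := [isSub for (@sval M (mem_submod hP) : submod -> M)].
HB.instance Definition _ := [Choice of submod by <:].
HB.instance Definition _ := [SubChoice_isSubLmodule of submod by <:].

Definition submod_incl : {linear submod -> M} := (val : submod -> M).

Lemma submod_inclP (u : submod) : P (submod_incl u).
Proof. by case: u => x /= hx; apply/asboolP. Qed.

Lemma submod_incl_inj : injective submod_incl.
Proof. exact: val_inj. Qed.

Lemma submod_lift x : P x -> exists u, submod_incl u = x.
Proof. by move=> /asboolP hx; exists (exist _ x hx). Qed.

Lemma submod_corestr (N : lmodType S) (f : {linear N -> M}) :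
  (forall x, P (f x)) -> exists g : {linear N -> submod},
    forall x, submod_incl (g x) = f x.
Proof.
move=> hf; have /choice[g hg] : forall x, exists u, submod_incl u = f x.
  by move=> x; exact: submod_lift.
have lg : linear g.
  by move=> a x y; apply: submod_incl_inj; rewrite linearP !hg linearP.
by exists (to_linear lg).
Qed.

End Submodules.

Section Lifting.
Variable S : pzRingType.
Implicit Types M N : lmodType S.

Lemma image_submod M N (f : {linear M -> N}) :
  submod_set [set y | exists x, f x = y].
Proof.
split; first by exists 0; rewrite linear0.
by move=> a _ _ [x <-] [y <-]; exists (a *: x + y); rewrite linearP.
Qed.

Lemma kernel_submod M N (f : {linear M -> N}) : submod_set [set x | f x = 0].
Proof.
split=> [|a x y /= hx hy] /=; first exact: linear0.
by rewrite linearP hx hy scaler0 addr0.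
Qed.

(** Projectivity is stated for surjections; restricting the codomain of [d] to its image makes it
    one. *)
Lemma projective_lift (P M N : lmodType S) (d : {linear M -> N})
    (f : {linear P -> N}) :
  projective P -> (forall x, exists y, d y = f x) ->
  exists h : {linear P -> M}, forall x, d (h x) = f x.
Proof.
move=> hP hf; have hI := image_submod d.
have [f' hf'] : exists f' : {linear P -> submod hI},
  forall x, submod_incl hI (f' x) = f x by exact: submod_corestr.
have [d' hd'] : exists d' : {linear M -> submod hI},
  forall x, submod_incl hI (d' x) = d x.
  by apply: submod_corestr => x; exists x.
have [y|h hh] := hP _ _ d' f'.
  have [x hx] := submod_inclP y.
  by exists x; apply: submod_incl_inj; rewrite hd'.
by exists h => x; rewrite -hd' hh hf'.
Qed.

Lemma factor_linear M N (E : lmodType S) (d : {linear M -> N})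
    (f : {linear M -> E}) :
  (forall y, exists x, d x = y) -> (forall x, d x = 0 -> f x = 0) ->
  exists h : {linear N -> E}, forall x, f x = h (d x).
Proof.
move=> /choice[s hs] hf.
have hfs x : f (s (d x)) = f x.
  by apply/eqP; rewrite -subr_eq0 -(linearB f); apply/eqP/hf; rewrite (linearB d) hs subrr.
have lh : linear (fun y => f (s y)).
  move=> a x y; rewrite -linearP; apply/eqP; rewrite -subr_eq0 -(linearB f).
  by apply/eqP/hf; rewrite (linearB d) linearP !hs subrr.
by exists (to_linear lh) => x; rewrite [RHS]hfs.
Qed.

(** The map [d] need not be injective, but [f] factors through the image of [d], whose inclusion in
    [N] is. *)
Lemma injective_extend M N (E : lmodType S) (d : {linear M -> N})
    (f : {linear M -> E}) :
  injective_module E -> (forall x, d x = 0 -> f x = 0) ->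
  exists h : {linear N -> E}, forall x, f x = h (d x).
Proof.
move=> hE hf; have hI := image_submod d.
have [d' hd'] : exists d' : {linear M -> submod hI},
  forall x, submod_incl hI (d' x) = d x.
  by apply: submod_corestr => x; exists x.
have [y|x|f' hf'] := @factor_linear _ _ _ d' f.
- have [x hx] := submod_inclP y.
  by exists x; apply: submod_incl_inj; rewrite hd'.
- by move=> hx; apply: hf; rewrite -hd' hx linear0.
have [|h hh] := hE _ _ (submod_incl hI) f'; first exact: submod_incl_inj.
by exists h => x; rewrite hf' -hh hd'.
Qed.

(* For an exact complex G of projectives and an exact complex I of injectives,
   with d : G_i -> G_(i-1) and delta : I_j -> I_(j+1), this expresses that the
   cocycles of bidegree (i, j) in Hom(G, I) come from Hom(G_(i-1), I_j). *)
Definition ext_trivial M N (I J : lmodType S) (d : {linear M -> N})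
    (delta : {linear I -> J}) : Prop :=
  forall f : {linear M -> I}, (forall x, d x = 0 -> f x = 0) ->
    (forall x, delta (f x) = 0) ->
    exists h : {linear N -> I},
      (forall x, delta (h x) = 0) /\ forall x, f x = h (d x).

Section Balance.
Variables (G2 G1 G0 I0 I1 I2 : lmodType S).
Variables (d2 : {linear G2 -> G1}) (d1 : {linear G1 -> G0}).
Variables (e0 : {linear I0 -> I1}) (e1 : {linear I1 -> I2}).
Hypothesis d_exact : forall x, d1 x = 0 <-> exists y, d2 y = x.
Hypothesis e_exact : forall x, e1 x = 0 <-> exists y, e0 y = x.
Hypothesis I0_inj : injective_module I0.

(** Dimension shifting in each variable: for projective G and injective I, both instances of
    [ext_trivial] express that Ext^2(coker d1, ker e0) vanishes. *)
Lemma ext_trivial_down :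
  projective G0 -> ext_trivial d1 e1 -> ext_trivial d2 e0.
Proof.
move=> G0_proj h1 f hf ef.
have [h hh] := injective_extend I0_inj hf.
have [x /d_exact[y <-]|x|g [eg hg]] := h1 (e0 \o h : {linear G1 -> I1}).
- by rewrite /= -hh ef.
- by apply/e_exact; exists (h x).
have [|g' hg'] := @projective_lift _ _ _ e0 g G0_proj.
  by move=> x; apply/e_exact; rewrite eg.
exists (h \- (g' \o d1) : {linear G1 -> I0}); split=> x /=.
  by rewrite linearB /= hg' -hg subrr.
have -> : d1 (d2 x) = 0 by apply/d_exact; exists x.
by rewrite linear0 subr0.
Qed.

Lemma ext_trivial_up :
  projective G1 -> ext_trivial d2 e0 -> ext_trivial d1 e1.
Proof.
move=> G1_proj h2 f hf ef.
have [|h hh] := @projective_lift _ _ _ e0 f G1_proj.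
  by move=> x; apply/e_exact; rewrite ef.
have [x /= hx|x|h' [eh' hh']] := h2 (h \o d2 : {linear G2 -> I0}).
- by rewrite hx linear0.
- by rewrite /= hh hf //; apply/d_exact; exists x.
have [x /d_exact[y <-]|g hg] :=
  @injective_extend _ _ _ d1 (h \- h' : {linear G1 -> I0}) I0_inj.
  by rewrite /= -hh' /= subrr.
exists (e0 \o g : {linear G0 -> I1}); split=> x /=.
  by apply/e_exact; exists (g x).
by rewrite -hg /= linearB /= eh' subr0 hh.
Qed.

End Balance.
End Lifting.

(** * Free modules, linear complements and coinduced modules *)

Section FreeModules.
Variables (S : nzRingType) (Y : choiceType) (M : lmodType S).
Implicit Types (v : Y -> M) (g : malg Y S).

Definition malg_ev v g : M := \sum_(y <- msupp g) mcoeff y g *: v y.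

Lemma malg_evEw v g (d : {fset Y}) : (msupp g `<=` d)%fset ->
  malg_ev v g = \sum_(y <- d) mcoeff y g *: v y.
Proof.
move=> hd; rewrite /malg_ev (big_fset_incl _ hd) //.
by move=> x _ /mcoeff_outdom ->; rewrite scale0r.
Qed.

Lemma malg_ev_is_linear v : linear (malg_ev v).
Proof.
move=> a g h; pose d := (msupp g `|` msupp h)%fset.
rewrite !(@malg_evEw v _ d) ?fsubsetUl ?fsubsetUr //; last first.
  apply: fsubset_trans (msuppD_le _ _) _.
  by rewrite fsetUSS // msuppZ_le.
rewrite scaler_sumr -big_split /=; apply: eq_bigr => y _.
by rewrite mcoeffD mcoeffZ scalerDl scalerA.
Qed.

HB.instance Definition _ v :=
  GRing.isLinear.Build S (malg Y S) M *:%R (malg_ev v) (malg_ev_is_linear v).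

Lemma malg_evU v y a : malg_ev v (mkmalgU y a) = a *: v y.
Proof. by rewrite (malg_evEw _ msuppU_le) big_seq_fset1 mcoeffUU. Qed.

Lemma malg_linearE (f : {linear malg Y S -> M}) g :
  f g = malg_ev (fun y => f (mkmalgU y 1)) g.
Proof.
rewrite {1}[g]monalgE linear_sum; apply: eq_bigr => y _.
rewrite -linearZ; congr (f _); apply/malgP => z.
by rewrite mcoeffZ !mcoeffU; case: eqP => _; rewrite ?mulr1 // mulr0.
Qed.

End FreeModules.

Lemma malg_projective (S : nzRingType) (Y : choiceType) :
  projective (malg Y S : lmodType S).
Proof.
move=> M N d f hd.
have /choice[v hv] : forall y : Y, exists x, d x = f (mkmalgU y 1).
  by move=> y; exact: hd.
exists (malg_ev v) => g; rewrite [RHS]malg_linearE linear_sum.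
by apply: eq_bigr => y _; rewrite linearZ hv.
Qed.

Section Complement.
Variables (K : fieldType) (M : lmodType K) (W : set M).
Hypothesis W_sub : submod_set W.

Let supported (X : set M) (g : malg M K) := forall x, x \in msupp g -> X x.

(** Zorn's lemma for the families that are independent modulo [W]; a maximal one represents a basis
    of M/W by elements of M. *)
Lemma relative_basis : exists X : set M,
  (forall g, supported X g -> W (malg_ev id g) -> g = 0) /\
  (forall u, exists2 g, supported X g & W (u - malg_ev id g)).
Proof.
have [W0 WP] := W_sub.
pose free (X : set M) := forall g, supported X g -> W (malg_ev id g) -> g = 0.
have [F freeF totF|X [freeX maxX]] := @Zorn_bigcup M free.
  move=> g sg Wg.
  (* A finite support lies in a single member of the chain. The empty support is set apart because
     the chain may be empty. *)
  have key : enum_fset (msupp g) = [::] \/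
      exists2 X, F X & forall x, x \in enum_fset (msupp g) -> X x.
    have : forall x, x \in enum_fset (msupp g) -> exists2 X, F X & X x.
      by move=> x /sg[X FX Xx]; exists X.
    elim: (enum_fset _) => [|x s ih] hs; [by left|right].
    have [Y FY Yx] := hs x (mem_head _ _).
    have [z zs|->|[Z FZ Zs]] := ih.
    - by apply: hs; rewrite inE zs orbT.
    - by exists Y => // z; rewrite inE => /eqP ->.
    have [YZ|ZY] := totF _ _ FY FZ.
      by exists Z => // z; rewrite inE => /orP[/eqP ->|/Zs //]; exact: YZ.
    by exists Y => // z; rewrite inE => /orP[/eqP -> //|/Zs]; exact: ZY.
  case: key => [g0|[X FX hX]]; last exact: (freeF X).
  apply/malgP => x; rewrite mcoeff0 mcoeff_outdom //.
  by rewrite -[_ \in _]/(x \in enum_fset _) g0.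
exists X; split; first exact: freeX.
move=> u; apply: boolp.contrapT => hu.
have nXu : ~ X u.
  move=> Xu; apply: hu; exists (mkmalgU u 1).
    by move=> x /(fsubsetP msuppU_le); rewrite in_fset1 => /eqP ->.
  by rewrite malg_evU scale1r subrr.
apply: (maxX (X `|` [set u])).
  by split=> [|h]; [exact: subsetUl|apply: nXu; apply: h; right].
move=> g sg Wg; apply: boolp.contrapT => g0; have [gu|gu] := eqVneq (mcoeff u g) 0.
  apply: g0; apply: freeX => // x xg; have [//|/= xu] := sg x xg.
  by move: xg; rewrite xu -mcoeff_neq0 gu eqxx.
(* In a relation that involves [u], dividing by the coefficient of [u] expresses [u] through [X]
   modulo [W]. *)
apply: hu; pose h := g - mkmalgU u (mcoeff u g).
exists (- (mcoeff u g)^-1 *: h).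
  move=> x /(fsubsetP (msuppZ_le _ _)); rewrite -mcoeff_neq0 mcoeffB mcoeffU.
  have [->|xu] := eqVneq u x; first by rewrite mulr1n subrr eqxx.
  rewrite mulr0n subr0 mcoeff_neq0 => /sg[//|/= h0].
  by rewrite h0 eqxx in xu.
rewrite linearZ linearB /= malg_evU scaleNr opprK scalerBr scalerA mulVf // scale1r.
by rewrite addrC subrK -[_ *: _]addr0; exact: WP.
Qed.

(** The projection onto a linear complement of [W]. It plays the role of the quotient map to M/W
    while staying inside M. *)
Lemma exists_projection : exists f : {linear M -> M},
  (forall u, f u = 0 <-> W u) /\ forall u, W (u - f u).
Proof.
have [X [freeX /(_ _)/cid2-/all_sig2[g sg Wg]]] := relative_basis; have [W0 WP] := W_sub.
have WB u v : W u -> W v -> W (u - v).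
  by move=> Wu Wv; rewrite addrC -scaleN1r; exact: WP.
have lg : linear g.
  move=> a u v; apply/eqP; rewrite -subr_eq0; apply/eqP/freeX.
    move=> x; rewrite -mcoeff_neq0 mcoeffB mcoeffD mcoeffZ => hx.
    have [gx|gx] := eqVneq (mcoeff x (g (a *: u + v))) 0; last first.
      by apply: (sg (a *: u + v)); rewrite -mcoeff_neq0.
    have [gu|gu] := eqVneq (mcoeff x (g u)) 0; last first.
      by apply: (sg u); rewrite -mcoeff_neq0.
    have [gv|gv] := eqVneq (mcoeff x (g v)) 0; last first.
      by apply: (sg v); rewrite -mcoeff_neq0.
    by rewrite gx gu gv mulr0 addr0 subrr eqxx in hx.
  have -> : malg_ev id (g (a *: u + v) - (a *: g u + g v)) =
      a *: (u - malg_ev id (g u)) + (v - malg_ev id (g v)) -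
      (a *: u + v - malg_ev id (g (a *: u + v))).
    rewrite linearB linearP /= scalerBr opprB [X in _ = X + _]addrACA -opprD.
    by rewrite [RHS]addrC addrA subrK.
  by apply: WB (Wg _); apply: WP; exact: Wg.
exists (malg_ev id \o to_linear lg); split=> // u; split=> /= [h|Wu].
  by have := Wg u; rewrite h subr0.
suff -> : g u = 0 by rewrite linear0.
apply: freeX => //; rewrite -[malg_ev _ _](subKr u); exact: WB.
Qed.

End Complement.

Section Coinduced.
Variables (K : fieldType) (S : algType K).

(** An alias that carries the K-structure through [c%:A], kept apart from the S-structure of [M]. *)
Definition restrict_scalars (M : lmodType S) : Type := M.

Section Restriction.
Variable M : lmodType S.
HB.instance Definition _ := GRing.Zmodule.on (restrict_scalars M).

Definition restrict_scale (c : K) (x : restrict_scalars M) :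
  restrict_scalars M := c%:A *: (x : M).

Lemma restrict_scaleA a b x :
  restrict_scale a (restrict_scale b x) = restrict_scale (a * b) x.
Proof. by rewrite /restrict_scale scalerA mulr_algl scalerA. Qed.
Lemma restrict_scale1 : left_id 1 restrict_scale.
Proof. by move=> x; rewrite /restrict_scale !scale1r. Qed.
Lemma restrict_scaleDr : right_distributive restrict_scale +%R.
Proof. by move=> c x y; rewrite /restrict_scale scalerDr. Qed.
Lemma restrict_scaleDl x : {morph restrict_scale^~ x : a b / a + b}.
Proof. by move=> a b; rewrite /restrict_scale !scalerDl. Qed.

HB.instance Definition _ :=
  GRing.Zmodule_isLmodule.Build K (restrict_scalars M)
    restrict_scaleA restrict_scale1 restrict_scaleDr restrict_scaleDl.
End Restriction.

Section Coinduction.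
Variable E : lmodType S.

Definition klinear (f : S -> E) : Prop :=
  forall (c : K) a b, f (c *: a + b) = c%:A *: f a + f b.

Definition mem_klinear : {pred (S -> E)} := fun f => `[< klinear f >].

Lemma mem_klinear_closed : zmod_closed mem_klinear.
Proof.
split=> [|f g /asboolP hf /asboolP hg]; apply/asboolP => c a b.
  by rewrite scaler0 addr0.
rewrite -[LHS]/(f _ - g _) hf hg -[(f - g) a]/(f a - g a).
by rewrite -[(f - g) b]/(f b - g b) scalerBr opprD addrACA.
Qed.
HB.instance Definition _ :=
  GRing.isZmodClosed.Build (S -> E) mem_klinear mem_klinear_closed.

(* Hom_K(S, E), on which b acts by (b f)(a) = f(a b). *)
Definition coind : Type := {f : S -> E | mem_klinear f}.
HB.instance Definition _ := [isSub for (@sval _ mem_klinear : coind -> (S -> E))].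
HB.instance Definition _ := [Choice of coind by <:].
HB.instance Definition _ := [SubChoice_isSubZmodule of coind by <:].

Definition coind_ev (f : coind) (a : S) : E := val f a.

Lemma coind_evP f : klinear (coind_ev f).
Proof. by case: f => f hf; apply/asboolP. Qed.
Lemma coind_ext f g : coind_ev f =1 coind_ev g -> f = g.
Proof. by move=> h; apply/val_inj/funext. Qed.
Lemma coind_evD f g a : coind_ev (f + g) a = coind_ev f a + coind_ev g a.
Proof. by []. Qed.
Lemma coind_evDr f a b : coind_ev f (a + b) = coind_ev f a + coind_ev f b.
Proof. by rewrite -[a]scale1r coind_evP !scale1r. Qed.

Lemma coind_evZr f c a : coind_ev f (c *: a) = c%:A *: coind_ev f a.
Proof.
have := coind_evP f c a 0; rewrite addr0 => ->; rewrite -[RHS]addr0; congr (_ + _).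
by have /eqP := coind_evDr f 0 0; rewrite addr0 -{1}[coind_ev f 0]addr0 (inj_eq (addrI _))
  eq_sym => /eqP.
Qed.

Definition to_coind (f : S -> E) (hf : klinear f) : coind :=
  exist _ f (introT (asboolP _) hf).

Lemma coind_scale_subproof (b : S) (f : coind) :
  klinear (fun a => coind_ev f (a * b)).
Proof. by move=> c a a'; rewrite mulrDl -scalerAl coind_evP. Qed.
Definition coind_scale (b : S) (f : coind) : coind :=
  to_coind (coind_scale_subproof b f).

Lemma coind_scaleA a b x :
  coind_scale a (coind_scale b x) = coind_scale (a * b) x.
Proof. by apply/coind_ext => c; rewrite /coind_ev /= mulrA. Qed.
Lemma coind_scale1 : left_id 1 coind_scale.
Proof. by move=> x; apply/coind_ext => c; rewrite /coind_ev /= mulr1. Qed.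
Lemma coind_scaleDr : right_distributive coind_scale +%R.
Proof. by move=> a x y; apply/coind_ext => c. Qed.
Lemma coind_scaleDl x : {morph coind_scale^~ x : a b / a + b}.
Proof. by move=> a b; apply/coind_ext => c; exact: etrans (congr1 _ (mulrDr _ _ _)) (coind_evDr
  _ _ _). Qed.

HB.instance Definition _ := GRing.Zmodule_isLmodule.Build S coind
  coind_scaleA coind_scale1 coind_scaleDr coind_scaleDl.

Lemma coind_evZ b f a : coind_ev (b *: f) a = coind_ev f (a * b).
Proof. by []. Qed.

End Coinduction.

Lemma scale_algl (M : lmodType S) (c : K) (a : S) (x : M) :
  (c *: a) *: x = c%:A *: (a *: x).
Proof. by rewrite scalerA mulr_algl. Qed.

Lemma klinear_scale (E M : lmodType S) (f : {linear restrict_scalars M -> restrict_scalars E})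
  (x : M) :
  klinear (fun a : S => (f (a *: x : M) : E)).
Proof.
move=> c a b; rewrite scalerDl scale_algl.
exact: (linearP f c (a *: x : M) (b *: x : M)).
Qed.

(** The adjunction Hom_S(M, Hom_K(S, E)) = Hom_K(M, E). Through it the extension of linear maps from
    a subspace, possible over a field, becomes injectivity of [coind E]. *)
Lemma coind_adjoint (E M : lmodType S)
    (f : {linear restrict_scalars M -> restrict_scalars E}) :
  exists h : {linear M -> coind E}, forall x a, coind_ev (h x) a = f (a *: x : M).
Proof.
pose h x := to_coind (klinear_scale f x).
suff lh : linear h by exists (to_linear lh).
move=> a x y; apply/coind_ext => b; rewrite coind_evD coind_evZ.
rewrite /coind_ev /= scalerDr scalerA.
exact: (linearD f (_ : restrict_scalars M) (_ : restrict_scalars M)).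
Qed.

Lemma restrict_submod (M : lmodType S) (W : set M) :
  submod_set W -> submod_set (W : set (restrict_scalars M)).
Proof. by case=> W0 WP; split=> // a x y Wx Wy; exact: WP. Qed.

Lemma restrict_linear_subproof (M N : lmodType S) (f : {linear M -> N}) :
  linear (f : restrict_scalars M -> restrict_scalars N).
Proof. by move=> a x y; exact: linearP. Qed.
Definition restrict_linear (M N : lmodType S) (f : {linear M -> N}) :=
  to_linear (restrict_linear_subproof f).

Lemma klinear_extend (M N E : lmodType S) (d : {linear M -> N})
    (f : {linear restrict_scalars M -> restrict_scalars E}) : injective d ->
  exists h : {linear restrict_scalars N -> restrict_scalars E},
    forall x : M, h (d x) = f x.
Proof.
move=> d_inj.
have [pr [pr0 pr1]] := exists_projection (restrict_submod (image_submod d)).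
have /choice[s hs] : forall y : restrict_scalars N, exists x : restrict_scalars M,
  restrict_linear d x = y - pr y by move=> y; exact: pr1.
have ls : linear s.
  move=> c x y; apply: d_inj; rewrite -[LHS]/(restrict_linear d _) hs.
  rewrite -[RHS]/(restrict_linear d _) [RHS]linearP !hs linearP.
  by rewrite scalerBr opprD addrACA.
exists (f \o to_linear ls) => x /=; congr (f _); apply: d_inj.
rewrite -[LHS]/(restrict_linear d _) hs; have /pr0 -> : exists z, d z = d x.
  by exists x.
by rewrite subr0.
Qed.

Lemma coind_injective (E : lmodType S) : injective_module (coind E : lmodType S).
Proof.
move=> M N d f d_inj.
pose f1 (x : restrict_scalars M) : restrict_scalars E := coind_ev (f x) 1.
have lf1 : linear f1.
  move=> c x y; rewrite /f1 (linearP f c%:A (x : M) (y : M)).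
  by rewrite coind_evD coind_evZ mul1r coind_evZr.
have [h1 hh1] := klinear_extend (to_linear lf1) d_inj.
have [h hh] := coind_adjoint h1; exists h => x; apply/coind_ext => a.
rewrite hh -linearZ; apply: etrans (hh1 _) _.
by rewrite -[LHS]/(coind_ev (f (a *: x)) 1) linearZ coind_evZ mul1r.
Qed.

Definition injective_coker (N1 N2 : lmodType S) (g : {linear N1 -> N2}) : Prop :=
  exists (E : lmodType S) (c : {linear N2 -> E}),
  [/\ injective_module E, forall y, c y = 0 <-> exists x, g x = y
    & forall z, exists y, c y = z].

(** The last clause makes a resolution built from this choice stop as soon as a cokernel is
    injective. In the other case [y] is sent to the function a |-> pr(a y), where the K-linear [pr]
    has kernel the image of [g]; since that image is a submodule, the function vanishes exactly when
    [y] lies in it. *)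
Lemma coker_embed (N1 N2 : lmodType S) (g : {linear N1 -> N2}) :
  exists (E : lmodType S) (c : {linear N2 -> E}),
  [/\ injective_module E, forall y, c y = 0 <-> exists x, g x = y
    & injective_coker g -> forall z, exists y, c y = z].
Proof.
have [[E' [c' [h1 h2 h3]]]|nInj] := pselect (injective_coker g).
  by exists E', c'; split.
have [pr [pr0 _]] := exists_projection (restrict_submod (image_submod g)).
have [c hc] := coind_adjoint pr.
exists (coind N2 : lmodType S), c; split=> //; first exact: coind_injective.
move=> y; split=> [cy|[x <-]].
  apply/pr0; have := hc y 1; rewrite scale1r => <-.
  by rewrite cy.
apply/coind_ext => a; rewrite hc -linearZ.
by apply/pr0; exists (a *: x).
Qed.

End Coinduced.

Section ZeroMap.
Variables (S : pzRingType) (M N : lmodType S).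

Lemma zero_map_subproof : linear (fun _ : M => 0 : N).
Proof. by move=> a x y; rewrite scaler0 addr0. Qed.
Definition zero_map := to_linear zero_map_subproof.

End ZeroMap.

Lemma injective_range_lift (S : pzRingType) (M X I : lmodType S) (c : {linear X -> I})
    (f : {linear M -> I}) : injective c -> (forall x, exists y, c y = f x) ->
  exists h : {linear M -> X}, forall x, c (h x) = f x.
Proof.
move=> c_inj /choice[h hh]; suff lh : linear h by exists (to_linear lh).
by move=> a x y; apply: c_inj; rewrite linearP !hh linearP.
Qed.

(** * Injective resolutions and the bound of injective by projective dimension *)

Section InjectiveDimension.
Variables (K : fieldType) (S : algType K).

Lemma zero_injective (E : lmodType S) : (forall x : E, x = 0) -> injective_module E.
Proof. by move=> E0 M N g f _; exists (zero_map _ _) => x; rewrite [RHS]E0 [LHS]E0. Qed.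

(** The state of a recursion in which each step embeds the cokernel of the current map in an
    injective module. Starting from the zero map of [X], whose cokernel is [X], it produces an
    injective resolution of [X]. *)
Record coseq := Coseq {
  coseq_dom : lmodType S;
  coseq_cod : lmodType S;
  coseq_map : {linear coseq_dom -> coseq_cod}
}.

Lemma coseq_next_exists (t : coseq) :
  {E : lmodType S & {c : {linear coseq_cod t -> E} |
    [/\ injective_module E, forall y, c y = 0 <-> exists x, coseq_map t x = y
      & injective_coker (coseq_map t) -> forall z, exists y, c y = z]}}.
Proof.
by have [E /cid[c hc]] := cid (coker_embed (coseq_map t)); exists E, c.
Qed.

Definition coseq_next (t : coseq) : coseq :=
  Coseq (sval (projT2 (coseq_next_exists t))).

Lemma coseq_nextP (t : coseq) :
  [/\ injective_module (coseq_cod (coseq_next t)),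
    forall y, coseq_map (coseq_next t) y = 0 <-> exists x, coseq_map t x = y
    & injective_coker (coseq_map t) ->
      forall z, exists y, coseq_map (coseq_next t) y = z].
Proof. exact: svalP (projT2 (coseq_next_exists t)). Qed.

Variable X : lmodType S.

Fixpoint coseq_iter (i : nat) : coseq :=
  if i is i'.+1 then coseq_next (coseq_iter i') else Coseq (zero_map X X).

Definition injres_mod (i : nat) : lmodType S := coseq_cod (coseq_iter i.+1).
Definition injres_d (i : nat) : {linear injres_mod i -> injres_mod i.+1} :=
  coseq_map (coseq_iter i.+2).
Definition injres_coaug : {linear X -> injres_mod 0} := coseq_map (coseq_iter 1).

Lemma injres_injective i : injective_module (injres_mod i).
Proof. by case: (coseq_nextP (coseq_iter i)). Qed.

Lemma injres_exact i x : injres_d i.+1 x = 0 <-> exists y, injres_d i y = x.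
Proof. by case: (coseq_nextP (coseq_iter i.+2)). Qed.

Lemma injres_exact0 x : injres_d 0 x = 0 <-> exists y, injres_coaug y = x.
Proof. by case: (coseq_nextP (coseq_iter 1)). Qed.

Lemma injres_coaug_inj : injective injres_coaug.
Proof.
case: (coseq_nextP (coseq_iter 0)) => _ h _ x y hxy.
apply/eqP; rewrite -subr_eq0; apply/eqP.
have /h[z <-//] : injres_coaug (x - y) = 0 by rewrite linearB hxy subrr.
Qed.

Definition injres : inj_resolution X :=
  InjResolution injres_injective injres_coaug_inj injres_exact0 injres_exact.

(** For j = 0 the source C_(e+1) is zero; dimension shifting spreads this to all i + j = e. *)
Lemma ext_trivial_injres (M : lmodType S) (C : proj_resolution M) e :
  (forall i, (e < i)%N -> forall x : C i, x = 0) ->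
  forall j i, (i + j)%N = e -> ext_trivial (pres_d C i) (injres_d j).
Proof.
move=> C0; elim=> [|j ih] i hij.
  move=> f _ _; exists (zero_map _ _); split=> x /=; first exact: linear0.
  by rewrite (C0 i.+1 _ x) ?linear0 // ltnS -hij addn0.
apply: ext_trivial_up (ih i.+1 _); last by rewrite addSnnS.
- by move=> x; exact: pres_exact.
- exact: injres_exact.
- exact: injres_injective.
- exact: pres_projective.
Qed.

(** The hypothesis amounts to Ext^1(M, ker delta) = 0 and is applied to M = N2 / g(N1). A resolution
    of this M maps to N2 by [p0] and to N1 by [p1], so N2 is generated by g(N1) and p0(C_0), and an
    extension of [f] can be glued from [f] and a map on C_0. *)
Lemma ext_trivial_submod_injective (I J : lmodType S) (delta : {linear I -> J}) :
  (forall M : lmodType S, exists C : proj_resolution M,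
    ext_trivial (pres_d C 0) delta) ->
  injective_module (submod (kernel_submod delta) : lmodType S).
Proof.
move=> hext N1 N2 g f g_inj.
have [E [c0 [_ hc0 _]]] := coker_embed g.
have [c hc] := submod_corestr (image_submod c0) (fun x => ex_intro _ x erefl).
have cE x : c x = 0 <-> exists y, g y = x.
  rewrite -hc0 -hc; split=> [->|h]; first by rewrite linear0.
  by apply: submod_incl_inj; rewrite h linear0.
have c_surj y : exists x, c x = y.
  have [x hx] := submod_inclP y; exists x; apply: submod_incl_inj.
  by rewrite hc.
have [C hC] := hext (submod (image_submod c0)).
have [x|p0 hp0] := @projective_lift _ _ _ _ c (pres_aug C) (@pres_projective _ _ C 0).
  by have [y hy] := c_surj (pres_aug C x); exists y.
have [x|p1 hp1] := @projective_lift _ _ _ _ g (p0 \o pres_d C 0) (@pres_projective _ _ C 1).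
  by apply/cE; rewrite /= hp0; apply/pres_exact0; exists x.
pose i := submod_incl (kernel_submod delta).
have [x hx|x|h [dh hh]] := hC (i \o (f \o p1)).
- rewrite /=; suff -> : p1 x = 0 by rewrite !linear0.
  by apply: g_inj; rewrite hp1 /= hx !linear0.
- exact: (submod_inclP (f (p1 x))).
(* [s] maps N1 x C_0 onto N2 and its relations come from C_1, where the contributions of [f] and [h]
   cancel; hence [r] factors through [s]. *)
pose s (u : N1 * C 0) : N2 := g u.1 + p0 u.2.
have ls : linear s.
  by move=> a [x1 x2] [y1 y2]; rewrite /s /= !linearP scalerDr addrACA.
pose r (u : N1 * C 0) : I := i (f u.1) + h u.2.
have lr : linear r.
  by move=> a [x1 x2] [y1 y2]; rewrite /r /= !linearP scalerDr addrACA.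
have s_surj y : exists u, to_linear ls u = y.
  have [z hz] := pres_surj C (c y).
  have [x hx] : exists x, g x = y - p0 z by apply/cE; rewrite linearB hp0 hz subrr.
  by exists (x, z); rewrite -[LHS]/(g x + p0 z) hx subrK.
have [[a x] su|H hH] := factor_linear (f := to_linear lr) s_surj.
  have {}su : g a + p0 x = 0 by [].
  have /pres_exact0[y xE] : pres_aug C x = 0.
    rewrite -hp0; apply/cE; exists (- a); rewrite linearN.
    by apply/eqP; rewrite eqr_oppLR -addr_eq0 su.
  have aE : a = - p1 y.
    apply: g_inj; rewrite linearN hp1 /= xE.
    by apply/eqP; rewrite -addr_eq0 su.
  by rewrite -[LHS]/(i (f a) + h x) -xE -hh aE !linearN /= addNr.
have dH y : delta (H y) = 0.
  have [[a x] <-] := s_surj y; rewrite -hH -[to_linear lr _]/(i (f a) + h x).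
  by rewrite linearD dh addr0; exact: (submod_inclP (f a)).
have [H' hH'] := submod_corestr (kernel_submod delta) dH.
exists H' => x; apply: submod_incl_inj; rewrite hH'.
have := hH (x, 0); rewrite -[to_linear ls _]/(g x + p0 0) linear0 addr0 => <-.
by rewrite -[LHS]/(i (f x) + h 0) linear0 addr0.
Qed.

(** This cokernel is the image of the next map, that is the kernel of the one after it, and
    resolutions of length e for all modules make that kernel injective. *)
Lemma injres_coker_injective e : (forall M : lmodType S, projdim_le M e) ->
  injective_coker (coseq_map (coseq_iter e)).
Proof.
move=> pd; have [_ h1 _] := coseq_nextP (coseq_iter e).
have [_ h2 _] := coseq_nextP (coseq_iter e.+1).
exists (submod (kernel_submod (coseq_map (coseq_iter e.+2)))).
have [x|c hc] := @submod_corestr _ _ _ (kernel_submod (coseq_map (coseq_iter e.+2)))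
  _ (coseq_map (coseq_iter e.+1)).
  by apply/h2; exists x.
exists c; split=> [|y|z].
- apply: ext_trivial_submod_injective => M; have [C C0] := pd M.
  by exists C; exact: (ext_trivial_injres C0 (add0n e)).
- rewrite -h1 -[coseq_next _]/(coseq_iter e.+1) -hc.
  split=> [->|h]; first by rewrite linear0.
  by apply: submod_incl_inj; rewrite h linear0.
- have /h2[y hy] := submod_inclP z; exists y; apply: submod_incl_inj.
  by rewrite hc.
Qed.

Lemma injres_map_surj e : (forall M : lmodType S, projdim_le M e) ->
  forall j, (e <= j)%N -> forall z, exists y, coseq_map (coseq_iter j.+1) y = z.
Proof.
(* A surjective map has zero cokernel, which is injective, so surjectivity propagates to the later
   maps. *)
move=> pd; have surjS t : (forall z, exists y, coseq_map t y = z) ->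
    injective_coker (coseq_map t).
  move=> t_surj; have [hi he _] := coseq_nextP t.
  exists (submod (image_submod (coseq_map (coseq_next t)))).
  have [c hc] := submod_corestr (image_submod (coseq_map (coseq_next t)))
    (fun x => ex_intro _ x erefl).
  have c0 y : coseq_map (coseq_next t) y = 0 by apply/he.
  have z0 (z : submod (image_submod (coseq_map (coseq_next t)))) : z = 0.
    by have [y hy] := submod_inclP z; apply: submod_incl_inj; rewrite -hy c0 linear0.
  exists c; split=> [|y|z]; first exact: zero_injective.
    by split=> _; [apply/he|]; rewrite ?c0 // [c y]z0.
  by exists 0; rewrite [LHS]z0 [RHS]z0.
move=> j; elim: j => [|j ih]; rewrite leq_eqVlt => /orP[/eqP ej|//].
- have [_ _] := coseq_nextP (coseq_iter 0); apply; rewrite -ej in pd *.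
  exact: injres_coker_injective.
- by have [_ _] := coseq_nextP (coseq_iter j.+1); apply; rewrite -ej in pd *;
  exact: injres_coker_injective.
- by move/ih => h; have [_ _] := coseq_nextP (coseq_iter j.+1); apply; exact: surjS.
Qed.

Lemma projdim_injdim_le e : (forall M : lmodType S, projdim_le M e) ->
  injdim_le X e.
Proof.
move=> pd; exists injres => -[//|i]; rewrite ltnS => ei z.
(* Past the place e two successive maps are surjective and compose to zero. *)
have [y <-] := @injres_map_surj e pd i.+1 (leqW ei) z.
have [t <-] := @injres_map_surj e pd i ei y.
have [_ h _] := coseq_nextP (coseq_iter i.+1).
by apply/h; exists t.
Qed.

End InjectiveDimension.

Section ExtVanishing.
Variables (S : pzRingType) (X : lmodType S).
Variables (G : nat -> lmodType S) (d : forall i, {linear G i.+1 -> G i}) (e : nat).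
Hypothesis G_projective : forall i, (i < e)%N -> projective (G i).
Hypothesis d_exact : forall i x, (i < e)%N -> d i x = 0 <-> exists y, d i.+1 y = x.

Lemma injdim_le_ext_trivial (C : inj_resolution X) :
  (forall i, (e < i)%N -> forall x : C i, x = 0) ->
  forall j i, (i + j)%N = e -> ext_trivial (d i) (ires_d C j).
Proof.
move=> C0 j i; elim: i j => [|i ih] j hij.
  move=> f hf _; have [h hh] := injective_extend (@ires_injective _ _ C j) hf.
  exists h; split=> // x; apply: C0; by rewrite -hij.
have ie : (i < e)%N by rewrite -hij addSn ltnS leq_addr.
apply: ext_trivial_down (ih j.+1 _); last by rewrite addnS -addSn.
- by move=> x; exact: d_exact.
- by move=> x; exact: ires_exact.
- exact: ires_injective.
- exact: G_projective.
Qed.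

(** This is the vanishing of Ext^(e+1)(coker d_0, X), read off the complex [G] by dimension shifting
    along an injective resolution of length e. *)
Lemma injdim_le_extend (f : {linear G e.+1 -> X}) :
  injdim_le X e -> (forall x, d e x = 0 -> f x = 0) ->
  exists h : {linear G e -> X}, forall x, f x = h (d e x).
Proof.
move=> [C C0] hf.
have [x hx|x|h [dh hh]] :=
  injdim_le_ext_trivial C0 (addn0 e) (f := ires_coaug C \o f).
- by rewrite /= hf // linear0.
- by apply/ires_exact0; exists (f x).
have [x|h' hh'] := injective_range_lift (@ires_inj _ _ C) (f := h).
  by apply/ires_exact0; exact: dh.
by exists h' => x; apply: (@ires_inj _ _ C); rewrite hh' -hh.
Qed.

End ExtVanishing.

(** * Graded rings and the tensor algebra *)

Section NatGrading.
Variable S : pzRingType.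

(** Encoded by the projections to the components, which apply to any element without a chosen
    decomposition. Additivity is enough: over K, linearity follows from the scalars having degree
    0. *)
Record nat_grading := NatGrading {
  gcomp : nat -> {additive S -> S};
  gcomp_gcomp : forall d e x, gcomp d (gcomp e x) = if d == e then gcomp e x else 0;
  gcomp_bound : forall x, exists N, forall d, (N <= d)%N -> gcomp d x = 0;
  gcomp_ext0 : forall x, (forall d, gcomp d x = 0) -> x = 0;
  gcompM : forall d x y,
    gcomp d (x * y) = \sum_(i < d.+1) gcomp i x * gcomp (d - i) y
}.

Variable g : nat_grading.

Definition homog (d : nat) (x : S) : Prop := gcomp g d x = x.

Lemma gcomp_homog d e x : homog e x -> gcomp g d x = if d == e then x else 0.
Proof. by move=> hx; rewrite -hx gcomp_gcomp. Qed.

Lemma homog_gcomp d x : homog d (gcomp g d x).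
Proof. by rewrite /homog gcomp_gcomp eqxx. Qed.

Lemma homog0 d : homog d 0.
Proof. exact: raddf0. Qed.

Lemma homogB d x y : homog d x -> homog d y -> homog d (x - y).
Proof. by rewrite /homog raddfB /= => -> ->. Qed.

Lemma homogD d x y : homog d x -> homog d y -> homog d (x + y).
Proof. by rewrite /homog raddfD /= => -> ->. Qed.

Lemma homog_sum d (I : Type) (r : seq I) (Q : pred I) (F : I -> S) :
  (forall i, Q i -> homog d (F i)) -> homog d (\sum_(i <- r | Q i) F i).
Proof.
by move=> h; apply: big_ind => //; [exact: homog0|move=> *; exact: homogD].
Qed.

Lemma gcompMl d t x y : homog d x ->
  gcomp g t (x * y) = if (d <= t)%N then x * gcomp g (t - d) y else 0.
Proof.
move=> hx; rewrite gcompM; case: ifP => dt; last first.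
  rewrite big1 // => i _; rewrite (gcomp_homog _ hx); case: eqP => [id|_].
    by rewrite -id -ltnS ltn_ord in dt.
  by rewrite mul0r.
rewrite (bigD1 (Ordinal (dt : d < t.+1)%N)) //= (gcomp_homog _ hx) eqxx big1 ?addr0 //.
by move=> i id; rewrite (gcomp_homog _ hx) ifN ?mul0r.
Qed.

Lemma gcompMr d t x y : homog d y ->
  gcomp g t (x * y) = if (d <= t)%N then gcomp g (t - d) x * y else 0.
Proof.
move=> hy; rewrite gcompM; case: ifP => dt; last first.
  rewrite big1 // => i _; rewrite (gcomp_homog _ hy); case: eqP => [id|_].
    by rewrite -id leq_subr in dt.
  by rewrite mulr0.
have tdt : (t - d < t.+1)%N by rewrite ltnS leq_subr.
rewrite (bigD1 (Ordinal tdt)) //= (gcomp_homog _ hy) subKn // eqxx big1 ?addr0 //.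
move=> i id; rewrite (gcomp_homog _ hy) ifN ?mulr0 //.
apply: contraNneq id => id; apply/eqP/val_inj => /=.
by rewrite -id subKn // -ltnS.
Qed.

Lemma homogM d e x y : homog d x -> homog e y -> homog (d + e) (x * y).
Proof.
by move=> hx hy; rewrite /homog (gcompMl _ _ hx) leq_addr addKn hy.
Qed.

Lemma gcomp_sum N x : (forall d, (N <= d)%N -> gcomp g d x = 0) ->
  x = \sum_(d < N) gcomp g d x.
Proof.
move=> hN; apply/eqP; rewrite -subr_eq0; apply/eqP; apply: (@gcomp_ext0 g) => d.
rewrite raddfB raddf_sum /=; have [Nd|dN] := leqP N d.
  rewrite hN // big1 ?subrr // => i _; rewrite gcomp_gcomp ifN //.
  by rewrite neq_ltn (leq_trans (ltn_ord i) Nd) orbT.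
rewrite (bigD1 (Ordinal dN)) //= gcomp_gcomp eqxx big1 ?addr0 ?subrr //.
by move=> i id; rewrite gcomp_gcomp ifN // eq_sym.
Qed.

Lemma gcomp_ext x y : (forall d, gcomp g d x = gcomp g d y) -> x = y.
Proof.
move=> h; apply/eqP; rewrite -subr_eq0; apply/eqP; apply: (@gcomp_ext0 g) => d.
by rewrite raddfB h subrr.
Qed.

End NatGrading.

Section TensorAlgebra.
Variables (K : fieldType) (n : nat).
Local Notation T := (TV K n).
Implicit Types (u v : T) (s : seq 'I_n).

Lemma lin_ext_is_linear (F : seq 'I_n -> T) : linear (lin_ext F).
Proof.
move=> c u v.
exact: (@malg_ev_is_linear K (fmonom 'I_n) T (fun s : fmonom 'I_n => F (fmonom_val s)) c u v).
Qed.
HB.instance Definition _ F :=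
  GRing.isLinear.Build K T T *:%R (lin_ext F) (lin_ext_is_linear F).

Lemma TV_ind (P : T -> Prop) : P 0 -> (forall u v, P u -> P v -> P (u + v)) ->
  (forall c u, P u -> P (c *: u)) -> (forall s, P (word K s)) -> forall u, P u.
Proof.
move=> P0 PD PZ Pw u; rewrite [u]monalgE; apply: big_ind => // s _.
suff -> : mkmalgU s (mcoeff s u) = mcoeff s u *: word K s by exact/PZ/Pw.
apply/malgP => t; rewrite mcoeffZ !mcoeffU fmK.
by case: eqP => _; rewrite ?mulr1 ?mulr0.
Qed.

Lemma TV_ext (M : lmodType K) (f h : T -> M) : linear f -> linear h ->
  (forall s, f (word K s) = h (word K s)) -> f =1 h.
Proof.
move=> lf lh hw.
have f0 : f 0 = 0 by exact: (linear0 (to_linear lf)).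
have h0 : h 0 = 0 by exact: (linear0 (to_linear lh)).
apply: TV_ind => [|u v hu hv|c u hu|//]; first by rewrite f0 h0.
  by rewrite -[u]scale1r lf lh hu hv.
by rewrite -[_ *: u]addr0 lf lh hu f0 h0.
Qed.

Lemma TV_ext2 (M : lmodType K) (f h : T -> T -> M) :
  (forall u, linear (f u)) -> (forall u, linear (h u)) ->
  (forall v, linear (f^~ v)) -> (forall v, linear (h^~ v)) ->
  (forall s t, f (word K s) (word K t) = h (word K s) (word K t)) ->
  forall u v, f u v = h u v.
Proof.
move=> lf lh lf' lh' hw u v.
by apply: (TV_ext (lf' v) (lh' v)) => s; apply: TV_ext.
Qed.

Lemma linear_mull u : linear (fun v : T => u * v).
Proof. by move=> c v w; rewrite mulrDr -scalerAr. Qed.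

Lemma linear_mulr v : linear (fun u : T => u * v).
Proof. by move=> c u w; rewrite mulrDl -scalerAl. Qed.

Lemma linear_comp (f h : T -> T) : linear f -> linear h -> linear (fun u => f (h u)).
Proof. by move=> lf lh c u v; rewrite lh lf. Qed.

Lemma linear_if (b : bool) (f h : T -> T) : linear f -> linear h ->
  linear (fun u => if b then f u else h u).
Proof. by case: b. Qed.

Lemma linear_big (I : Type) (r : seq I) (f : I -> T -> T) :
  (forall i, linear (f i)) -> linear (fun u => \sum_(i <- r) f i u).
Proof.
move=> lf c u v; rewrite scaler_sumr -big_split; apply: eq_bigr => i _.
exact: lf.
Qed.

Lemma word_cat s t : word K (s ++ t) = word K s * word K t.
Proof.
rewrite [RHS](malgM_def) fgmulUU mulr1; congr (mkmalgU _ _).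
by rewrite /mmul /= /mul /= fmmulE.
Qed.

Lemma word_nil : word K [::] = 1 :> T.
Proof. by rewrite /word -[FMonom _]fmoneE. Qed.

Lemma word_cons i s : word K (i :: s) = gen K i * word K s.
Proof. exact: (word_cat [:: i]). Qed.

Lemma word_rcons s i : word K (rcons s i) = word K s * gen K i.
Proof. by rewrite -cats1 word_cat. Qed.

Definition tcomp (d : nat) : T -> T :=
  lin_ext (fun s => if size s == d then word K s else 0).
HB.instance Definition _ d := GRing.Linear.on (tcomp d).

Lemma tcomp_linear d : linear (tcomp d). Proof. exact: lin_ext_is_linear. Qed.

Lemma tcomp_word d s : tcomp d (word K s) = if size s == d then word K s else 0.
Proof. exact: lin_ext_word. Qed.

Lemma tcomp0 d : tcomp d 0 = 0. Proof. exact: linear0. Qed.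

Lemma tcomp_tcomp d e u : tcomp d (tcomp e u) = if d == e then tcomp e u else 0.
Proof.
apply: (TV_ext (linear_comp _ _) (linear_if _ _ _)); try exact: tcomp_linear.
  exact: zero_map_subproof.
move=> s; rewrite tcomp_word; case: (eqVneq (size s) e) => [<-|_].
  by rewrite tcomp_word eq_sym.
by rewrite tcomp0 if_same.
Qed.

Lemma tcomp_bound u : exists N, forall d, (N <= d)%N -> tcomp d u = 0.
Proof.
elim/TV_ind: u => [|u v [N hN] [N' hN']|c u [N hN]|s].
- by exists 0%N => d _; exact: tcomp0.
- exists (maxn N N') => d; rewrite geq_max => /andP[h h'].
  by rewrite -[u]scale1r tcomp_linear hN // hN' // addr0 scaler0.
- by exists N => d h; rewrite -[c *: u]addr0 tcomp_linear hN // tcomp0 addr0 scaler0.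
- by exists (size s).+1 => d h; rewrite tcomp_word ltn_eqF.
Qed.

Lemma mcoeff_word s t : mcoeff (FMonom t) (word K s) = (s == t)%:R.
Proof. by rewrite mcoeffU fmP. Qed.

Lemma TV_mcoeffZ c u t : mcoeff t (c *: u) = c * mcoeff t u.
Proof. exact: mcoeffZ. Qed.

Lemma mcoeff_tcomp d u t :
  mcoeff t (tcomp d u) = if size t == d then mcoeff t u else 0.
Proof.
elim/TV_ind: u => [|u v hu hv|c u hu|].
- by rewrite tcomp0 mcoeff0 if_same.
- have -> : tcomp d (u + v) = tcomp d u + tcomp d v by exact: (linearD (tcomp d)).
  rewrite mcoeffD; apply: etrans (f_equal2 +%R hu hv) _.
  by case: ifP => _; rewrite ?mcoeffD ?addr0.
- have -> : tcomp d (c *: u) = c *: tcomp d u.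
    by rewrite -[_ *: u]addr0 tcomp_linear tcomp0 addr0.
  apply: etrans (TV_mcoeffZ _ _ _) _; apply: etrans (congr1 ( *%R c) hu) _.
  by case: ifP => _; rewrite ?TV_mcoeffZ ?mulr0.
move=> s; rewrite -[t]fmK /= tcomp_word; case: eqP => sd; case: eqP => td //.
- by rewrite mcoeff_word; case: eqP => // st; rewrite -sd st in td.
- by rewrite mcoeff0 mcoeff_word; case: eqP => // st; rewrite -td -st in sd.
- by rewrite mcoeff0.
Qed.

Lemma tcomp_ext0 u : (forall d, tcomp d u = 0) -> u = 0.
Proof.
move=> h; apply/malgP => t; rewrite mcoeff0.
by have := mcoeff_tcomp (size t) u t; rewrite h mcoeff0 eqxx.
Qed.

Lemma tcompM d u v :
  tcomp d (u * v) = \sum_(i < d.+1) tcomp i u * tcomp (d - i) v.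
Proof.
apply: (@TV_ext2 T (fun u v => tcomp d (u * v))
  (fun u v => \sum_(i < d.+1) tcomp i u * tcomp (d - i) v)) => [{}u|{}u|{}v|{}v|s t].
- exact: linear_comp (tcomp_linear d) (linear_mull u).
- apply: linear_big => i.
  exact: linear_comp (linear_mull (tcomp i u)) (tcomp_linear (d - i)).
- exact: linear_comp (tcomp_linear d) (linear_mulr v).
- apply: linear_big => i.
  exact: linear_comp (linear_mulr (tcomp (d - i) v)) (tcomp_linear i).
rewrite -word_cat tcomp_word size_cat.
have [sd|ds] := leqP (size s) d; last first.
  rewrite gtn_eqF ?(leq_trans ds (leq_addr _ _)) // big1 // => i _.
  rewrite tcomp_word ifN ?mul0r //; apply: contraTneq ds => ->.
  by rewrite -ltnS -leqNgt ltn_ord.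
rewrite (bigD1 (Ordinal (sd : (size s < d.+1)%N))) //= big1 => [|i is_].
  rewrite !tcomp_word eqxx addr0 -{1}(subnKC sd) eqn_add2l.
  by case: eqP => _; rewrite ?mulr0 // word_cat.
by rewrite tcomp_word ifN ?mul0r // eq_sym.
Qed.

Definition T_grading : nat_grading T := @NatGrading T (fun d => tcomp d)
  tcomp_tcomp tcomp_bound tcomp_ext0 tcompM.

Lemma tpowP d u : tpow d u <-> tcomp d u = u.
Proof.
split=> [hu|<- s]; last first.
  by rewrite -mcoeff_neq0 mcoeff_tcomp; case: (size s =P d); rewrite ?eqxx.
apply/malgP => t; rewrite mcoeff_tcomp; case: eqP => // td.
by rewrite mcoeff_outdom //; apply/negP => /hu.
Qed.

End TensorAlgebra.

Section FreeData.
Variables (K : fieldType) (n : nat).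

(* What is used of the tensor algebra: the grading and the unique expressions
   u = aug u + sum_i x_i (ld i u) = aug u + sum_i (rd i u) x_i. *)
Record free_data (T : algType K) := FreeData {
  fd_gr :> nat_grading T;
  fd_x : 'I_n -> T;
  fd_ld : 'I_n -> {linear T -> T};
  fd_rd : 'I_n -> {linear T -> T};
  fd_aug : T -> K;
  fd_gr0 : forall u, gcomp fd_gr 0 u = (fd_aug u)%:A;
  fd_gr1 : forall i, homog fd_gr 1 (fd_x i);
  fd_ldE : forall u, u = (fd_aug u)%:A + \sum_i fd_x i * fd_ld i u;
  fd_rdE : forall u, u = (fd_aug u)%:A + \sum_i fd_rd i u * fd_x i;
  fd_ldM : forall i j v, fd_ld i (fd_x j * v) = if i == j then v else 0;
  fd_rdM : forall i j v, fd_rd i (v * fd_x j) = if i == j then v else 0;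
  fd_ld1 : forall i, fd_ld i 1 = 0
}.

Local Notation T := (TV K n).
Implicit Types (i j : 'I_n) (s : seq 'I_n) (u v : T).

Definition rder (i : 'I_n) : T -> T :=
  lin_ext (fun s =>
    if rev s is j :: s' then if j == i then word K (rev s') else 0 else 0).

Lemma pder_linear i : linear (pder i : T -> T).
Proof. exact: lin_ext_is_linear. Qed.

Lemma rder_linear i : linear (rder i).
Proof. exact: lin_ext_is_linear. Qed.

Lemma pder_word i s : pder i (word K s) =
  if s is j :: s' then if j == i then word K s' else 0 else 0.
Proof. exact: lin_ext_word. Qed.

Lemma rder_rcons i s j :
  rder i (word K (rcons s j)) = if j == i then word K s else 0.
Proof. by apply: etrans (lin_ext_word _ _) _; rewrite rev_rcons revK. Qed.

Lemma rder_nil i : rder i (word K [::]) = 0.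
Proof. exact: lin_ext_word. Qed.

Lemma aug_linear : linear (fun u : T => (mcoeff one u)%:A : T).
Proof.
move=> c u v.
have L (a b : K) : (c * a + b)%:A = c *: a%:A + b%:A :> T.
  by rewrite scalerDl scalerA.
have E : mcoeff one (c *: u + v) = c * mcoeff one u + mcoeff one v.
  exact: etrans (mcoeffD _ _ _) (congr1 (+%R^~ _) (TV_mcoeffZ _ _ _)).
exact: etrans (congr1 (fun a : K => a%:A) E) (L _ _).
Qed.

Lemma aug_word s : (mcoeff one (word K s))%:A = if s is [::] then 1 else 0 :> T.
Proof.
rewrite mcoeffU fmP fm1 /=; case: s => [|i s]; first exact: scale1r.
exact: scale0r.
Qed.

Lemma linear_add (f h : T -> T) : linear f -> linear h ->
  linear (fun u => f u + h u).
Proof. by move=> lf lh c u v; rewrite lf lh scalerDr addrACA. Qed.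

Lemma TV_ldE (u : T) : u = (mcoeff one u)%:A + \sum_i gen K i * pder i u.
Proof.
apply: (@TV_ext K n T (fun u => u)
  (fun u => (mcoeff one u)%:A + \sum_i gen K i * pder i u)) => [//||s].
  apply: linear_add aug_linear _; apply: linear_big => i.
  exact: linear_comp (linear_mull (gen K i)) (pder_linear i).
rewrite aug_word; case: s => [|j s].
  rewrite big1 ?addr0 ?word_nil // => i _.
  by rewrite -word_nil pder_word mulr0.
rewrite add0r (bigD1 j) //= big1 => [|i ij]; rewrite pder_word.
  by rewrite eqxx addr0 word_cons.
by rewrite eq_sym (negbTE ij) mulr0.
Qed.

Lemma TV_rdE (u : T) : u = (mcoeff one u)%:A + \sum_i rder i u * gen K i.
Proof.
apply: (@TV_ext K n T (fun u => u)
  (fun u => (mcoeff one u)%:A + \sum_i rder i u * gen K i)) => [//||s].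
  apply: linear_add aug_linear _; apply: linear_big => i.
  exact: linear_comp (linear_mulr (gen K i)) (rder_linear i).
rewrite aug_word; case/lastP: s => [|s j].
  rewrite big1 ?addr0 ?word_nil // => i _.
  by rewrite -word_nil rder_nil mul0r.
have -> : (if rcons s j is [::] then 1 else 0) = 0 :> T by case: (s).
rewrite add0r (bigD1 j) //= big1 => [|i ij]; rewrite rder_rcons.
  by rewrite eqxx addr0 word_rcons.
by rewrite eq_sym (negbTE ij) mul0r.
Qed.

Lemma TV_ldM i j (v : T) : pder i (gen K j * v) = if i == j then v else 0.
Proof.
apply: (@TV_ext K n T (fun v => pder i (gen K j * v))
  (fun v => if i == j then v else 0)) => [||s].
- exact: linear_comp (pder_linear i) (linear_mull _).
- exact: linear_if (fun _ _ _ => erefl) (@zero_map_subproof _ _ _).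
- by rewrite -word_cons pder_word eq_sym.
Qed.

Lemma TV_rdM i j (v : T) : rder i (v * gen K j) = if i == j then v else 0.
Proof.
apply: (@TV_ext K n T (fun v => rder i (v * gen K j))
  (fun v => if i == j then v else 0)) => [||s].
- exact: linear_comp (rder_linear i) (linear_mulr _).
- exact: linear_if (fun _ _ _ => erefl) (@zero_map_subproof _ _ _).
- by rewrite -word_rcons rder_rcons eq_sym.
Qed.

Lemma TV_gr0 (u : T) : tcomp 0 u = (mcoeff one u)%:A.
Proof.
apply: (@TV_ext K n T (tcomp 0) (fun u => (mcoeff one u)%:A)) => [||s].
- exact: tcomp_linear.
- exact: aug_linear.
- by rewrite tcomp_word aug_word; case: s => //; rewrite word_nil.
Qed.

Lemma TV_gr1 i : homog (T_grading K n) 1 (gen K i).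
Proof. exact: tcomp_word. Qed.

Lemma TV_ld1 i : pder i (1 : T) = 0.
Proof. by rewrite -word_nil pder_word. Qed.

Definition TV_data : free_data T :=
  @FreeData T (T_grading K n) (@gen K n)
    (fun i => to_linear (pder_linear i)) (fun i => to_linear (rder_linear i))
    (mcoeff one) TV_gr0 TV_gr1 TV_ldE TV_rdE TV_ldM TV_rdM TV_ld1.

End FreeData.

Lemma sum_mulrDr (S : pzRingType) (I : finType) (f g h : I -> S) :
  \sum_i f i * (g i + h i) = \sum_i f i * g i + \sum_i f i * h i.
Proof. by rewrite -big_split; apply: eq_bigr => i _; rewrite mulrDr. Qed.

Lemma sum_mulrDl (S : pzRingType) (I : finType) (f g h : I -> S) :
  \sum_i (f i + g i) * h i = \sum_i f i * h i + \sum_i g i * h i.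
Proof. by rewrite -big_split; apply: eq_bigr => i _; rewrite mulrDl. Qed.

Section FreeDataTheory.
Variables (K : fieldType) (n : nat) (T : algType K) (fd : free_data n T).
Local Notation x := (fd_x fd).
Local Notation ld := (fd_ld fd).
Local Notation rd := (fd_rd fd).

Definition fd_col : 'cV[T]_n := \col_i x i.

Lemma fd_ld_scalar i c : ld i c%:A = 0.
Proof. by rewrite linearZ /= fd_ld1 scaler0. Qed.

Lemma fd_ld_sum i (c : 'I_n -> T) : ld i (\sum_j x j * c j) = c i.
Proof.
rewrite linear_sum (bigD1 i) //= fd_ldM eqxx big1 ?addr0 // => j ji.
by rewrite fd_ldM eq_sym (negbTE ji).
Qed.

Lemma fd_rd_sum i (c : 'I_n -> T) : rd i (\sum_j c j * x j) = c i.
Proof.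
rewrite linear_sum (bigD1 i) //= fd_rdM eqxx big1 ?addr0 // => j ji.
by rewrite fd_rdM eq_sym (negbTE ji).
Qed.

Lemma fd_aug_scalar c : (fd_aug fd c%:A)%:A = c%:A :> T.
Proof.
rewrite [RHS](fd_ldE fd) big1 ?addr0 // => i _.
by rewrite fd_ld_scalar mulr0.
Qed.

Lemma homog_scalar c : homog fd 0 (c%:A).
Proof. by rewrite /homog fd_gr0 fd_aug_scalar. Qed.

Lemma gcompZ d c u : gcomp fd d (c *: u) = c *: gcomp fd d u.
Proof.
by rewrite -[c *: u]mulr_algl (gcompMl _ _ (homog_scalar c)) /= subn0 mulr_algl.
Qed.

Lemma gcompS_ld d i u : ld i (gcomp fd d.+1 u) = gcomp fd d (ld i u).
Proof.
rewrite [in LHS](fd_ldE fd u) raddfD /= (gcomp_homog _ (homog_scalar _)) add0r.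
rewrite raddf_sum; under eq_bigr => j _.
  rewrite (gcompMl _ _ (fd_gr1 fd j)) /= subn1; over.
by rewrite fd_ld_sum.
Qed.

Lemma fd_ind (P : T -> Prop) : (forall c, P c%:A) ->
  (forall u v, P u -> P v -> P (u + v)) ->
  (forall i u, P u -> P (x i * u)) -> forall u, P u.
Proof.
move=> Pc PD PM.
suff hN N : forall u, (forall d, (N <= d)%N -> gcomp fd d u = 0) -> P u.
  by move=> u; have [N /hN] := gcomp_bound fd u.
elim: N => [|N ih] u hu.
  have -> : u = 0 by apply: (gcomp_ext0 (n := fd)) => d; exact: hu.
  by rewrite -(scale0r (1 : T)).
rewrite (fd_ldE fd u); apply: (PD) => //; apply: big_ind => //.
  by rewrite -(scale0r (1 : T)).
move=> i _; apply: PM; apply: ih => d hd.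
by rewrite -gcompS_ld hu // linear0.
Qed.

Lemma fd_col_linv m (a b : 'M[T]_(n, m)) :
  fd_col^T *m a = fd_col^T *m b -> a = b.
Proof.
move=> h; apply/matrixP => i j; move/matrixP/(_ 0 j)/(congr1 (ld i)): h.
rewrite !mxE; under eq_bigr => l _ do rewrite !mxE.
rewrite fd_ld_sum; under eq_bigr => l _ do rewrite !mxE.
by rewrite fd_ld_sum.
Qed.

Lemma fd_col_rinv m (a b : 'M[T]_(m, n)) : a *m fd_col = b *m fd_col -> a = b.
Proof.
move=> h; apply/matrixP => i j; move/matrixP/(_ i 0)/(congr1 (rd j)): h.
rewrite !mxE; under eq_bigr => l _ do rewrite !mxE.
rewrite fd_rd_sum; under eq_bigr => l _ do rewrite !mxE.
by rewrite fd_rd_sum.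
Qed.

Lemma fd_row_ldE (u : 'rV[T]_n) : exists (lam : 'rV[K]_n) (U : 'M[T]_n),
  u = map_mx (in_alg T) lam + fd_col^T *m U.
Proof.
exists (\row_i fd_aug fd (u 0 i)), (\matrix_(j, i) ld j (u 0 i)).
apply/rowP => i; rewrite !mxE {1}(fd_ldE fd (u 0 i)); congr (_ + _).
by apply: eq_bigr => j _; rewrite !mxE.
Qed.

Lemma fd_rdE_mx (c : T) : exists (c0 : K) (C : 'rV[T]_n),
  c%:M = (c0%:A)%:M + C *m fd_col.
Proof.
exists (fd_aug fd c), (\row_i rd i c); apply/matrixP => i j.
rewrite !mxE !ord1 eqxx !mulr1n {1}(fd_rdE fd c); congr (_ + _).
by apply: eq_bigr => l _; rewrite !mxE.
Qed.

Section Presented.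
Variables (A : algType K) (pi : {lrmorphism T -> A}) (N : nat) (r : 'cV[T]_N).

Record presented : Prop := Presented {
  presented_surj : forall a, exists u, pi u = a;
  presented_ker : forall u,
    pi u = 0 <-> ideal_gen [set s | exists i, s = r i 0] u
}.

Hypothesis hpi : presented.

Lemma presented_rel i : pi (r i 0) = 0.
Proof.
apply/(presented_ker hpi); rewrite -[r i 0]addr0 -[r i 0]mulr1 -[r i 0]mul1r.
by apply: ideal_gen_add; [exists i|exact: ideal_gen0].
Qed.

Lemma presented_mx m1 m2 (a : 'M[A]_(m1, m2)) :
  exists u : 'M[T]_(m1, m2), map_mx pi u = a.
Proof.
have /choice[s hs] := presented_surj hpi.
by exists (map_mx s a); apply/matrixP => i j; rewrite !mxE hs.
Qed.

(** For the kernel I this says I = r T + x I. It comes from T = K + x T: in a term a r_j b the left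
    factor is split into its constant and a part that begins with a generator. The exactness proofs
    lift an equation to T in this way and then cancel x on one side. *)
Lemma presented_ldecomp1 y : pi y = 0 -> exists (b : 'I_N -> T) (t : 'I_n -> T),
  (forall i, pi (t i) = 0) /\
  y = \sum_i r i 0 * b i + \sum_i x i * t i.
Proof.
move/(presented_ker hpi); elim=> [|a s b z [j ->] _ [bz [tz [tz0 ->]]]].
  exists (fun=> 0), (fun=> 0); split=> [i|]; first exact: raddf0.
  by rewrite !big1 ?addr0 // => i _; rewrite mulr0.
exists (fun i => bz i + (fd_aug fd a *: b) *+ (i == j)),
  (fun i => tz i + ld i a * r j 0 * b); split=> [i|].
  by rewrite raddfD /= tz0 !rmorphM /= presented_rel mulr0 mul0r addr0.
rewrite !sum_mulrDr addrACA [LHS]addrC; congr (_ + _).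
rewrite (bigD1 j) //= eqxx mulr1n big1 ?addr0 => [|i ij]; last first.
  by rewrite (negbTE ij) mulr0n mulr0.
rewrite [in LHS](fd_ldE fd a) !mulrDl; congr (_ + _).
  by rewrite -!scalerAl mul1r scalerAr.
by rewrite !mulr_suml; apply: eq_bigr => i _; rewrite !mulrA.
Qed.

Lemma presented_rdecomp1 y : pi y = 0 -> exists (b : 'I_N -> T) (t : 'I_n -> T),
  (forall i, pi (t i) = 0) /\
  y = \sum_i b i * r i 0 + \sum_i t i * x i.
Proof.
move/(presented_ker hpi); elim=> [|a s b z [j ->] _ [bz [tz [tz0 ->]]]].
  exists (fun=> 0), (fun=> 0); split=> [i|]; first exact: raddf0.
  by rewrite !big1 ?addr0 // => i _; rewrite mul0r.
exists (fun i => bz i + (fd_aug fd b *: a) *+ (i == j)),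
  (fun i => tz i + a * r j 0 * rd i b); split=> [i|].
  by rewrite raddfD /= tz0 !rmorphM /= presented_rel mulr0 mul0r addr0.
rewrite !sum_mulrDl addrACA [LHS]addrC; congr (_ + _).
rewrite (bigD1 j) //= eqxx mulr1n big1 ?addr0 => [|i ij]; last first.
  by rewrite (negbTE ij) mulr0n mul0r.
rewrite [in LHS](fd_rdE fd b) !mulrDr; congr (_ + _).
  by rewrite -!scalerAr mulr1 scalerAl.
by rewrite !mulr_sumr; apply: eq_bigr => i _; rewrite !mulrA.
Qed.

Lemma presented_ldecomp m (y : 'rV[T]_m) : map_mx pi y = 0 ->
  exists (B : 'M[T]_(N, m)) (t : 'M[T]_(n, m)),
    map_mx pi t = 0 /\ y = r^T *m B + fd_col^T *m t.
Proof.
move=> hy; have /choice[f hf] : forall j, exists bt : ('I_N -> T) * ('I_n -> T),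
    (forall i, pi (bt.2 i) = 0) /\
    y 0 j = \sum_i r i 0 * bt.1 i + \sum_i x i * bt.2 i.
  move=> j; have [|b [t h]] := @presented_ldecomp1 (y 0 j); last by exists (b, t).
  by move/matrixP/(_ 0 j): hy; rewrite !mxE.
exists (\matrix_(i, j) (f j).1 i), (\matrix_(i, j) (f j).2 i).
split; apply/matrixP => i j; rewrite !mxE; first by case: (hf j).
rewrite ord1; case: (hf j) => _ ->; congr (_ + _); apply: eq_bigr => l _;
  by rewrite !mxE.
Qed.

Lemma presented_rdecomp m (y : 'cV[T]_m) : map_mx pi y = 0 ->
  exists (B : 'M[T]_(m, N)) (t : 'M[T]_(m, n)),
    map_mx pi t = 0 /\ y = B *m r + t *m fd_col.
Proof.
move=> hy; have /choice[f hf] : forall j, exists bt : ('I_N -> T) * ('I_n -> T),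
    (forall i, pi (bt.2 i) = 0) /\
    y j 0 = \sum_i bt.1 i * r i 0 + \sum_i bt.2 i * x i.
  move=> j; have [|b [t h]] := @presented_rdecomp1 (y j 0); last by exists (b, t).
  by move/matrixP/(_ j 0): hy; rewrite !mxE.
exists (\matrix_(j, i) (f j).1 i), (\matrix_(j, i) (f j).2 i).
split; apply/matrixP => i j; rewrite !mxE; first by case: (hf i).
rewrite ord1; case: (hf i) => _ ->; congr (_ + _); apply: eq_bigr => l _;
  by rewrite !mxE.
Qed.

End Presented.
End FreeDataTheory.

Lemma add_eq_sub (V : zmodType) (a b c d : V) : a + b = c + d -> a - c = d - b.
Proof.
by move=> h; apply/eqP; rewrite subr_eq addrAC eq_sym subr_eq addrC h.
Qed.

Section ScalarMatrices.
Variables (K : fieldType) (T : algType K).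

Lemma algr_comm (c : K) (a : T) : a * c%:A = c%:A * a.
Proof. by rewrite mulr_algl mulr_algr. Qed.

Lemma scalar_mx_comm m n (c : K) (a : 'M[T]_(m, n)) :
  a *m (c%:A)%:M = (c%:A)%:M *m a.
Proof.
apply/matrixP => i j; rewrite mul_scalar_mx !mxE (bigD1 j) //= big1 => [|l lj].
  by rewrite !mxE eqxx mulr1n addr0 algr_comm.
by rewrite !mxE (negbTE lj) mulr0n mulr0.
Qed.

Lemma scalar_row_comm n (c : 'rV[K]_n) (a : 'cV[T]_n) :
  map_mx (in_alg T) c *m a = a^T *m (map_mx (in_alg T) c)^T.
Proof.
apply/matrixP => i j; rewrite !mxE !ord1; apply: eq_bigr => l _.
by rewrite !mxE algr_comm.
Qed.

Definition alg_diag n (q : 'I_n -> K) : 'M[T]_n := diag_mx (\row_i (q i)%:A).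

Lemma mul_alg_diag m n (q : 'I_n -> K) (a : 'M[T]_(n, m)) i j :
  (alg_diag q *m a) i j = q i *: a i j.
Proof. by rewrite mul_diag_mx !mxE mulr_algl. Qed.

Lemma mul_mx_alg_diag m n (q : 'I_n -> K) (a : 'M[T]_(m, n)) i j :
  (a *m alg_diag q) i j = q j *: a i j.
Proof.
rewrite mxE (bigD1 j) //= big1 => [|l lj].
  by rewrite !mxE eqxx mulr1n addr0 mulr_algr.
by rewrite !mxE (negbTE lj) mulr0n mulr0.
Qed.

Lemma alg_diagM n (q q' : 'I_n -> K) :
  alg_diag q *m alg_diag q' = alg_diag (fun i => q i * q' i).
Proof.
apply/matrixP => i j; rewrite mul_alg_diag !mxE.
by case: eqP => [->|_]; rewrite ?mulr1n ?mulr0n ?scaler0 // scalerA.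
Qed.

Lemma alg_diag1 n (q : 'I_n -> K) : (forall i, q i = 1) -> alg_diag q = 1%:M.
Proof. by move=> hq; apply/matrixP => i j; rewrite !mxE hq scale1r. Qed.

End ScalarMatrices.

Lemma map_mull0 (R S : pzRingType) (pi : {rmorphism R -> S}) m n p
    (a : 'M[R]_(m, n)) (b : 'M[R]_(n, p)) :
  map_mx pi a = 0 -> map_mx pi (a *m b) = 0.
Proof. by rewrite map_mxM => ->; rewrite mul0mx. Qed.

Lemma map_mulr0 (R S : pzRingType) (pi : {rmorphism R -> S}) m n p
    (a : 'M[R]_(m, n)) (b : 'M[R]_(n, p)) :
  map_mx pi b = 0 -> map_mx pi (a *m b) = 0.
Proof. by rewrite map_mxM => ->; rewrite mulmx0. Qed.

(** * The complex of a twisted superpotential *)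

Section SuperpotentialExactness.
Variables (K : fieldType) (n : nat) (T : algType K) (fd : free_data n T).
Variables (A : algType K) (pi : {lrmorphism T -> A}).
Variables (F : 'M[T]_n) (q : 'I_n -> K).
Local Notation x := (fd_col fd).
Local Notation f := (F *m x).
Local Notation X := (map_mx pi x).
Local Notation FA := (map_mx pi F).
Hypothesis q_neq0 : forall i, q i != 0.
Hypothesis hF : x^T *m F = f^T *m alg_diag T q.
Hypothesis hpi : presented pi f.
Local Notation Qd := (alg_diag T q).
Local Notation Qi := (alg_diag T (fun i => (q i)^-1)).

Lemma QdK : Qd *m Qi = 1%:M.
Proof. by rewrite alg_diagM alg_diag1 // => i; rewrite mulfV. Qed.
Lemma superpotential_tr : f^T = x^T *m F *m Qi.
Proof. by rewrite hF -mulmxA QdK mulmx1. Qed.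

Lemma map_rel0 : map_mx pi f = 0.
Proof.
by apply/matrixP => i j; rewrite ord1 [RHS]mxE [LHS]mxE; exact: presented_rel.
Qed.

Lemma map_trmx_rel0 : map_mx pi (x^T *m F) = 0.
Proof. by rewrite hF map_mxM -map_trmx map_rel0 trmx0 mul0mx. Qed.

(** Lifted to T, u x lies in T f + I x with f = F x; cancelling the last letter leaves u = B F
    modulo I. *)
Lemma left_exact1 (u : 'rV[A]_n) : u *m X = 0 -> exists v, u = v *m FA.
Proof.
have [{}u <-] := presented_mx hpi u; rewrite -map_mxM => hu.
have [B [t [t0 ht]]] : exists (B : 'M[T]_(1, n)) (t : 'M[T]_(1, n)),
  map_mx pi t = 0 /\ u *m x = B *m f + t *m x by exact: presented_rdecomp.
exists (map_mx pi B); rewrite -map_mxM; rewrite mulmxA -mulmxDl in ht.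
by rewrite (fd_col_rinv ht) map_mxD t0 addr0.
Qed.

Lemma right_exact1 (c : 'cV[A]_n) : X^T *m c = 0 -> exists b, c = FA *m b.
Proof.
have [{}c <-] := presented_mx hpi c; rewrite map_trmx -map_mxM => hc.
have [B [t [t0 ht]]] : exists (B : 'M[T]_(n, 1)) (t : 'M[T]_(n, 1)),
  map_mx pi t = 0 /\ x^T *m c = f^T *m B + x^T *m t by exact: presented_ldecomp.
exists (map_mx pi (Qi *m B)); rewrite -map_mxM.
rewrite superpotential_tr -!mulmxA -mulmxDr in ht.
by rewrite (fd_col_linv ht) map_mxD t0 addr0.
Qed.

Lemma gcomp0_mulx m (a : 'M[T]_(m, n)) i j : gcomp fd 0 ((a *m x) i j) = 0.
Proof.
rewrite mxE raddf_sum big1 // => l _.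
by rewrite (gcompMr (d := 1)) // mxE; exact: fd_gr1.
Qed.

Lemma gcomp0_xmul m (a : 'M[T]_(1, m)) i j : gcomp fd 0 ((x *m a) i j) = 0.
Proof.
rewrite mxE raddf_sum big1 // => l _.
by rewrite (gcompMl (d := 1)) // mxE; exact: fd_gr1.
Qed.

Hypothesis right_exact2 : forall c : 'cV[A]_n, FA *m c = 0 ->
  exists e : 'M[A]_1, c = X *m e.

(** Exactness for columns at [F] is converted here into one degree of exactness for rows. Write u =
    L + x^T U with L constant. Multiplying u F = 0 by x on the right and cancelling the leading x^T
    turns it into F v = 0 in A, with v = Qi (L^T - B x). Hence v is a right multiple of the column
    X, say by e; this forces L = 0, and the constant term of e yields the multiple of X^T. *)
Lemma left_exact2_step (u : 'rV[A]_n) : u *m FA = 0 ->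
  exists (c : K) (U : 'M[A]_n), U *m FA = 0 /\ u = c%:A *: X^T + X^T *m U.
Proof.
have [{}u <-] := presented_mx hpi u; rewrite -map_mxM => hu.
have [B [I' [I'0 hB]]] : exists (B : 'M[T]_n) (t : 'M[T]_n),
  map_mx pi t = 0 /\ u *m F = f^T *m B + x^T *m t by exact: presented_ldecomp.
have [lam [U hU]] := fd_row_ldE fd u; set L := map_mx _ lam in hU.
have E1 : F *m Qi *m L^T + U *m f = F *m Qi *m B *m x + I' *m x.
  apply: (@fd_col_linv _ _ _ fd); rewrite mulmxDr.
  have -> : x^T *m (F *m Qi *m L^T) = L *m f.
    by rewrite !mulmxA -superpotential_tr -scalar_row_comm mulmxA.
  rewrite (mulmxA _ U) -(mulmxDl L) -hU mulmxA hB mulmxDl mulmxDr.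
  by rewrite !(mulmxA x^T) -superpotential_tr.
pose v := Qi *m (L^T - B *m x).
have [e1 hv1] : exists e : 'M[A]_1, map_mx pi v = X *m e.
  apply: right_exact2; rewrite -map_mxM /v mulmxA mulmxBr mulmxA.
  have -> : F *m Qi *m L^T - F *m Qi *m B *m x = I' *m x - U *m f.
    exact: add_eq_sub E1.
  by rewrite map_mxB (map_mull0 _ I'0) (map_mulr0 _ map_rel0) subrr.
have [e hv] : exists e : 'M[T]_1, map_mx pi (v - x *m e) = 0.
  have [e he] := presented_mx hpi e1; exists e.
  by rewrite map_mxB hv1 map_mxM he subrr.
have [Rho [Kap [Kap0 hk]]] : exists (B : 'M[T]_n) (t : 'M[T]_n),
  map_mx pi t = 0 /\ v - x *m e = B *m f + t *m x by exact: presented_rdecomp.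
(* [L] is constant, while the right-hand side of [EL] has no term of degree 0. *)
have L0 : L = 0.
  have EL : L^T = (B + Qd *m (Rho *m F + Kap)) *m x + Qd *m x *m e.
    move/eqP: hk; rewrite subr_eq => /eqP/(congr1 (mulmx Qd)).
    rewrite /v mulmxA QdK mul1mx => /eqP; rewrite subr_eq => /eqP ->.
    by rewrite mulmxDl !mulmxDr !mulmxDl !mulmxA addrC -!addrA; congr (_ + _); rewrite addrC.
  apply/matrixP => i j; rewrite [RHS]mxE ord1.
  have -> : L 0 j = L^T j 0 by rewrite [RHS]mxE.
  have -> : L^T j 0 = gcomp fd 0 (L^T j 0).
    by rewrite 2!mxE -[LHS](fd_aug_scalar fd) -fd_gr0.
  rewrite EL mxE raddfD /= gcomp0_mulx add0r -mulmxA mul_alg_diag.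
  by rewrite gcompZ gcomp0_xmul scaler0.
move: E1 hU; rewrite L0 trmx0 mulmx0 !add0r => E1 hU.
have [c0 [C hC]] := fd_rdE_mx fd (e 0 0).
have {}hC : e = (c0%:A)%:M + C *m x.
  by rewrite -hC; apply/matrixP => i j; rewrite !mxE !ord1 eqxx.
(* The correction [F *m Rho] does not affect the product with x^T in A, since x^T F vanishes there;
   the scalar c0 changes it by a multiple of X^T. *)
pose U' := U + (c0%:A)%:M + F *m Rho.
have hU' : U' *m F = I' - F *m Kap - f *m C.
  apply: (@fd_col_rinv _ _ _ fd); rewrite -mulmxA /U' !mulmxDl E1 -mulmxDl.
  have hQB : Qi *m B *m x = - (x *m e + Rho *m f + Kap *m x).
    have hv0 : v = - (Qi *m B *m x) by rewrite /v L0 trmx0 sub0r mulmxN mulmxA.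
    move/eqP: hk; rewrite hv0 subr_eq eqr_oppLR => /eqP ->.
    by rewrite addrC addrA.
  rewrite !mulmxDl -!(mulmxA F) hQB hC.
  rewrite mulmxN !mulmxDr !mulNmx -scalar_mx_comm !mulmxA.
  set t1 := F *m x *m _; set t2 := _ *m C *m x; set t3 := _ *m Rho *m _ *m _.
  set t4 := F *m Kap *m x; set t5 := I' *m x.
  have -> : t1 + t2 + t3 + t4 = (t1 + t3) + (t2 + t4) by rewrite -addrA addrACA.
  rewrite -(addrA _ t1) addrC opprD !addrA subrr add0r opprD addrC addrA addrAC.
  by [].
exists (- c0), (map_mx pi U'); split.
  rewrite -map_mxM hU' !map_mxB I'0 (map_mulr0 _ Kap0) (map_mull0 _ map_rel0).
  by rewrite !subr0.
rewrite hU map_mxM map_trmx /U' !map_mxD.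
have -> : map_mx pi (c0%:A)%:M = (c0%:A)%:M :> 'M[A]_n.
  by rewrite map_scalar_mx /= linearZ /= rmorph1.
rewrite !mulmxDr scalar_mx_comm mul_scalar_mx.
have -> : map_mx pi x^T *m map_mx pi (F *m Rho) = 0.
  by rewrite -map_mxM mulmxA; exact: map_mull0 map_trmx_rel0.
by rewrite addr0 !scaleNr addrCA addNr addr0.
Qed.

End SuperpotentialExactness.

Section RowMultiplication.
Variable S : pzRingType.

Lemma rowmul_subproof m1 m2 (Y : 'M[S]_(m1, m2)) :
  linear (fun u : 'rV[S]_m1 => u *m Y).
Proof. by move=> a u v; rewrite mulmxDl scalemxAl. Qed.

Definition rowmul m1 m2 (Y : 'M[S]_(m1, m2)) :
  {linear 'rV[S]_m1 -> 'rV[S]_m2} := to_linear (rowmul_subproof Y).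

Lemma rowmulE m1 m2 (Y : 'M[S]_(m1, m2)) u : rowmul Y u = u *m Y.
Proof. by []. Qed.

Lemma row_projective m : projective ('rV[S]_m : lmodType S).
Proof.
move=> M N d f hd.
have /choice[v hv] : forall j : 'I_m, exists y, d y = f (delta_mx 0 j).
  by move=> j; exact: hd.
have lh : linear (fun u : 'rV[S]_m => \sum_j u 0 j *: v j).
  move=> a u w; rewrite scaler_sumr -big_split; apply: eq_bigr => j _.
  by rewrite !mxE scalerDl scalerA.
exists (to_linear lh) => u; rewrite [in RHS](row_sum_delta u) linear_sum linear_sum.
by apply: eq_bigr => j _; rewrite !linearZ hv.
Qed.

End RowMultiplication.

Section Truncation.
Variables (S : pzRingType) (g : nat_grading S).

Definition trunc (N : nat) (y : S) : S := \sum_(e < N) gcomp g e y.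

Lemma gcomp_trunc d N y :
  gcomp g d (trunc N y) = if (d < N)%N then gcomp g d y else 0.
Proof.
rewrite raddf_sum /=; case: ltnP => dN.
  rewrite (bigD1 (Ordinal dN)) //= gcomp_gcomp eqxx big1 ?addr0 // => i id.
  by rewrite gcomp_gcomp ifN // eq_sym.
rewrite big1 // => i _; rewrite gcomp_gcomp ifN // neq_ltn.
by rewrite (leq_trans (ltn_ord i) dN) orbT.
Qed.

Lemma gcomp_bound_fin n (y : 'I_n -> S) :
  exists N, forall i d, (N <= d)%N -> gcomp g d (y i) = 0.
Proof.
have /choice[N hN] : forall i, exists N, forall d, (N <= d)%N -> gcomp g d (y i) = 0.
  by move=> i; exact: gcomp_bound.
exists (\max_i N i) => i d hd; apply: hN; apply: leq_trans hd.
exact: leq_bigmax.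
Qed.

End Truncation.

Section QuotientGrading.
Variables (K : fieldType) (n : nat) (T : algType K) (fd : free_data n T).
Variables (A : algType K) (pi : {lrmorphism T -> A}) (N : nat) (r : 'cV[T]_N).
Hypothesis hpi : presented pi r.

Definition compatible (g : nat_grading A) : Prop :=
  forall d u, gcomp g d (pi u) = pi (gcomp fd d u).

Hypothesis r_homog : forall i, exists e, homog fd e (r i 0).

Lemma presented_gcomp0 d u : pi u = 0 -> pi (gcomp fd d u) = 0.
Proof.
move/(presented_ker hpi); elim=> [|a s b v [i ->] _ ih].
  by rewrite !raddf0.
rewrite !raddfD /= ih addr0 gcompM raddf_sum big1 // => j _; rewrite /= rmorphM /=.
have [e he] := r_homog i; rewrite (gcompMr _ _ he); case: ifP => _.
  by rewrite rmorphM /= (presented_rel hpi) mulr0 mul0r.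
by rewrite raddf0 mul0r.
Qed.

Lemma quotient_grading : exists g, compatible g.
Proof.
have /choice[s hs] := presented_surj hpi.
pose c d a := pi (gcomp fd d (s a)).
have cE d u : c d (pi u) = pi (gcomp fd d u).
  apply/eqP; rewrite -subr_eq0 -!raddfB; apply/eqP/presented_gcomp0.
  by rewrite raddfB /= hs subrr.
have cB d : zmod_morphism (c d).
  by move=> a b; rewrite -(hs a) -(hs b) -raddfB !cE !raddfB.
pose cA d : {additive A -> A} := HB.pack (c d) (GRing.isZmodMorphism.Build A A (c d) (cB d)).
have cc d e a : cA d (cA e a) = if d == e then cA e a else 0.
  rewrite -(hs a) /= !cE gcomp_gcomp; case: eqP => // _; exact: raddf0.
have cbound a : exists M, forall d, (M <= d)%N -> cA d a = 0.
  have [M hM] := gcomp_bound fd (s a); exists M => d /hM h.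
  by rewrite -(hs a) /= cE h raddf0.
have cext a : (forall d, cA d a = 0) -> a = 0.
  move=> h; have [M hM] := gcomp_bound fd (s a).
  rewrite -(hs a) (gcomp_sum hM) raddf_sum big1 // => i _.
  by rewrite /= -cE hs; exact: h.
have cM d a b : cA d (a * b) = \sum_(i < d.+1) cA i a * cA (d - i)%N b.
  rewrite -(hs a) -(hs b) -rmorphM /= cE gcompM raddf_sum.
  by apply: eq_bigr => i _; rewrite /= rmorphM /= !cE.
exists (NatGrading cc cbound cext cM) => d u; exact: cE.
Qed.

Variable g : nat_grading A.
Hypothesis hg : compatible g.

Lemma compatible_homog d u : homog fd d u -> homog g d (pi u).
Proof. by rewrite /homog hg => ->. Qed.

Lemma compatible_gcomp0 a : exists c : K, gcomp g 0 a = c%:A.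
Proof.
have [u <-] := presented_surj hpi a; exists (fd_aug fd u).
by rewrite hg fd_gr0 linearZ /= rmorph1.
Qed.

Lemma compatible_lsplit a : exists (c : K) (b : 'I_n -> A),
  a = c%:A + \sum_i pi (fd_x fd i) * b i.
Proof.
have [u <-] := presented_surj hpi a.
exists (fd_aug fd u), (fun i => pi (fd_ld fd i u)).
rewrite {1}(fd_ldE fd u) raddfD raddf_sum /= linearZ /= rmorph1; congr (_ + _).
by apply: eq_bigr => i _; rewrite /= rmorphM.
Qed.

End QuotientGrading.

Section LeftExactness.
Variables (K : fieldType) (n : nat) (T : algType K) (fd : free_data n T).
Variables (A : algType K) (pi : {lrmorphism T -> A}).
Variables (F : 'M[T]_n) (q : 'I_n -> K) (e : nat).
Local Notation x := (fd_col fd).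
Local Notation f := (F *m x).
Local Notation X := (map_mx pi x).
Local Notation FA := (map_mx pi F).
Hypothesis q_neq0 : forall i, q i != 0.
Hypothesis hF : x^T *m F = f^T *m alg_diag T q.
Hypothesis hpi : presented pi f.
Hypothesis F_homog : forall i j, homog fd e.+1 (F i j).
Variable g : nat_grading A.
Hypothesis hg : compatible fd pi g.
Hypothesis right_exact2 : forall c : 'cV[A]_n, FA *m c = 0 ->
  exists e : 'M[A]_1, c = X *m e.

Lemma gens_homog i : homog g 1 (X i 0).
Proof. by rewrite !mxE; apply: compatible_homog => //; exact: fd_gr1. Qed.

(** [left_exact2_step] leaves new cycles, the rows of U, multiplied by generators of degree 1, so
    agreement below d for these gives agreement below d + 1 for u. *)
Lemma left_exact2_approx d (u : 'rV[A]_n) : u *m FA = 0 ->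
  exists a, forall t i, (t < d)%N -> gcomp g t (u 0 i - a * X i 0) = 0.
Proof.
elim: d u => [|d ih] u hu; first by exists 0.
have [c [U [hU uE]]] := left_exact2_step q_neq0 hF hpi right_exact2 hu.
have /choice[a ha] : forall s, exists a, forall t i, (t < d)%N ->
    gcomp g t (U s i - a * X i 0) = 0.
  move=> s; have [|a ha] := ih (row s U); first by rewrite -row_mul hU row0.
  by exists a => t i td; have := ha t i td; rewrite mxE.
exists (c%:A + \sum_s X s 0 * a s) => t i td.
have -> : u 0 i - (c%:A + \sum_s X s 0 * a s) * X i 0 =
    \sum_s X s 0 * (U s i - a s * X i 0).
  have -> : u 0 i = c%:A * X i 0 + \sum_s X s 0 * U s i.
    by rewrite uE !mxE; congr (_ + _); apply: eq_bigr => s _; rewrite !mxE.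
  rewrite mulrDl opprD addrACA subrr add0r mulr_suml -sumrB.
  by apply: eq_bigr => s _; rewrite mulrBr mulrA.
rewrite raddf_sum big1 // => s _.
case: t td => [|t] td; rewrite (gcompMl _ _ (gens_homog s)) //=.
by rewrite subn1 ha // mulr0.
Qed.

Lemma left_exact2 (u : 'rV[A]_n) : u *m FA = 0 -> exists a, u = a *: X^T.
Proof.
move=> hu; have [N hN] := gcomp_bound_fin g (fun i => u 0 i).
have [a ha] := left_exact2_approx N.+1 hu.
(* The approximating [a] may have components of arbitrarily high degree; as the degrees in [u] are
   below N, they are cut off. *)
exists (trunc g N a); apply/rowP => i; rewrite [RHS]mxE [X in _ * X]mxE.
apply: (gcomp_ext (g := g)) => t; rewrite (gcompMr _ _ (gens_homog i)).
have [tN|Nt] := ltnP t N.+1.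
  have /eqP := ha t i tN; rewrite raddfB subr_eq0 (gcompMr _ _ (gens_homog i)) => /eqP ->.
  case: t tN => //= t tN; rewrite subn1 gcomp_trunc /=; rewrite ltnS in tN.
  by rewrite tN.
rewrite hN ?(ltnW Nt) //; case: t Nt => //= t Nt.
by rewrite subn1 gcomp_trunc ltnNge -ltnS Nt /= mul0r.
Qed.

(** The relations have degree e + 2, hence at least 2, so no generator dies in A. *)
Lemma X_neq0 i : X i 0 != 0.
Proof.
have key u : pi u = 0 -> gcomp fd 1 u = 0.
  move/(presented_ker hpi); elim=> [|a s b v [j ->] _ ih]; first exact: raddf0.
  rewrite raddfD /= ih addr0; have hj : homog fd (e.+1 + 1) (f j 0).
    rewrite mxE; apply: homog_sum => l _; apply: homogM; first exact: F_homog.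
    by rewrite mxE; exact: fd_gr1.
  by rewrite gcompM big1 // => l _; rewrite (gcompMr _ _ hj) addn1 ifN ?mul0r // -leqNgt -ltnS;
    exact: leq_trans (ltn_ord l) _.
apply/eqP; rewrite !mxE => /key; rewrite fd_gr1 => x0.
have := fd_ldM fd i i 1; rewrite x0 mul0r linear0 eqxx => /eqP.
by rewrite eq_sym oner_eq0.
Qed.

Definition socle_mod : lmodType A := submod (kernel_submod (rowmul X^T)).

(* The module in degree 4 is the kernel of the map out of degree 3. *)
Definition socle_complex (i : nat) : lmodType A :=
  match i with
  | 0 => 'rV[A]_1 | 1 => 'rV[A]_n | 2 => 'rV[A]_n | 3 => 'rV[A]_1
  | _ => socle_mod
  end.

Definition socle_complex_d (i : nat) :
    {linear socle_complex i.+1 -> socle_complex i} :=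
  match i with
  | 0 => rowmul X | 1 => rowmul FA | 2 => rowmul X^T
  | 3 => submod_incl (kernel_submod (rowmul X^T))
  | _ => zero_map _ _
  end.

Hypothesis n_gt0 : (0 < n)%N.
Hypothesis pd3 : forall M : lmodType A, projdim_le M 3.

(* The kernel of right multiplication by x is a direct summand of A, hence
   generated by an idempotent, and A is connected. *)
Lemma left_exact3 (a : A) : a *: X^T = 0 -> a = 0.
Proof.
move=> ha; have [|i y i3|y hy|h hh] := @injdim_le_extend _ socle_mod socle_complex
  socle_complex_d 3 _ _ (idfun : {linear socle_mod -> socle_mod}) (projdim_injdim_le _ pd3).
- by move=> [|[|[|//]]] _; exact: row_projective.
- case: i y i3 => [|[|[|//]]] y _ /=; split.
  + by move=> /(left_exact1 hpi)[v ->]; exists v.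
  + by case=> v <-; rewrite -mulmxA -map_mxM map_rel0 // mulmx0.
  + by move=> /left_exact2[b ->]; exists b%:M; rewrite mul_scalar_mx.
  + case=> v <-; rewrite -mulmxA map_trmx -map_mxM.
    by rewrite (map_trmx_rel0 hF hpi) mulmx0.
  + by move=> hy; have [u hu] := @submod_lift _ _ _ (kernel_submod (rowmul X^T)) y hy; exists u.
  + by case=> v <-; exact: (submod_inclP v).
- by apply: submod_incl_inj; rewrite [LHS]hy linear0.
(* [h] is a retraction of A onto the kernel, and [E] is the image of 1. *)
pose E := submod_incl (kernel_submod (rowmul X^T)) (h (const_mx 1)) 0 0.
have hE (b : A) : b *: X^T = 0 -> b = b * E.
  move=> hb; have [|u hu] := @submod_lift _ _ _ (kernel_submod (rowmul X^T)) b%:M.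
    by rewrite /= mul_scalar_mx.
  have bE : b%:M = b *: const_mx 1 :> 'rV[A]_1.
    by apply/rowP => j; rewrite !mxE ord1 eqxx mulr1n mulr1.
  have uE : u = h (submod_incl (kernel_submod (rowmul X^T)) u) := hh u.
  have := congr1 (submod_incl (kernel_submod (rowmul X^T))) uE.
  rewrite !hu {2}bE !linearZ /= => /matrixP/(_ 0 0).
  by rewrite !mxE eqxx mulr1n.
have EX i : E * X i 0 = 0.
  have := submod_inclP (h (const_mx 1)); rewrite /= => /matrixP/(_ 0 i).
  by rewrite [in RHS]mxE [in LHS]mxE big_ord_recl big_ord0 addr0 [X in _ * X]mxE.
have EX0 : E *: X^T = 0 by apply/rowP => i; rewrite [RHS]mxE [LHS]mxE mxE.
have [c [b Eb]] := compatible_lsplit fd hpi E.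
(* [E] is idempotent and E x_i = 0, so of the second factor only its constant c survives. If E is
   non-zero then c = 1, and the part of degree 1 of E x_i = 0 reads x_i = 0. *)
have EcE : E = c *: E.
  rewrite {1}(hE E EX0) {2}Eb mulrDr mulr_sumr big1 ?addr0 => [|i _].
    by rewrite mulr_algr.
  by rewrite mulrA; have := EX i; rewrite !mxE => ->; rewrite mul0r.
have [E0|E0] := eqVneq E 0; first by rewrite (hE a ha) E0 mulr0.
have c1 : c = 1.
  apply/eqP; rewrite -subr_eq0; apply: contraNT E0 => c0.
  rewrite -(scalerK c0 E) scalerBl -EcE scale1r subrr scaler0.
  by [].
have := EX (Ordinal n_gt0) => /(congr1 (gcomp g 1)).
rewrite (gcompMr _ _ (gens_homog _)) /= subnn raddf0 Eb c1 scale1r raddfD raddf_sum.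
rewrite /= big1 => [|i _]; last first.
  by have := gens_homog i; rewrite mxE [X in pi X]mxE => hi; rewrite (gcompMl _ _ hi).
have -> : gcomp g 0 1 = 1.
  have := compatible_homog hg (homog_scalar fd 1).
  by rewrite scale1r rmorph1.
by rewrite addr0 mul1r => /eqP; rewrite (negbTE (X_neq0 _)).
Qed.

End LeftExactness.

Lemma mul_scale_col (S : pzRingType) m n (a : 'M[S]_(m, n)) k c i :
  (a *m (c *: (delta_mx k 0 : 'cV_n))) i 0 = a i k * c.
Proof.
rewrite mxE (bigD1 k) //= big1 => [|j jk]; rewrite !mxE.
  by rewrite !eqxx mulr1 addr0.
by rewrite (negbTE jk) /= !mulr0.
Qed.

Lemma mul_scale_row (S : pzRingType) m n (a : 'M[S]_(n, m)) k c i :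
  ((c *: (delta_mx k 0 : 'cV_n)^T) *m a) 0 i = c * a k i.
Proof.
rewrite mxE (bigD1 k) //= big1 => [|j jk]; rewrite !mxE.
  by rewrite !eqxx mulr1 addr0.
by rewrite (negbTE jk) /= mulr0 mul0r.
Qed.

Lemma mul_row_ek (S : pzRingType) n (a : 'cV[S]_n) k (c : 'M[S]_1) :
  (a^T *m ((delta_mx k 0 : 'cV_n) *m c)) 0 0 = a k 0 * c 0 0.
Proof.
rewrite mulmxA mxE big_ord_recl big_ord0 addr0; congr (_ * _).
by rewrite -[delta_mx k 0]scale1r mul_scale_col mulr1 mxE.
Qed.

Lemma mul_scalar_mxE (S : pzRingType) m n (a : 'M[S]_(m, n)) c i j :
  (c%:M *m a) i j = c * a i j.
Proof. by rewrite mul_scalar_mx mxE. Qed.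

Lemma mul_mx_scalarE (S : pzRingType) m n (a : 'M[S]_(m, n)) c i j :
  (a *m c%:M) i j = a i j * c.
Proof.
rewrite mxE (bigD1 j) //= big1 => [|l lj]; rewrite mxE.
  by rewrite eqxx mulr1n addr0.
by rewrite (negbTE lj) mulr0.
Qed.

(** * The normal extension and its cone complex *)

Section NormalExtension.
Variables (K : fieldType) (n : nat) (T : algType K) (fd : free_data n T).
Variables (A : algType K) (piA : {lrmorphism T -> A}).
Variables (F : 'M[T]_n) (p q : 'I_n -> K) (k : 'I_n).
Local Notation x := (fd_col fd).
Local Notation f := (F *m x).
Local Notation fk := (f k 0).
Hypothesis p_neq0 : forall i, p i != 0.
Hypothesis q_neq0 : forall i, q i != 0.
Hypothesis pk : p k = q k.
Hypothesis hF : x^T *m F = f^T *m alg_diag T q.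
Hypothesis hA : presented piA f.
Variables (sg sg' : {lrmorphism T -> T}).
Hypothesis sg_x : forall i, sg (x i 0) = p i *: x i 0.
Hypothesis sg'_x : forall i, sg' (x i 0) = (p i)^-1 *: x i 0.
Hypothesis sg_f : forall i, sg (f i 0) = (q k / p i) *: f i 0.

(** The zero entry at [k], here and in the first block of [ext_rel], keeps all columns indexed like
    the matrix F. *)
Definition normal_rel : 'cV[T]_n :=
  \col_i (if i == k then 0 else x i 0 * fk - p i *: (fk * x i 0)).
Definition ext_rel : 'cV[T]_(n + n) :=
  col_mx (\col_i (if i == k then 0 else f i 0)) normal_rel.

Variables (D : algType K) (piD : {lrmorphism T -> D}).
Hypothesis hD : presented piD ext_rel.
Local Notation Om := (piD fk).
Local Notation XD := (map_mx piD x).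
Local Notation FD := (map_mx piD F).
Local Notation XA := (map_mx piA x).
Local Notation FA := (map_mx piA F).
Local Notation ek := (delta_mx k 0 : 'cV_n).

Lemma rmorph_fd_ext (S : algType K) (s t : {lrmorphism T -> S}) :
  (forall i, s (x i 0) = t (x i 0)) -> s =1 t.
Proof.
move=> h u; elim/(@fd_ind _ _ _ fd): u => [c|u v hu hv|i u hu].
- by rewrite !linearZ /= !rmorph1.
- by rewrite !rmorphD /= hu hv.
- by have := h i; rewrite mxE !rmorphM /= hu => ->.
Qed.

Lemma sgK : cancel sg sg'.
Proof.
move=> u; have h := @rmorph_fd_ext _ (sg' \o sg : {lrmorphism T -> T}) idfun.
by apply: h => i /=; rewrite sg_x linearZ /= sg'_x scalerA mulfV // scale1r.
Qed.

Lemma sg'K : cancel sg' sg.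
Proof.
move=> u; have h := @rmorph_fd_ext _ (sg \o sg' : {lrmorphism T -> T}) idfun.
by apply: h => i /=; rewrite sg'_x linearZ /= sg_x scalerA mulVf // scale1r.
Qed.

Lemma sg'_f i : sg' (f i 0) = (p i / q k) *: f i 0.
Proof.
rewrite -[RHS]sgK !linearZ /= sg_f linearZ /= scalerA.
by rewrite mulrA divfK // mulfV // scale1r.
Qed.

Lemma piD_rel i : i != k -> piD (f i 0) = 0.
Proof.
move=> ik; have := presented_rel hD (lshift n i).
by rewrite /ext_rel col_mxEu [in X in piD X]mxE (negbTE ik).
Qed.

Lemma piD_f i : piD (f i 0) = if i == k then Om else 0.
Proof. by case: (eqVneq i k) => [->|/piD_rel]. Qed.

Lemma FX_ext : FD *m XD = Om *: ek.
Proof.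
apply/matrixP => i j; rewrite -map_mxM [LHS]mxE (ord1 j) [LHS]piD_f !mxE eqxx andbT.
by case: eqP => _; rewrite ?mulr1 ?mulr0.
Qed.

Lemma XF_ext : XD^T *m FD = (q k *: Om) *: ek^T.
Proof.
rewrite map_trmx -map_mxM hF; apply/matrixP => i j; rewrite [LHS]mxE.
rewrite mul_mx_alg_diag /= linearZ /= [X in piD X]mxE (ord1 i) piD_f !mxE eqxx /=.
by case: eqP => [->|_]; rewrite ?mulr1 ?mulr0 ?scaler0.
Qed.

(** For i = k this is not one of the relations. It follows from associativity of x^T F x, which
    equals x_k Om as well as q_k Om x_k, together with p_k = q_k. *)
Lemma X_normal i : XD i 0 * Om = p i *: (Om * XD i 0).
Proof.
have [->|ik] := eqVneq i k.
  have := mulmxA XD^T FD XD; rewrite FX_ext XF_ext => /matrixP/(_ 0 0).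
  by rewrite mul_scale_col mul_scale_row mxE pk -scalerAl.
have := presented_rel hD (rshift n i).
rewrite /ext_rel col_mxEd /normal_rel [in X in piD X]mxE (negbTE ik).
by rewrite raddfB /= linearZ /= !rmorphM /= => /eqP; rewrite subr_eq0 !mxE => /eqP.
Qed.

Lemma Om_comm u : piD u * Om = Om * piD (sg u).
Proof.
elim/(@fd_ind _ _ _ fd): u => [c|u v hu hv|i u hu].
- by rewrite !linearZ /= !rmorph1 mulr_algl mulr_algr.
- by rewrite !rmorphD /= mulrDl mulrDr hu hv.
- have -> : fd_x fd i = x i 0 by rewrite mxE.
  have xE : piD (x i 0) = XD i 0 by rewrite [RHS]mxE.
  rewrite !rmorphM /= sg_x -[LHS]mulrA hu [LHS]mulrA xE X_normal.
  by rewrite linearZ /= xE -!scalerAl -scalerAr mulrA.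
Qed.

Lemma Om_normal : normal_element Om.
Proof.
apply/seteqP; split=> _ [a _ <-]; have [u <-] := presented_surj hD a.
  by exists (piD (sg' u)) => //; rewrite Om_comm sg'K.
by exists (piD (sg u)) => //; rewrite Om_comm.
Qed.

Lemma piA_piD u : piD u = 0 -> piA u = 0.
Proof.
move/(presented_ker hD); elim=> [|a s b v [i ->] _ ih]; first exact: raddf0.
rewrite raddfD /= ih addr0 !rmorphM /=; suff -> : piA (ext_rel i 0) = 0.
  by rewrite mulr0 mul0r.
case: (splitP i) => j ij; [rewrite (_ : i = lshift n j)|rewrite (_ : i = rshift n j)];
  try exact: val_inj.
  by rewrite col_mxEu mxE; case: eqP => _; rewrite ?raddf0 // (presented_rel hA).
rewrite col_mxEd mxE; case: eqP => _; rewrite ?raddf0 // raddfB /= linearZ /=.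
by rewrite !rmorphM /= (presented_rel hA) mul0r mulr0 scaler0 subr0.
Qed.

Lemma piD_ker u : piA u = 0 -> exists z, piD u = Om * z.
Proof.
move/(presented_ker hA); elim=> [|a s b v [i ->] _ [z hz]].
  by exists 0; rewrite mulr0 raddf0.
rewrite raddfD /= hz !rmorphM /= piD_f; case: eqP => _; last first.
  by exists z; rewrite mulr0 mul0r add0r.
by exists (piD (sg a) * piD b + z); rewrite Om_comm mulrDr mulrA.
Qed.

Lemma exists_theta : exists theta : {lrmorphism D -> A},
  [/\ forall u, theta (piD u) = piA u, forall a, exists y, theta y = a
    & forall y, theta y = 0 <-> exists z, y = Om * z].
Proof.
have /choice[s hs] := presented_surj hD.
pose th a := piA (s a).
have thE u : th (piD u) = piA u.
  apply/eqP; rewrite -subr_eq0 -raddfB; apply/eqP/piA_piD.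
  by rewrite raddfB /= hs subrr.
have thB : zmod_morphism th.
  by move=> a b; rewrite -(hs a) -(hs b) -raddfB /= !thE raddfB.
have thM : monoid_morphism th.
  split=> [|a b]; first by rewrite -(rmorph1 piD) thE rmorph1.
  by rewrite -(hs a) -(hs b) -rmorphM /= !thE rmorphM.
have thZ : scalable th.
  by move=> c a; rewrite -(hs a) -linearZ /= !thE linearZ.
pose theta : {lrmorphism D -> A} := HB.pack th
  (GRing.isZmodMorphism.Build D A th thB)
  (GRing.isMonoidMorphism.Build D A th thM)
  (GRing.isScalable.Build K D A *:%R th thZ).
exists theta; split=> [u|a|y]; first exact: thE.
  by have [u <-] := presented_surj hA a; exists (piD u); exact: thE.
have [u <-] := presented_surj hD y; rewrite [theta _]thE.
split=> [/piD_ker //|[z hz]].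
have [v hv] := presented_surj hD z.
rewrite -thE hz -hv -rmorphM thE rmorphM /= (presented_rel hA) mul0r.
by [].
Qed.

Lemma sg_F i j : sg (F i j) = (q k / (p i * p j)) *: F i j.
Proof.
have h : \sum_l sg (F i l) * (p l *: fd_x fd l) =
    \sum_l ((q k / p i) *: F i l) * fd_x fd l.
  have := sg_f i; rewrite mxE raddf_sum scaler_sumr => h.
  apply: etrans (etrans _ h) _; apply: eq_bigr => l _; rewrite /=.
    by rewrite rmorphM /= sg_x mxE.
  by rewrite mxE -scalerAl.
have /(congr1 (fd_rd fd j)) : \sum_l (p l *: sg (F i l)) * fd_x fd l =
    \sum_l ((q k / p i) *: F i l) * fd_x fd l.
  by rewrite -h; apply: eq_bigr => l _; rewrite -scalerAl -scalerAr.
rewrite !fd_rd_sum => /(congr1 ( *:%R (p j)^-1)).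
rewrite !scalerA mulVf // scale1r => ->.
by rewrite invfM [_^-1 * _]mulrC mulrA.
Qed.

Local Notation FS := (map_mx piD (map_mx sg F)).
Local Notation XS := (map_mx piD (map_mx sg x)).

Lemma sgF_Om i j : FD i j * Om = Om * FS i j.
Proof. by rewrite mxE Om_comm !mxE. Qed.

Lemma XSFS : XS^T *m FS = (q k *: Om) *: ek^T.
Proof.
rewrite map_trmx -map_mxM map_trmx -map_mxM hF; apply/matrixP => i j.
rewrite [LHS]mxE [X in piD X = _]mxE mul_mx_alg_diag /= !linearZ /=.
rewrite [X in piD (sg X)]mxE (ord1 i) sg_f linearZ /= piD_f !mxE eqxx /=.
case: eqP => [->|_]; rewrite ?mulr0 ?scaler0 // mulr1 pk mulfV // scale1r.
by [].
Qed.

Hypothesis right_exact2 : forall c : 'cV[A]_n, FA *m c = 0 ->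
  exists e : 'M[A]_1, c = XA *m e.

Lemma theta_mx_ker (theta : {lrmorphism D -> A}) m1 m2 (a : 'M[D]_(m1, m2)) :
  (forall y, theta y = 0 <-> exists z, y = Om * z) -> map_mx theta a = 0 ->
  exists b, a = Om *: b.
Proof.
move=> hth ha.
have /choice[s hs] : forall ij : 'I_m1 * 'I_m2, exists z, a ij.1 ij.2 = Om * z.
  by move=> ij; apply/hth; move/matrixP/(_ ij.1 ij.2): ha; rewrite !mxE.
by exists (\matrix_(i, j) s (i, j)); apply/matrixP => i j; rewrite [RHS]mxE [X in _ * X]mxE -hs.
Qed.

(** Modulo Om the hypothesis is F a = 0, so a = X d + Om e' by exactness over A. With v = b - e_k d
    - FS e', moving Om through F and F X = Om e_k give Om v = 0, and XS^T FS = q_k Om e_k^T gives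
    the formula for c. *)
Lemma Om_annihilator_aux (a b : 'cV[D]_n) c : FD *m a = Om *: b ->
  c = - (q k *: a k 0) + \sum_i (p i *: XD i 0) * b i 0 ->
  exists v : 'I_n -> D, (forall i, Om * v i = 0) /\
    c = \sum_i (p i *: XD i 0) * v i.
Proof.
move=> hab hc; have [th [thE th_surj th_ker]] := exists_theta.
have th_piD m1 m2 (y : 'M[T]_(m1, m2)) : map_mx th (map_mx piD y) = map_mx piA y.
  by apply/matrixP => i j; rewrite !mxE thE.
have [|e he] := @right_exact2 (map_mx th a).
  rewrite -th_piD -map_mxM hab; apply/matrixP => i j; rewrite [LHS]mxE /= [X in th X]mxE
    [RHS]mxE rmorphM /=.
  have -> : th Om = 0 by rewrite thE (presented_rel hA).
  by rewrite mul0r.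
have [d hd] : exists d : 'M[D]_1, map_mx th d = e.
  have /choice[s hs] := th_surj.
  by exists (map_mx s e); apply/matrixP => i j; rewrite !mxE hs.
have [e' he'] : exists e', a - XD *m d = Om *: e'.
  by apply: (theta_mx_ker th_ker); rewrite map_mxB map_mxM hd th_piD he subrr.
have {he'}aE : a = XD *m d + Om *: e' by rewrite -he' addrC subrK.
pose v := b - ek *m d - FS *m e'.
have FOm (y : 'cV[D]_n) : FD *m (Om *: y) = Om *: (FS *m y).
  apply/matrixP => i j; rewrite [LHS]mxE [RHS]mxE [X in _ * X]mxE mulr_sumr.
  by apply: eq_bigr => l _; rewrite [X in _ * X]mxE !mulrA sgF_Om.
exists (fun i => v i 0); split=> [i|].
  have : Om *: v = 0.
    rewrite !scalerBr -hab aE mulmxDr FOm mulmxA FX_ext -scalemxAl.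
    by rewrite [X in X - _]addrAC subrr add0r subrr.
  by move/matrixP/(_ i 0); rewrite [LHS]mxE [in RHS]mxE.
have XSE i : XS i 0 = p i *: XD i 0.
  by rewrite [LHS]mxE [X in piD X]mxE sg_x linearZ /= [X in _ = _ *: X]mxE.
have bE : b = ek *m d + FS *m e' + v by rewrite /v addrC -[b - _ - _]addrA -opprD subrK.
rewrite hc; under eq_bigr => i _ do rewrite -XSE.
under [RHS]eq_bigr => i _ do rewrite -XSE.
have sumE (y : 'cV[D]_n) : \sum_i XS i 0 * y i 0 = (XS^T *m y) 0 0.
  by rewrite [RHS]mxE; apply: eq_bigr => i _; rewrite [XS^T 0 i]mxE.
rewrite !sumE bE !mulmxDr (mulmxA _ FS) XSFS.
rewrite [X in _ + X = _]mxE [X in _ + (X + _) = _]mxE mul_scale_row.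
rewrite mul_row_ek XSE pk aE [X in _ *: X]mxE [X in _ *: (_ + X)]mxE.
rewrite mxE big_ord_recl big_ord0 addr0.
rewrite scalerDr opprD -!scalerAl addrA addrACA.
by rewrite addNr addNr !add0r.
Qed.

Lemma Om_annihilator c : Om * c = 0 ->
  exists v : 'I_n -> D, (forall i, Om * v i = 0) /\
    c = \sum_i (p i *: XD i 0) * v i.
Proof.
have [u <-] := presented_surj hD c; rewrite -rmorphM => hc.
pose y : 'rV[T]_1 := (fk * u)%:M.
have [B [I' [I'0 hB]]] : exists (B : 'M[T]_(n + n, 1)) (t : 'M[T]_(n, 1)),
    map_mx piD t = 0 /\ y = ext_rel^T *m B + x^T *m t.
  have hy : map_mx piD y = 0 by rewrite map_scalar_mx /= hc raddf0.
  exact: presented_ldecomp.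
pose al := usubmx B; pose be := dsubmx B.
pose Ek := alg_diag T (fun i => if i == k then 0 else 1).
pose P := alg_diag T p.
pose Qi := alg_diag T (fun i => (q i)^-1).
have fT : f^T = x^T *m F *m Qi by exact: superpotential_tr.
pose b1 := Ek *m be.
have b1E i : b1 i 0 = (if i == k then 0 else 1) *: be i 0.
  by rewrite /b1 mul_alg_diag.
clearbody b1.
(* The decomposition of [fk * u] in the ideal of D, after every f^T has been written as x^T F Qi and
   the leading x^T cancelled. *)
have E1 : F *m (Qi *m (u *: ek)) = F *m (Qi *m (Ek *m al)) + fk *: b1 -
    F *m (Qi *m (ek *m (x^T *m (P *m b1)))) + I'.
  apply: (@fd_col_linv _ _ _ fd); rewrite !(mulmxDr, mulmxN) !mulmxA -!fT.
  have -> : f^T *m (u *: ek) = y.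
    by apply/matrixP => i j; rewrite !ord1 mul_scale_col [RHS]mxE eqxx mulr1n mxE.
  rewrite hB -[B]vsubmxK /ext_rel tr_col_mx mul_row_col -/al -/be; congr (_ + _).
  rewrite -[RHS]addrA; congr (_ + _).
    congr (_ *m _); apply/matrixP => i j; rewrite mul_mx_alg_diag !(ord1 i).
    rewrite [LHS]mxE [LHS]mxE [X in _ *: X]mxE.
    by case: eqP => _; rewrite ?scale0r ?scale1r.
  apply/matrixP => i j; rewrite (ord1 j) (ord1 i) -!mulmxA.
  rewrite mxE [RHS]mxE [X in _ = _ + X]mxE mul_row_ek mxE [X in fk * X]mxE.
  rewrite mulr_sumr -sumrB; apply: eq_bigr => l _.
  rewrite mul_alg_diag ![in x^T 0 l]mxE [normal_rel^T 0 l]mxE [normal_rel l 0]mxE.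
  rewrite [(fk *: b1) l 0]mxE b1E; case: eqP => _.
    by rewrite mul0r scale0r scaler0 !mulr0 subr0.
  rewrite scale1r mulrBl !mulrA; congr (_ - _).
  by rewrite -scalerAl -scalerAr.
(* The arguments of F in [E1], collected so that F a = - Om b1 in D. As [Ek *m al] vanishes at k,
   the entry a_k recovers u up to the factor - q_k and the sum over b1. *)
pose a := Qi *m (Ek *m al) - Qi *m (u *: ek) - Qi *m (ek *m (x^T *m (P *m b1))).
have Fa : F *m a = - (fk *: b1) - I'.
  rewrite /a !mulmxBr E1 !opprD opprK.
  by rewrite !addrA subrr sub0r addrAC addrK.
apply: (@Om_annihilator_aux (map_mx piD a) (map_mx piD (- b1))).
  rewrite -map_mxM Fa map_mxB I'0 subr0 !map_mxN map_mxZ.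
  by rewrite scalerN.
have ak : a k 0 = - ((q k)^-1 *: (u + (x^T *m (P *m b1)) 0 0)).
  have subE (s t : 'cV[T]_n) : (s - t) k 0 = s k 0 - t k 0 by rewrite !mxE.
  rewrite /a !subE !mul_alg_diag eqxx scale0r scaler0 sub0r.
  rewrite [(u *: ek) k 0]mxE [ek k 0]mxE !eqxx mulr1 scalerDr opprD.
  congr (_ - _ *: _); rewrite mxE big_ord_recl big_ord0 addr0.
  by rewrite mxE !eqxx mul1r.
have -> : \sum_i (p i *: XD i 0) * map_mx piD (- b1) i 0 =
    - piD ((x^T *m (P *m b1)) 0 0).
  rewrite mxE raddf_sum -sumrN; apply: eq_bigr => i _.
  rewrite [XD i 0]mxE [map_mx piD _ _ _]mxE [(- b1) i 0]mxE mul_alg_diag.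
  by rewrite [x^T 0 i]mxE raddfN /= rmorphM /= linearZ /= mulrN -scalerAl -scalerAr.
rewrite [map_mx piD a k 0]mxE ak raddfN scalerN opprK /= linearZ /= scalerA.
by rewrite mulfV // scale1r raddfD /= addrK.
Qed.

Variable g : nat_grading D.
Hypothesis hg : compatible fd piD g.

Lemma Om_left_regular c : Om * c = 0 -> c = 0.
Proof.
suff key d : forall c, Om * c = 0 -> forall t, (t < d)%N -> gcomp g t c = 0.
  by move=> hc; apply: (gcomp_ext0 (n := g)) => t; exact: key hc t (ltnSn t).
elim: d => [//|d ih] {}c /Om_annihilator[v [hv ->]] t td.
rewrite raddf_sum big1 // => i _ /=; rewrite -scalerAl scalerAr.
rewrite (gcompMl _ _ (gens_homog hg i)); case: t td => [//|t] td /=.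
by rewrite subn1 ih ?mulr0 // -scalerAr hv scaler0.
Qed.

Lemma ideal_stable (S : algType K) (pi : {lrmorphism T -> S}) N (r : 'cV[T]_N)
    (s : {lrmorphism T -> T}) : presented pi r ->
  (forall i, pi (s (r i 0)) = 0) -> forall u, pi u = 0 -> pi (s u) = 0.
Proof.
move=> hpi hs u /(presented_ker hpi); elim=> [|a t b v [i ->] _ ih].
  by rewrite !raddf0.
by rewrite !raddfD /= ih addr0 !rmorphM /= hs mulr0 mul0r.
Qed.

Lemma sg_ker u : piA u = 0 -> piA (sg u) = 0.
Proof.
by apply: (ideal_stable hA) => i; rewrite sg_f linearZ /= (presented_rel hA) scaler0.
Qed.

Lemma sg'_ker u : piA u = 0 -> piA (sg' u) = 0.
Proof.
by apply: (ideal_stable hA) => i; rewrite sg'_f linearZ /= (presented_rel hA) scaler0.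
Qed.

Lemma sg'_fk : sg' fk = fk.
Proof. by rewrite sg'_f pk mulfV // scale1r. Qed.

Lemma sg'_ext_ker u : piD u = 0 -> piD (sg' u) = 0.
Proof.
apply: (ideal_stable hD) => i.
suff [c ->] : exists c, sg' (ext_rel i 0) = c *: ext_rel i 0.
  by rewrite linearZ /= (presented_rel hD) scaler0.
case: (splitP i) => j ij; [rewrite (_ : i = lshift n j)|rewrite (_ : i = rshift n j)];
  try exact: val_inj.
  exists (p j / q k); rewrite col_mxEu mxE; case: eqP => _; last exact: sg'_f.
  by rewrite raddf0 scaler0.
exists (p j)^-1; rewrite col_mxEd mxE; case: eqP => _; first by rewrite raddf0 scaler0.
rewrite raddfB /= linearZ /= !rmorphM /= sg'_fk sg'_x scalerBr.
by rewrite -!scalerAl -!scalerAr !scalerA [p j * _]mulrC.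
Qed.

(** Moving Om to the left turns u into sg(u), and [sg'], which preserves the ideal of D, brings
    sg(u) = 0 back to u = 0. *)
Lemma Om_right_regular c : c * Om = 0 -> c = 0.
Proof.
have [u <-] := presented_surj hD c; rewrite Om_comm => /Om_left_regular/sg'_ext_ker.
by rewrite sgK.
Qed.

Lemma Om_regular : regular_element Om.
Proof.
split=> y z; rewrite /= => h; apply/eqP; rewrite -subr_eq0; apply/eqP.
  by apply: Om_left_regular; rewrite mulrBr h subrr.
by apply: Om_right_regular; rewrite mulrBl h subrr.
Qed.

Lemma Om_comm' u : Om * piD u = piD (sg' u) * Om.
Proof. by rewrite Om_comm sg'K. Qed.

(** * The cone of the multiplication by Om *)

Definition cone_rk (i : nat) : nat :=
  match i with 0 => 1 | 1 => n | 2 => n | 3 => 1 | _ => 0 end.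
Definition cone_rk1 (i : nat) : nat := if i is i'.+1 then cone_rk i' else 0.

Definition cone_d (i : nat) : 'M[T]_(cone_rk i.+1, cone_rk i) :=
  match i with 0 => x | 1 => F | 2 => x^T | _ => 0 end.
Definition cone_d1 (i : nat) : 'M[T]_(cone_rk1 i.+1, cone_rk1 i) :=
  match i with 0 => 0 | i'.+1 => cone_d i' end.
(** The quotients by Om of - F x = - Om e_k and of - x^T F = - q_k Om e_k^T, the only two
    compositions of the lifted maps that do not vanish. *)
Definition cone_h (i : nat) : 'M[D]_(cone_rk i.+1, cone_rk1 i) :=
  match i with 1 => - ek | 2 => - ((q k)%:A *: ek^T) | _ => 0 end.

Local Notation "a ^D" := (map_mx piD a) (at level 2, format "a ^D").
Local Notation "a ^psi" := (map_mx piD (map_mx sg' a)) (at level 2, format "a ^psi").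

(* The cone of the multiplication by Om on a twist of the lifted complex of A;
   two successive maps of that lift compose to a multiple of Om, which the
   homotopy cone_h compensates. *)
Definition cone_mx (i : nat) :
    'M[D]_(cone_rk i.+1 + cone_rk1 i.+1, cone_rk i + cone_rk1 i) :=
  block_mx (cone_d i)^D (cone_h i) Om%:M (- (cone_d1 i)^psi).

Lemma mapDE m1 m2 (a : 'M[T]_(m1, m2)) i j : a^D i j = piD (a i j).
Proof. by rewrite mxE. Qed.
Lemma mappsiE m1 m2 (a : 'M[T]_(m1, m2)) i j : a^psi i j = piD (sg' (a i j)).
Proof. by rewrite !mxE. Qed.

Lemma Om_mx m1 m2 (a : 'M[T]_(m1, m2)) : Om%:M *m a^D = a^psi *m Om%:M.
Proof.
apply/matrixP => i j; rewrite mul_scalar_mxE mul_mx_scalarE.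
by rewrite mapDE mappsiE Om_comm'.
Qed.

Lemma cone_dd i : (cone_d i.+1 *m cone_d i)^D = - (cone_h i.+1 *m Om%:M).
Proof.
case: i => [|[|[|i]]]; last by rewrite /= mul0mx map_mx0 mul0mx oppr0.
- rewrite /= map_mxM FX_ext mulNmx opprK.
  apply/matrixP => i j; rewrite mul_mx_scalarE [LHS]mxE [ek i j]mxE.
  by case: (_ && _); rewrite ?mulr1 ?mul1r ?mulr0 ?mul0r.
- rewrite /= map_mxM -map_trmx XF_ext mulNmx opprK.
  apply/matrixP => i j; rewrite mul_mx_scalarE [LHS]mxE [X in X * Om]mxE [ek^T i j]mxE.
  rewrite [ek j i]mxE.
  by case: (_ && _); rewrite ?mulr1 ?mulr0 ?mul0r // mulr_algl.
- by apply/matrixP => -[].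
Qed.

Lemma map_sg'_f : f^psi = Om *: ek.
Proof.
apply/matrixP => i j; rewrite (ord1 j) mappsiE sg'_f linearZ /=.
rewrite piD_f [RHS]mxE [ek i 0]mxE eqxx andbT; case: eqP => [->|_].
  by rewrite pk mulfV // scale1r mulr1.
by rewrite scaler0 mulr0.
Qed.

Lemma cone_hh i : Om%:M *m cone_h i.+1 =
  - (map_mx piD (map_mx sg' (cone_d1 i.+2 *m cone_d1 i.+1))).
Proof.
case: i => [|[|[|i]]]; last by apply/matrixP => -[].
- by rewrite /= map_sg'_f mulmxN mul_scalar_mx.
- rewrite /= mulmxN mul_scalar_mx; congr (- _).
  rewrite hF; apply/matrixP => i j; rewrite (ord1 i) mappsiE.
  rewrite mul_mx_alg_diag linearZ /= linearZ /=.
  have -> : piD (sg' (f^T 0 j)) = (f^psi) j 0 by rewrite mappsiE [f^T 0 j]mxE.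
  rewrite map_sg'_f ![in LHS]mxE ![in RHS]mxE; case: eqP => [->|_] /=.
    by rewrite !mulr1 mulr_algr.
  by rewrite !mulr0 scaler0.
- by apply/matrixP => -[].
Qed.

(** The one case with content compares x_k with q_k sg'(x_k) = (q_k / p_k) x_k. *)
Lemma cone_dh i : (cone_d i.+1)^D *m cone_h i = cone_h i.+1 *m (cone_d1 i)^psi.
Proof.
case: i => [|[|[|i]]]; last by apply/matrixP => -[].
- by apply/matrixP => i [].
- rewrite /=; apply/matrixP => i j; rewrite !(ord1 i) !(ord1 j).
  rewrite mulmxN mulNmx [LHS]mxE [RHS]mxE; congr (- _).
  rewrite mul_scale_row -[delta_mx k 0]scale1r mul_scale_col mulr1.
  rewrite mapDE mappsiE [x^T 0 k]mxE sg'_x.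
  by rewrite linearZ /= mulr_algl scalerA -pk mulfV // scale1r.
- by apply/matrixP => -[].
Qed.

Lemma cone_complex i : cone_mx i.+1 *m cone_mx i = 0.
Proof.
rewrite /cone_mx /= mulmx_block -map_mxM cone_dd addNr cone_dh mulmxN addrN.
rewrite Om_mx mulNmx addrN mulNmx mulmxN opprK.
have -> : Om%:M *m cone_h i + (cone_d i)^psi *m (cone_d1 i)^psi = 0.
  case: i => [|i]; first by apply/matrixP => j [].
  by rewrite cone_hh -!map_mxM addNr.
exact: block_mx0.
Qed.

Hypothesis left_exactA : forall i (u : 'rV[A]_(cone_rk i.+1)),
  u *m map_mx piA (cone_d i) = 0 -> exists v, u = v *m map_mx piA (cone_d i.+1).
Hypothesis right_exactA : forall i (c : 'cV[A]_(cone_rk i)), (i < 3)%N ->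
  map_mx piA (cone_d i) *m c = 0 -> exists b, c = map_mx piA (cone_d1 i) *m b.

(** By exactness over A the first block of a cycle is a boundary up to a multiple of Om, so
    subtracting a boundary of the cone makes that block zero. A cycle (0, v') satisfies v' Om = 0,
    and Om is regular. *)
Lemma cone_left_exact i (w : 'rV[D]_(cone_rk i.+1 + cone_rk1 i.+1)) :
  w *m cone_mx i = 0 -> exists v, w = v *m cone_mx i.+1.
Proof.
have [th [thE th_surj th_ker]] := exists_theta.
have th_piD m1 m2 (y : 'M[T]_(m1, m2)) : map_mx th y^D = map_mx piA y.
  by apply/matrixP => a b; rewrite !mxE thE.
have thOm : th Om = 0 by rewrite thE (presented_rel hA).
rewrite -[w]hsubmxK; set u := lsubmx w; set v := rsubmx w.
rewrite mul_row_block => h; have [huv _] := eq_row_mx (etrans h (esym (row_mx0 _ _ _ _))).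
have [y hy] : exists y, map_mx th u = y *m map_mx piA (cone_d i.+1).
  apply: left_exactA; rewrite -th_piD -map_mxM.
  have -> : u *m (cone_d i)^D = - (v *m Om%:M) by apply/eqP; rewrite -addr_eq0 huv.
  rewrite map_mxN; apply/eqP; rewrite oppr_eq0; apply/eqP/matrixP => a b.
  by rewrite mxE /= mul_mx_scalarE rmorphM /= thOm mulr0 mxE.
have [y' hy'] : exists y', map_mx th y' = y.
  have /choice[s hs] := th_surj.
  by exists (map_mx s y); apply/matrixP => a b; rewrite !mxE hs.
have [z hz] : exists z, u - y' *m (cone_d i.+1)^D = z *m Om%:M.
  have [b hb] : exists b, u - y' *m (cone_d i.+1)^D = Om *: b.
    by apply: (theta_mx_ker th_ker); rewrite map_mxB map_mxM hy' th_piD hy subrr.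
  have /choice[s hs] : forall d, exists d', Om * d = d' * Om.
    move=> d; have [t <-] := presented_surj hD d.
    by exists (piD (sg' t)); rewrite Om_comm'.
  by exists (map_mx s b); rewrite hb; apply/matrixP => a c; rewrite mul_mx_scalarE
    [LHS]mxE [X in _ = X * _]mxE hs.
pose w' := row_mx u v - row_mx y' z *m cone_mx i.+1.
have hw' : w' *m cone_mx i = 0.
  by rewrite mulmxBl -mulmxA cone_complex mulmx0 subr0 mul_row_block.
pose v' := rsubmx w'.
have w'E : w' = row_mx 0 v'.
  rewrite -[w']hsubmxK; congr row_mx; rewrite /w' mul_row_block opp_row_mx.
  by rewrite add_row_mx row_mxKl opprD addrA hz subrr.
have v0 : v' = 0.
  move: hw'; rewrite w'E mul_row_block !mul0mx !add0r => h'.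
  have [hv' _] := eq_row_mx (etrans h' (esym (row_mx0 _ _ _ _))).
  apply/matrixP => a b; rewrite [RHS]mxE; apply: Om_right_regular.
  by move/matrixP/(_ a b): hv'; rewrite mul_mx_scalarE => ->; rewrite mxE.
exists (row_mx y' z); apply/eqP; rewrite -subr_eq0 -/w' w'E v0 row_mx0.
by [].
Qed.

(** The mirror image of [cone_left_exact], with the second block reduced to zero. The map on that
    block is twisted by [sg'], so exactness over A is applied to the image under [sg] of a lift, and
    the result is twisted back. *)
Lemma cone_right_exact i (c : 'cV[D]_(cone_rk i.+1 + cone_rk1 i.+1)) : (i < 3)%N ->
  cone_mx i.+1 *m c = 0 -> exists b, c = cone_mx i *m b.
Proof.
move=> i3.
have [th [thE th_surj th_ker]] := exists_theta.
have thOm : th Om = 0 by rewrite thE (presented_rel hA).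
rewrite -[c]vsubmxK; set c1 := usubmx c; set c2 := dsubmx c.
rewrite mul_block_col => h; have [_ h2] := eq_col_mx (etrans h (esym (col_mx0 _ _ _ _))).
have {h2}h2 : (cone_d i)^psi *m c2 = Om%:M *m c1.
  by apply/eqP; rewrite -subr_eq0 -oppr_eq0 opprB -mulNmx h2.
have [t ht] := presented_mx hD c2.
have [b hb] : exists b, map_mx piA (map_mx sg t) = map_mx piA (cone_d1 i) *m b.
  apply: right_exactA => //; rewrite -map_mxM.
  have ht0 : map_mx piA (map_mx sg' (cone_d i) *m t) = 0.
    apply/matrixP => a j; rewrite mxE [RHS]mxE -thE.
    have -> : piD ((map_mx sg' (cone_d i) *m t) a j) = ((cone_d i)^psi *m c2) a j.
      by rewrite -ht -map_mxM mapDE.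
    by rewrite h2 mul_scalar_mxE rmorphM /= thOm mul0r.
  apply/matrixP => a j; rewrite mxE [RHS]mxE.
  have -> : (cone_d i *m map_mx sg t) a j = sg ((map_mx sg' (cone_d i) *m t) a j).
    rewrite !mxE raddf_sum; apply: eq_bigr => l _.
    by rewrite /= rmorphM /= !mxE sg'K.
  by apply: sg_ker; move/matrixP/(_ a j): ht0; rewrite mxE [RHS]mxE.
have [b' hb'] := presented_mx hA b.
have [z hz] : exists z, c2 - (cone_d1 i)^psi *m (map_mx sg' b')^D = Om *: z.
  apply: (theta_mx_ker th_ker); apply/matrixP => a j; rewrite [RHS]mxE [LHS]mxE.
  rewrite -ht -map_mxM -map_mxM -raddfB mapDE thE.
  have /matrixP/(_ a j) : map_mx piA (map_mx sg t - cone_d1 i *m b') = 0.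
    by rewrite map_mxB map_mxM hb' hb subrr.
  rewrite mxE [RHS]mxE => /sg'_ker; apply: etrans; congr (piA _).
  have -> : t - map_mx sg' (cone_d1 i *m b') =
      map_mx sg' (map_mx sg t - cone_d1 i *m b').
    rewrite map_mxB; congr (_ - _).
    by apply/matrixP => a' j'; rewrite !mxE /= sgK.
  by rewrite [LHS]mxE.
pose b0 := - (map_mx sg' b')^D.
pose c' := col_mx c1 c2 - cone_mx i *m col_mx z b0.
have hc' : cone_mx i.+1 *m c' = 0.
  by rewrite mulmxBr mulmxA cone_complex mul0mx subr0 mul_block_col.
pose c1' := usubmx c'.
have c'E : c' = col_mx c1' 0.
  rewrite -[c']vsubmxK; congr col_mx; rewrite /c' mul_block_col opp_col_mx.
  rewrite add_col_mx col_mxKd /b0 mulmxN mulNmx opprK mul_scalar_mx -hz.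
  by rewrite subrK subrr.
have c0 : c1' = 0.
  move: hc'; rewrite c'E mul_block_col !mulmx0 !addr0 => h'.
  have [_ hc1] := eq_col_mx (etrans h' (esym (col_mx0 _ _ _ _))).
  apply/matrixP => a j; rewrite [RHS]mxE; apply: Om_left_regular.
  by move/matrixP/(_ a j): hc1; rewrite mul_scalar_mxE => ->; rewrite mxE.
exists (col_mx z b0); apply/eqP; rewrite -subr_eq0 -/c' c'E c0 col_mx0.
by [].
Qed.

Lemma cone_left_aug (u : 'rV[D]_(cone_rk 0 + cone_rk1 0)) :
  gcomp g 0 (u 0 0) = 0 -> exists v, u = v *m cone_mx 0.
Proof.
have [t ht] := presented_surj hD (u 0 0); rewrite -ht hg => ht0.
have tE : piD t = \sum_i piD (fd_rd fd i t) * XD i 0.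
  rewrite [in LHS](fd_rdE fd t) raddfD /= -fd_gr0 ht0 add0r raddf_sum.
  by apply: eq_bigr => i _; rewrite /= rmorphM /= mxE mxE.
exists (row_mx (\row_i piD (fd_rd fd i t)) 0).
rewrite /cone_mx mul_row_block !mul0mx !addr0 -[LHS]hsubmxK; congr row_mx; last first.
  by apply/matrixP => i [].
apply/matrixP => i j; rewrite (ord1 i) (ord1 j) [RHS]mxE [LHS]mxE.
have -> : u 0 (lshift (cone_rk1 0) 0) = piD t by rewrite ht; congr (u _ _); exact: val_inj.
by rewrite tE; apply: eq_bigr => l _; rewrite [X in _ = X * _]mxE.
Qed.

Lemma cone_right_top (c : 'cV[D]_(cone_rk 4 + cone_rk1 4)) :
  gcomp g 0 (c 0 0) = 0 -> exists b, c = cone_mx 3 *m b.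
Proof.
have [t ht] := presented_surj hD (c 0 0); rewrite -ht hg => ht0.
have tE : piD t = \sum_i XD i 0 * piD (fd_ld fd i t).
  rewrite [in LHS](fd_ldE fd t) raddfD /= -fd_gr0 ht0 add0r raddf_sum.
  by apply: eq_bigr => i _; rewrite /= rmorphM /= mxE mxE.
(* The last map is minus the twist of x^T, with entries - p_i^-1 x_i; the sign and the factors p_i
   undo this. *)
exists (col_mx 0 (- \col_i (p i *: piD (fd_ld fd i t)))).
rewrite /cone_mx mul_block_col !mulmx0 !add0r -[LHS]vsubmxK; congr col_mx.
  by apply/matrixP => -[].
apply/matrixP => i j; rewrite (ord1 i) (ord1 j) mulmxN mulNmx opprK [RHS]mxE [LHS]mxE.
have -> : c (rshift (cone_rk 4) 0) 0 = piD t by rewrite ht; congr (c _ _); exact: val_inj.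
rewrite tE; apply: eq_bigr => l _; rewrite mappsiE [X in _ = _ * X]mxE /= [x^T _ _]mxE sg'_x.
by rewrite linearZ /= -scalerAl -scalerAr scalerA mulVf // scale1r [XD l 0]mxE.
Qed.

Variable e : nat.
Hypothesis F_homog : forall i j, homog fd e.+1 (F i j).

(** With m = e + 2 the generators over A lie in degrees 0, 1, m, m + 1, and [cone_dg1] adds the
    degree m of Om. The last generator of the cone gets degree 2m + 1, which becomes the Gorenstein
    parameter of D. *)
Definition cone_dg (i : nat) : nat :=
  match i with 0 => 0 | 1 => 1 | 2 => e.+2 | _ => e.+3 end.
Definition cone_dg1 (i : nat) : nat := if i is i'.+1 then (cone_dg i' + e.+2)%N else 0.
Definition cone_deg (i : nat) (j : 'I_(cone_rk i + cone_rk1 i)) : nat :=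
  match fintype.split j with inl _ => cone_dg i | inr _ => cone_dg1 i end.

Lemma homogZ d c u : homog fd d u -> homog fd d (c *: u).
Proof. by rewrite /homog gcompZ => ->. Qed.

Lemma fk_homog : homog fd e.+2 fk.
Proof.
rewrite mxE; apply: homog_sum => l _; rewrite -addn1; apply: homogM => //.
by rewrite mxE; exact: fd_gr1.
Qed.

Lemma sg'_F i j : sg' (F i j) = (p i * p j / q k) *: F i j.
Proof.
rewrite -[RHS]sgK !linearZ /= sg_F linearZ /= scalerA.
rewrite mulrA divfK // divff ?scale1r //.
by rewrite mulf_neq0.
Qed.

Lemma cone_d_homog i a b : (cone_dg i <= cone_dg i.+1)%N /\ homog fd (cone_dg i.+1 - cone_dg i)
  (cone_d i a b).
Proof.
case: i a b => [|[|[|i]]] a b /=; split; rewrite ?ltnS ?leqnSn ?leq0n //.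
- by rewrite (ord1 b) mxE; exact: fd_gr1.
- by rewrite mxE (ord1 a) mxE subSnn; exact: fd_gr1.
- by rewrite mxE; exact: homog0.
Qed.

Lemma cone_psi_homog i a b d : homog fd d (cone_d i a b) ->
  homog fd d (sg' (cone_d i a b)).
Proof.
case: i a b => [|[|[|i]]] a b /= h.
- by rewrite (ord1 b) sg'_x -(ord1 b); exact: homogZ.
- by rewrite sg'_F; exact: homogZ.
- by move: h; rewrite mxE (ord1 a) => h; rewrite sg'_x; exact: homogZ.
- by rewrite mxE raddf0; exact: homog0.
Qed.

Lemma scalar_homog c : homog g 0 (c%:A).
Proof.
have := compatible_homog hg (homog_scalar fd c).
by rewrite linearZ /= rmorph1.
Qed.

Lemma cone_mx_homog i a b : cone_mx i a b = 0 \/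
  (cone_deg b <= cone_deg a)%N /\ homog g (cone_deg a - cone_deg b) (cone_mx i a b).
Proof.
rewrite /cone_mx; case: (split_ordP a) => a' ->; case: (split_ordP b) => b' ->;
  rewrite /cone_deg ?(unsplitK (inl _)) ?(unsplitK (inr _)).
- right; rewrite block_mxEul mapDE; have [h1 h2] := cone_d_homog a' b'.
  by split=> //; exact: compatible_homog.
- rewrite block_mxEur; case: i a' b' {a b} => [|[|[|i]]] a' b' /=.
  + by case: b'.
  + right; split; first by rewrite add0n.
    rewrite add0n subnn mxE; have := scalar_homog (- ((a' == k) && (b' == 0))%:R).
    by rewrite scaleNr scaler_nat mxE.
  + right; split; first by rewrite add1n.
    rewrite add1n subnn mxE; have := scalar_homog (- (q k * ((b' == k) && (a' == 0))%:R)).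
    by rewrite !mxE scaleNr -scalerA scaler_nat mulr_algl.
  + by left; rewrite mxE.
- rewrite block_mxEdl mxE; case: eqP => [ab|_]; last by left.
  right; rewrite mulr1n /=; split; first exact: leq_addr.
  by rewrite addKn; apply: compatible_homog fk_homog.
- rewrite block_mxEdr mxE mappsiE; case: i a' b' {a b} => [|i] a' b' /=.
    by case: b'.
  have [h1 h2] := cone_d_homog a' b'; right; split; first by rewrite leq_add2r.
  rewrite subnDr /homog raddfN; congr (- _).
  by apply: compatible_homog => //; exact: cone_psi_homog.
Qed.

End NormalExtension.

Lemma exists_basis (K : fieldType) (M : lmodType K) :
  exists (Y : choiceType) (v : Y -> M),
    (forall h : malg Y K, malg_ev v h = 0 -> h = 0) /\
    (forall u, exists h : malg Y K, u = malg_ev v h).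
Proof.
have W0 : submod_set [set (0 : M)].
  by split=> // a x y /= -> ->; rewrite scaler0 addr0.
have [X [Xfree Xspan]] := relative_basis W0.
pose Y : choiceType := {x : M | `[< X x >]}.
pose inj (h : malg Y K) : malg M K := malg_ev (fun y => mkmalgU (val y) 1) h.
have injE (h : malg Y K) x :
    mcoeff x (inj h) = if insub x is Some y then mcoeff y h else 0.
  rewrite /inj /malg_ev raddf_sum /=.
  under eq_bigr => y _ do rewrite mcoeffZ mcoeffU.
  case: insubP => [y _ yx|nx].
    have [yh|yh] := boolP (y \in msupp h).
      rewrite (big_fsetD1 y) //= yx eqxx mulr1 big1_seq ?addr0 // => z.
      move=> /andP[_]; rewrite in_fsetD1 => /andP[/negbTE zy _].
      by rewrite -yx -[sval z]/(val z) (inj_eq val_inj) zy mulr0.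
    rewrite (mcoeff_outdom yh) big1_seq // => z /andP[_ zh].
    rewrite -yx -[sval z]/(val z) (inj_eq val_inj).
    case: eqP => [zy|_]; last by rewrite mulr0.
    by rewrite -zy zh in yh.
  rewrite big1 // => z _; case: eqP => [zx|_]; last by rewrite mulr0.
  by case/negP: nx; rewrite -zx; exact: (valP z).
have injev (h : malg Y K) : malg_ev id (inj h) = malg_ev val h.
  rewrite /inj {1}/malg_ev -/(malg_ev id _) linear_sum; apply: eq_bigr => y _.
  by rewrite linearZ /= malg_evU scale1r.
exists Y, val; split=> [h h0|u].
  have : inj h = 0.
    apply: Xfree; last by rewrite injev h0.
    move=> x; rewrite -mcoeff_neq0 injE; case: insubP => [y yX _ _|_]; last by rewrite eqxx.
    by apply/asboolP; exact: yX.
  move=> hh; apply/malgP => y; have := injE h (val y).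
  by rewrite hh valK mcoeff0 => <-; rewrite mcoeff0.
have [h sh hu] := Xspan u.
exists (\sum_(x <- msupp h)
  (if insub x is Some y then mkmalgU (y : Y) (mcoeff x h) else 0)).
have -> : u = malg_ev id h by apply/eqP; rewrite -subr_eq0; apply/eqP.
rewrite linear_sum; apply: eq_big_seq => x xh.
case: insubP => [y _ yx|nx]; first by rewrite [RHS]malg_evU yx.
by case/negP: nx; apply/asboolP; exact: sh.
Qed.

(** * Filtered free modules and their leading forms *)

Section FilteredResolution.
Variables (K : fieldType) (S : algType K) (g : nat_grading S) (Y : choiceType).

Section OneStep.
Variables (r : nat) (deg : 'I_r -> nat).
Local Notation C := (malg (Y * 'I_r)%type S).

Definition crow (c : C) (y : Y) : 'rV[S]_r := \row_j mcoeff (y, j) c.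

Definition of_rows (s : seq Y) (z : Y -> 'rV[S]_r) : C :=
  \sum_(y <- undup s) \sum_j mkmalgU (y, j) (z y 0 j).

Lemma crow_of_rows s z y : crow (of_rows s z) y = if y \in s then z y else 0.
Proof.
apply/rowP => j; rewrite !mxE raddf_sum /= -mem_undup; case: ifP => ys.
  rewrite (bigD1_seq y) ?undup_uniq //= raddf_sum (bigD1 j) //= mcoeffU eqxx mulr1n.
  rewrite big1 => [|l lj].
    rewrite addr0 big1 ?addr0 // => y' y'y; rewrite raddf_sum big1 // => l _.
    by rewrite /= mcoeffU xpair_eqE (negbTE y'y).
  by rewrite mcoeffU xpair_eqE eqxx (negbTE lj).
rewrite mxE big1_seq // => y' /andP[_ y's]; rewrite raddf_sum big1 // => l _.
rewrite /= mcoeffU xpair_eqE; case: eqP => [y'y|//].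
by rewrite -y'y y's in ys.
Qed.

Lemma crow_ext (c d : C) : (forall y, crow c y = crow d y) -> c = d.
Proof.
move=> h; apply/malgP => -[y j]; have /rowP/(_ j) := h y.
by rewrite !mxE.
Qed.

(* The elements of filtration degree < p, the generator (y, j) being placed in
   degree deg j. *)
Definition filt (p : nat) (c : C) : Prop :=
  forall y j d, (p <= d + deg j)%N -> gcomp g d (mcoeff (y, j) c) = 0.

(** The leading form in filtration degree p. The test [deg j <= p] excludes the values of the
    truncated subtraction. *)
Definition symb (p : nat) (c : C) (y : Y) : 'rV[S]_r :=
  \row_j (if (deg j <= p)%N then gcomp g (p - deg j) (mcoeff (y, j) c) else 0).

Definition hrow (p : nat) (z : 'rV[S]_r) : Prop :=
  forall j, if (deg j <= p)%N then homog g (p - deg j) (z 0 j) else z 0 j = 0.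

Lemma filt0 c : filt 0 c -> c = 0.
Proof.
move=> hc; apply/malgP => -[y j]; rewrite mcoeff0.
by apply: (gcomp_ext0 (n := g)) => d; exact: hc.
Qed.

Lemma filtB p c d : filt p c -> filt p d -> filt p (c - d).
Proof. by move=> hc hd y j e he; rewrite mcoeffB raddfB /= hc // hd // subr0. Qed.

Lemma filt_exists c : exists p, filt p c.
Proof.
have /choice[N hN] : forall k : Y * 'I_r, exists N, forall d, (N <= d)%N ->
    gcomp g d (mcoeff k c) = 0 by move=> k; exact: gcomp_bound.
exists (\max_(k <- enum_fset (msupp c)) (N k + deg k.2))%N => y j d hd.
have [jc|jc] := boolP ((y, j) \in msupp c); last by rewrite (mcoeff_outdom jc) raddf0.
apply: hN; rewrite -(leq_add2r (deg j)); apply: leq_trans hd.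
by rewrite (big_fsetD1 (y, j)) //= leq_maxl.
Qed.

Lemma filtS p c : filt p.+1 c -> (forall y, symb p c y = 0) -> filt p c.
Proof.
move=> hc h y j d; rewrite leq_eqVlt => /orP[/eqP pd|]; last exact: hc.
have /rowP/(_ j) := h y; rewrite !mxE pd leq_addl addnK.
by [].
Qed.

Lemma symb_hrow p c y : hrow p (symb p c y).
Proof. by move=> j; rewrite mxE; case: ifP => /= h; rewrite h //; exact: homog_gcomp.
Qed.

Lemma symb0 p y : symb p 0 y = 0.
Proof. by apply/rowP => j; rewrite !mxE mcoeff0 raddf0 if_same. Qed.

Lemma symbB p c d y : symb p (c - d) y = symb p c y - symb p d y.
Proof.
apply/rowP => j; rewrite !mxE mcoeffB raddfB /=.
by case: ifP => // _; rewrite subr0.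
Qed.

Lemma hrow_filt p c : (forall y, hrow p (crow c y)) -> filt p.+1 c.
Proof.
move=> hc y j d hd; have := hc y j; rewrite mxE; case: leqP => dp; last first.
  by move=> ->; exact: raddf0.
move=> /gcomp_homog ->; case: eqP => // dE.
by move: hd; rewrite dE subnK // ltnn.
Qed.

Lemma hrow_symb p c y : hrow p (crow c y) -> symb p c y = crow c y.
Proof.
by move=> hc; apply/rowP => j; have := hc j; rewrite !mxE; case: ifP.
Qed.

Lemma hrow0 p : hrow p 0.
Proof. by move=> j; rewrite mxE; case: ifP => // _; exact: homog0. Qed.

End OneStep.

(* Z is the condition of being a cycle of the associated graded map: cycles lift
   to the kernel modulo lower filtration (filt_lift), and leading parts of kernel
   elements are cycles (filt_symb). *)
Definition filt_lift r (deg : 'I_r -> nat) (N : lmodType S)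
    (delta : {linear malg (Y * 'I_r)%type S -> N}) (Z : 'rV[S]_r -> Prop) : Prop :=
  forall p t, (forall y, hrow deg p (crow t y) /\ Z (crow t y)) ->
    exists2 t', filt deg p t' & delta t = delta t'.

Definition filt_symb r (deg : 'I_r -> nat) (N : lmodType S)
    (delta : {linear malg (Y * 'I_r)%type S -> N}) (Z : 'rV[S]_r -> Prop) : Prop :=
  forall p u, filt deg p.+1 u -> delta u = 0 -> forall y, Z (symb deg p u y).

Section Step.
Variables (r r' : nat) (deg : 'I_r -> nat) (deg' : 'I_r' -> nat).
Variables (X : 'M[S]_(r', r)) (Z : 'rV[S]_r -> Prop).
Variables (N : lmodType S) (delta : {linear malg (Y * 'I_r)%type S -> N}).
Hypothesis X_hrow : forall l, hrow deg (deg' l) (row l X).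
Hypothesis Z0 : Z 0.
Hypothesis X_Z : forall l, Z (row l X).
Hypothesis Z_exact : forall z, Z z -> exists v, z = v *m X.
Hypothesis delta_lift : filt_lift deg delta Z.
Hypothesis delta_symb : filt_symb deg delta Z.
Local Notation C := (malg (Y * 'I_r)%type S).
Local Notation C' := (malg (Y * 'I_r')%type S).

Lemma Z_exact_homog p z : hrow deg p z -> Z z -> exists2 v, hrow deg' p v & z = v *m X.
Proof.
move=> hz /Z_exact[v zE].
exists (\row_l if (deg' l <= p)%N then gcomp g (p - deg' l) (v 0 l) else 0).
  by move=> l; rewrite mxE; case: ifP => /= h; rewrite h //; exact: homog_gcomp.
apply/rowP => j; rewrite [RHS]mxE; have := hz j; have := X_hrow.
rewrite zE mxE; case: ifP => jp hX.
  rewrite /homog => <-; rewrite raddf_sum; apply: eq_bigr => l _ /=.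
  have := hX l j; rewrite !mxE; case: ifP => jl.
    move=> hXlj; rewrite (gcompMr _ _ hXlj) leq_sub2rE //.
    by case: ifP => // _; [rewrite subnBA // addnC subnKC // | rewrite mul0r]. 
  by move=> ->; rewrite !mulr0 raddf0.
move=> ->; rewrite big1 // => l _; rewrite mxE.
have := hX l j; rewrite mxE; case: ifP => jl; last by move=> ->; rewrite mulr0.
case: ifP => lp; last by rewrite mul0r.
by rewrite (leq_trans jl lp) in jp.
Qed.

Let gen (k : Y * 'I_r') : C := of_rows [:: k.1] (fun=> row k.2 X).

Lemma gen_crow k y : crow (gen k) y = if y == k.1 then row k.2 X else 0.
Proof. by rewrite crow_of_rows mem_seq1. Qed.

(** The rows of [X] generate the cycles of the associated graded map. Each row, placed at a basis
    element, becomes an element of ker delta after subtracting a term of lower filtration, and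
    [delta'] sends the new generators to these elements. It thus acts on leading forms as [X], and
    this gives exactness compatible with the filtrations, from which both conditions for the next
    step follow. *)
Lemma filtered_step : exists delta' : {linear C' -> C},
  [/\ forall u, delta u = 0 <-> exists v, delta' v = u,
      filt_lift deg' delta' (fun z => z *m X = 0)
    & filt_symb deg' delta' (fun z => z *m X = 0)].
Proof.
have /choice[s hs] : forall k, exists t', filt deg (deg' k.2) t' /\ delta (gen k) = delta t'.
  move=> k; have [|t' h1 h2] := @delta_lift (deg' k.2) (gen k); last by exists t'.
  move=> y; rewrite gen_crow; case: eqP => _; split=> //.
  by move=> j; rewrite mxE; case: ifP => // _; exact: homog0.
pose w k := gen k - s k.
pose delta' : {linear C' -> C} := malg_ev w.
have dd v : delta (delta' v) = 0.
  rewrite /delta' /= /malg_ev linear_sum big1 // => k _.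
  by rewrite linearZ /= linearB /= (hs k).2 subrr scaler0.
have coefE v y j : mcoeff (y, j) (delta' v) =
    \sum_(k <- msupp v) mcoeff k v * mcoeff (y, j) (w k).
  by rewrite /delta' /= /malg_ev raddf_sum; apply: eq_bigr => k _; rewrite /= mcoeffZ.
have wE k y j : mcoeff (y, j) (w k) =
    (if y == k.1 then X k.2 j else 0) - mcoeff (y, j) (s k).
  rewrite mcoeffB; congr (_ - _).
  by have /rowP/(_ j) := gen_crow k y; rewrite mxE => ->; case: ifP; rewrite mxE.
have w1 k y j b : (deg' k.2 < b + deg j)%N -> gcomp g b (mcoeff (y, j) (w k)) = 0.
  move=> hb; rewrite wE raddfB /= (hs k).1 ?(ltnW hb) // subr0.
  case: ifP => _; last exact: raddf0.
  have := X_hrow k.2 j; rewrite mxE; case: ifP => jk; last by move=> ->; exact: raddf0.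
  move/gcomp_homog => ->; case: eqP => // bE.
  by move: hb; rewrite bE subnK // ltnn.
have w2 k y j b : (b + deg j)%N = deg' k.2 ->
    gcomp g b (mcoeff (y, j) (w k)) = if y == k.1 then X k.2 j else 0.
  move=> hb; rewrite wE raddfB /= (hs k).1 ?hb // subr0.
  case: ifP => _; last exact: raddf0.
  have := X_hrow k.2 j; rewrite mxE -hb leq_addl addnK.
  by move/gcomp_homog => ->; rewrite eqxx.
have S1 p v : filt deg' p.+1 v -> filt deg p.+1 (delta' v).
  move=> hv y j d hd; rewrite coefE raddf_sum big1 // => -[y' l] _ /=.
  rewrite gcompM big1 // => i _; have [pi|ip] := leqP p.+1 (i + deg' l).
    by rewrite hv // mul0r.
  rewrite w1 ?mulr0 //=; have id : (i <= d)%N by rewrite -ltnS.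
  rewrite -(ltn_add2l i) addnA subnKC //; exact: leq_trans ip hd.
have S2k p v k y j : filt deg' p.+1 v -> (deg j <= p)%N ->
    gcomp g (p - deg j) (mcoeff k v * mcoeff (y, j) (w k)) =
    if y == k.1 then symb deg' p v k.1 0 k.2 * X k.2 j else 0.
  case: k => y' l hv jp; rewrite gcompM mxE /=.
  have [lp|pl] := leqP (deg' l) p; last first.
    rewrite mul0r if_same big1 // => i _; rewrite hv ?mul0r //.
    by apply: leq_trans pl _; exact: leq_addl.
  have [jl|lj] := leqP (deg j) (deg' l); last first.
    have -> : X l j = 0 by have := X_hrow l j; rewrite mxE leqNgt lj.
    rewrite mulr0 if_same big1 // => i _; have [pi|ip] := leqP p.+1 (i + deg' l).
      by rewrite hv // mul0r.
    by rewrite w1 ?mulr0 //=; apply: leq_trans lj _; exact: leq_addl.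
  have hi : (p - deg' l < (p - deg j).+1)%N by rewrite ltnS leq_sub2l.
  rewrite (bigD1 (Ordinal hi)) //= w2 /=; last first.
    by lia.
  rewrite big1 ?addr0 => [|i /negP ne].
    by case: eqP => _; rewrite ?mulr0.
  have [pi|ip] := leqP p.+1 (i + deg' l); first by rewrite hv // mul0r.
  rewrite w1 ?mulr0 //=; have id : (i <= p - deg j)%N by rewrite -ltnS.
  have ilt : nat_of_ord i <> (p - deg' l)%N by move=> h; apply: ne; apply/eqP/val_inj.
  lia.
(* The corrections [s k] have lower filtration and do not reach the leading form. *)
have S2 p v y : filt deg' p.+1 v -> symb deg p (delta' v) y = symb deg' p v y *m X.
  move=> hv; apply/rowP => j; rewrite mxE [RHS]mxE; case: ifP => jp; last first.
    rewrite big1 // => l _; rewrite mxE; have := X_hrow l j; rewrite mxE.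
    case: ifP => jl; last by move=> ->; rewrite mulr0.
    case: ifP => lp; last by rewrite mul0r.
    by rewrite (leq_trans jl lp) in jp.
  rewrite coefE raddf_sum /=; under eq_bigr => k _ do rewrite (S2k _ _ _ _ _ hv jp).
  have hz k : k \notin msupp v -> symb deg' p v k.1 0 k.2 = 0.
    case: k => y' l h; rewrite mxE /= (mcoeff_outdom h) raddf0.
    by case: ifP.
  rewrite -big_mkcond /=.
  transitivity (\sum_l \sum_(k <- msupp v | k == (y, l)) symb deg' p v k.1 0 k.2 * X k.2 j).
    rewrite (exchange_big_dep xpredT) //= [in LHS]big_mkcond /=.
    apply: eq_bigr => -[y' l] _ /=; case: eqP => [->|yy].
      rewrite (big_pred1 l) // => l'; rewrite xpair_eqE eqxx /= eq_sym.
      by [].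
    by rewrite big_pred0 // => l'; rewrite xpair_eqE eq_sym; case: eqP yy.
  apply: eq_bigr => l _; have [h|h] := boolP ((y, l) \in msupp v).
    by rewrite -big_filter filter_pred1_uniq ?fset_uniq // big_seq1.
  rewrite (hz (y, l) h) mul0r big1_seq // => k /andP[/eqP -> kh].
  by rewrite kh in h.
(* The leading form of u is a cycle, hence comes from a homogeneous [c]; subtracting delta'(c)
   leaves a kernel element of lower filtration. *)
have strict p u : filt deg p u -> delta u = 0 ->
    exists2 v, filt deg' p v & delta' v = u.
  elim: p u => [|p ih] u hu du.
    exists 0; first by move=> y j d _; rewrite mcoeff0 raddf0.
    by rewrite linear0 (filt0 hu).
  have /choice[v hv] : forall y, exists v, hrow deg' p v /\ symb deg p u y = v *m X.
    move=> y; have [v h1 h2] := Z_exact_homog (symb_hrow deg p u y) (delta_symb hu du y).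
    by exists v.
  pose sy := [seq k.1 | k <- enum_fset (msupp u)].
  pose c := of_rows sy v.
  have crow_c y : crow c y = if y \in sy then v y else 0 by exact: crow_of_rows.
  have c_hrow y : hrow deg' p (crow c y).
    by rewrite crow_c; case: ifP => _; [exact: (hv y).1|exact: hrow0].
  have c_filt := hrow_filt c_hrow.
  have su y : symb deg p u y = crow c y *m X.
    rewrite crow_c; case: ifP => ys; first exact: (hv y).2.
    rewrite mul0mx; apply/rowP => j; rewrite !mxE mcoeff_outdom ?raddf0 ?if_same //.
    by apply/negP => h; move/negP: ys; apply; apply/mapP; exists (y, j).
  have [||c' hc' dc'] := ih (u - delta' c).
  - apply: filtS; first by apply: filtB => //; exact: S1.
    by move=> y; rewrite symbB su S2 // hrow_symb // subrr.
  - by rewrite linearB /= du dd subrr.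
  exists (c' + c); last by rewrite linearD /= dc' subrK.
  move=> y j d hd; rewrite mcoeffD raddfD /= c_filt // hc' ?addr0 //.
  exact: ltnW.
exists delta'; split.
- move=> u; split=> [du|[v <-]]; last exact: dd.
  by have [p hp] := filt_exists deg u; have [v _ hv] := strict p u hp du; exists v.
- move=> p t ht; have tf : filt deg' p.+1 t by apply: hrow_filt => y; exact: (ht y).1.
  have [||v hv <-] := strict p (delta' t); last by exists v.
  + apply: filtS; first exact: S1.
    by move=> y; rewrite S2 // hrow_symb ?(ht y).2 //; exact: (ht y).1.
  + exact: dd.
- by move=> p u hu du y; rewrite -S2 // du symb0.
Qed.

End Step.
End FilteredResolution.

(** * Resolving arbitrary modules by filtered lifting *)

Section GradedResolution.
Variables (K : fieldType) (S : algType K) (g : nat_grading S).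
Variables (rk : nat -> nat) (deg : forall i, 'I_(rk i) -> nat).
Variable X : forall i, 'M[S]_(rk i.+1, rk i).
Hypothesis g_connected : forall a, exists c : K, gcomp g 0 a = c%:A.
Hypothesis g_scalar : forall c : K, homog g 0 c%:A.
Variable j0 : 'I_(rk 0).
Hypothesis rk0 : forall j, j = j0.
Hypothesis deg0 : forall j : 'I_(rk 0), deg j = 0%N.
Hypothesis X_hrow : forall i l, hrow g (@deg i) (deg l) (row l (X i)).
Hypothesis X_complex : forall i, X i.+1 *m X i = 0.
Hypothesis X_exact : forall i (z : 'rV[S]_(rk i.+1)), z *m X i = 0 ->
  exists v, z = v *m X i.+1.
Hypothesis X_pos : forall l j, gcomp g 0 (X 0 l j) = 0.
Hypothesis X_aug : forall z : 'rV[S]_(rk 0), (forall j, gcomp g 0 (z 0 j) = 0) ->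
  exists v, z = v *m X 0.

Variable M : lmodType S.
Variables (Y : choiceType) (b : Y -> restrict_scalars M).
Hypothesis b_free : forall h : malg Y K, malg_ev b h = 0 -> h = 0.
Hypothesis b_span : forall u : restrict_scalars M, exists h : malg Y K, u = malg_ev b h.

Definition res_mod (i : nat) : lmodType S := malg (Y * 'I_(rk i))%type S.

(** The generators go to a K-basis of M and lie in filtration degree 0; this is the filtration with
    F_0 = M, whose associated graded module has trivial action of positive degrees. *)
Definition res_aug : {linear res_mod 0 -> M} := malg_ev (fun k => b k.1 : M).

Lemma res_aug_scalars (h : malg Y K) :
  exists2 t : res_mod 0, filt g (@deg 0) 1 t & res_aug t = malg_ev b h.
Proof.
exists (\sum_(y <- msupp h) mkmalgU (y, j0) (mcoeff y h)%:A).
  move=> y j d; rewrite deg0 addn0 => d0; rewrite raddf_sum raddf_sum big1 // => y' _ /=.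
  rewrite mcoeffU; case: eqP => _; last exact: raddf0.
  by rewrite mulr1n (gcomp_homog _ (g_scalar _)) gtn_eqF.
by rewrite linear_sum; apply: eq_bigr => y _; rewrite [LHS]malg_evU.
Qed.

Definition aug_cycle (z : 'rV[S]_(rk 0)) : Prop := forall j, gcomp g 0 (z 0 j) = 0.

(** Every element of M is the image of constant coefficients, which have filtration degree below 1.
    For p = 0 a homogeneous cycle is itself zero. *)
Lemma res_aug_lift : filt_lift g (@deg 0) res_aug aug_cycle.
Proof.
move=> p t ht; have [h hh] := b_span (res_aug t).
have [t' h1 h2] := res_aug_scalars h.
case: p ht => [|p] ht.
  suff -> : t = 0 by exists 0; [move=> y j d _; rewrite mcoeff0 raddf0|].
  apply: crow_ext => y; apply/rowP => j; rewrite [RHS]mxE mcoeff0.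
  have [h3 h4] := ht y; have := h3 j; rewrite deg0 leq0n subn0 => <-.
  exact: h4.
exists t'; last by rewrite h2 -hh.
move=> y j d hd; apply: h1; exact: leq_trans hd.
Qed.

Lemma res_aug_symb : filt_symb g (@deg 0) res_aug aug_cycle.
Proof.
move=> p u hu du y j; rewrite mxE deg0 leq0n subn0 gcomp_gcomp.
(* Only p = 0 is at stake. Then the coefficients of u are constants, and the independence of the
   basis makes them vanish. *)
case: eqP => // p0; rewrite -p0 in hu *.
have /choice[c hc] : forall k : Y * 'I_(rk 0), exists c : K, mcoeff k u = c%:A.
  move=> -[y' j']; have [c hc] := g_connected (mcoeff (y', j') u); exists c.
  rewrite -hc; apply: (gcomp_ext (g := g)) => d; rewrite gcomp_gcomp.
  case: eqP => [->//|/eqP d0]; rewrite hu // deg0 addn0 lt0n.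
  by [].
pose h : malg Y K := \sum_(k <- msupp u) mkmalgU k.1 (c k).
have h0 : h = 0.
  apply: b_free; rewrite linear_sum -[RHS]du; apply: eq_bigr => k _.
  by rewrite [LHS]malg_evU hc.
have : mcoeff y h = c (y, j).
  rewrite raddf_sum /=; have [yu|yu] := boolP ((y, j) \in msupp u).
    rewrite (big_fsetD1 (y, j)) //= mcoeffU eqxx mulr1n big1_seq ?addr0 // => -[y' j'].
    move=> /andP[_]; rewrite in_fsetD1 (rk0 j') -(rk0 j) xpair_eqE eqxx andbT.
    by move=> /andP[/negbTE yy' _]; rewrite mcoeffU yy'.
  rewrite big1_seq => [|[y' j'] /andP[_ yu']].
    have := mcoeff_outdom yu; rewrite hc => /eqP.
    by rewrite scaler_eq0 oner_eq0 orbF => /eqP ->.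
  rewrite mcoeffU /=; case: eqP => // yy; case/negP: yu.
  by rewrite -yy (rk0 j) -(rk0 j').
by rewrite h0 mcoeff0 hc => <-; rewrite scale0r raddf0.
Qed.

Definition res_stage (i : nat) : Type := {d : {linear res_mod i.+1 -> res_mod i} |
  filt_lift g (@deg i.+1) d (fun z => z *m X i = 0) /\
  filt_symb g (@deg i.+1) d (fun z => z *m X i = 0)}.

Lemma res_first : exists d : {linear res_mod 1 -> res_mod 0},
  [/\ forall u, res_aug u = 0 <-> exists v, d v = u,
      filt_lift g (@deg 1) d (fun z => z *m X 0 = 0)
    & filt_symb g (@deg 1) d (fun z => z *m X 0 = 0)].
Proof.
apply: (filtered_step (X_hrow (i := 0)) _ _ X_aug res_aug_lift res_aug_symb).
  by move=> j; rewrite mxE raddf0.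
by move=> l j; rewrite mxE.
Qed.

Lemma res_next i (s : res_stage i) : exists d : {linear res_mod i.+2 -> res_mod i.+1},
  [/\ forall u, sval s u = 0 <-> exists v, d v = u,
      filt_lift g (@deg i.+2) d (fun z => z *m X i.+1 = 0)
    & filt_symb g (@deg i.+2) d (fun z => z *m X i.+1 = 0)].
Proof.
case: s => d [h1 h2].
apply: (filtered_step (X_hrow (i := i.+1)) _ _ (X_exact (i := i)) h1 h2).
  exact: mul0mx.
by move=> l; rewrite -row_mul X_complex row0.
Qed.

Fixpoint res_stages (i : nat) : res_stage i :=
  match i with
  | 0 => let e := cid res_first in
         let: And3 _ h1 h2 := svalP e in exist _ (sval e) (conj h1 h2)
  | i'.+1 => let e := cid (res_next (res_stages i')) in
             let: And3 _ h1 h2 := svalP e in exist _ (sval e) (conj h1 h2)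
  end.

Definition res_d (i : nat) : {linear res_mod i.+1 -> res_mod i} :=
  sval (res_stages i).

Lemma res_exact0 u : res_aug u = 0 <-> exists v, res_d 0 v = u.
Proof.
rewrite /res_d /=; case: (svalP (cid res_first)) => h h1 h2.
by rewrite h.
Qed.

Lemma res_exact i u : res_d i u = 0 <-> exists v, res_d i.+1 v = u.
Proof.
rewrite {2}/res_d /=; case: (svalP (cid (res_next (res_stages i)))) => h h1 h2.
by rewrite -h.
Qed.

Lemma res_surj m : exists u, res_aug u = m.
Proof.
have [h ->] := b_span m; have [t _ ht] := res_aug_scalars h.
by exists t.
Qed.

Lemma res_projective i : projective (res_mod i).
Proof. exact: malg_projective. Qed.

Definition graded_res : proj_resolution M :=
  ProjResolution res_projective res_surj res_exact0 res_exact.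

End GradedResolution.

Lemma graded_projdim_le (K : fieldType) (S : algType K) (g : nat_grading S)
    (rk : nat -> nat) (deg : forall i, 'I_(rk i) -> nat)
    (X : forall i, 'M[S]_(rk i.+1, rk i)) (e : nat) (j0 : 'I_(rk 0)) :
  (forall a, exists c : K, gcomp g 0 a = c%:A) ->
  (forall c : K, homog g 0 c%:A) ->
  (forall j, j = j0) -> (forall j : 'I_(rk 0), deg 0%N j = 0%N) ->
  (forall i l, hrow g (@deg i) (deg i.+1 l) (row l (X i))) ->
  (forall i, X i.+1 *m X i = 0) ->
  (forall i (z : 'rV[S]_(rk i.+1)), z *m X i = 0 -> exists v, z = v *m X i.+1) ->
  (forall l j, gcomp g 0 (X 0%N l j) = 0) ->
  (forall z : 'rV[S]_(rk 0), (forall j, gcomp g 0 (z 0 j) = 0) ->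
    exists v, z = v *m X 0%N) ->
  (forall i, (e < i)%N -> rk i = 0%N) ->
  forall M : lmodType S, projdim_le M e.
Proof.
move=> h1 h2 h3 h4 h5 h6 h7 h8 h9 hrk M.
have [Y [b [bf bs]]] := exists_basis (restrict_scalars M).
exists (graded_res h1 h2 h3 h4 h5 h6 h7 h8 h9 bf bs) => i ei x.
apply/malgP => -[y j]; exfalso.
by move: j; rewrite hrk // => -[].
Qed.

Lemma injdim_leW (S : pzRingType) (M : lmodType S) d e :
  (d <= e)%N -> injdim_le M d -> injdim_le M e.
Proof.
move=> de [C hC]; exists C => i ei; apply: hC; exact: leq_ltn_trans ei.
Qed.

Section MinimalResolution.
Variables (K : fieldType) (S : algType K) (g : nat_grading S).
Variables (rk : nat -> nat) (X : forall i, 'M[S]_(rk i.+1, rk i)) (e : nat).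
Hypothesis g_scalar : forall c : K, homog g 0 c%:A.
Hypothesis X_complex : forall i, X i.+1 *m X i = 0.
Hypothesis X_exact : forall i (z : 'rV[S]_(rk i.+1)), z *m X i = 0 ->
  exists v, z = v *m X i.+1.
Variable l0 : 'I_(rk e.+1).
Hypothesis rk_top : rk e.+2 = 0%N.
Hypothesis X_top : forall j, gcomp g 0 (X e l0 j) = 0.

(** Otherwise the coordinate [l0] would extend along [X e], and 1 would be a combination of the
    entries of row [l0], none of which has a part of degree 0. *)
Lemma minimal_injdim_ge d : injdim_le (S^o : lmodType S) d -> (e < d)%N.
Proof.
move=> hd; rewrite ltnNge; apply/negP => de.
have hf : linear (fun u : 'rV[S]_(rk e.+1) => u 0 l0 : S^o).
  by move=> a u v; rewrite !mxE.
have [|||h hh] := @injdim_le_extend S (S^o) (fun i => 'rV[S]_(rk i)) (fun i => rowmul (X i))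
  e _ _ (to_linear hf) (injdim_leW de hd).
- by move=> i _; exact: row_projective.
- move=> i x _; split=> [/X_exact[v ->]|[y <-]]; first by exists v.
  by rewrite !rowmulE -mulmxA X_complex mulmx0.
- move=> x /X_exact[v ->] /=; rewrite mxE big1 // => j _.
  by exfalso; move: j; rewrite rk_top => -[].
have := hh (delta_mx 0 l0); rewrite /= mxE !eqxx -rowE mulr1n.
rewrite [X in h X]row_sum_delta linear_sum => /(congr1 (gcomp g 0)).
have h1 : homog g 0 (1 : S) by rewrite -(scale1r (1 : S)).
rewrite h1 raddf_sum /= big1 => [/eqP|j _]; first by rewrite oner_eq0.
rewrite (linearZ_LR h) /= [X in gcomp g 0 X](_ : _ = row l0 (X e) 0 j * h (delta_mx 0 j)) //.
rewrite gcompM big_ord1 mxE X_top.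
by rewrite mul0r.
Qed.

End MinimalResolution.

(** * Graded Ext over a presented algebra *)

Section IntegerGrading.
Variables (S : pzRingType) (g : nat_grading S).

Definition icomp (t : int) (a : S) : S := if t is Posz d then gcomp g d a else 0.

Lemma icomp_is_additive t : {morph icomp t : a b / a - b}.
Proof. by move=> a b; case: t => d /=; rewrite ?raddfB // subr0. Qed.

HB.instance Definition _ t :=
  GRing.isZmodMorphism.Build S S (icomp t) (icomp_is_additive t).

Definition ihomog (t : int) (a : S) : Prop := icomp t a = a.

Lemma icomp_icomp t s a : icomp t (icomp s a) = if t == s then icomp s a else 0.
Proof.
case: s => s /=; last by rewrite raddf0 if_same.
case: t => t /=; first by rewrite gcomp_gcomp.
by [].
Qed.

Lemma ihomog_icomp t a : ihomog t (icomp t a).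
Proof. by rewrite /ihomog icomp_icomp eqxx. Qed.

Lemma icomp_ihomog t s a : ihomog s a -> icomp t a = if t == s then a else 0.
Proof. by move=> ha; rewrite -ha icomp_icomp. Qed.

Lemma ihomogB t a b : ihomog t a -> ihomog t b -> ihomog t (a - b).
Proof. by rewrite /ihomog raddfB /= => -> ->. Qed.

Lemma ihomog0 t : ihomog t 0.
Proof. exact: raddf0. Qed.

Lemma ihomog_sum t (I : Type) (r : seq I) (F : I -> S) :
  (forall i, ihomog t (F i)) -> ihomog t (\sum_(i <- r) F i).
Proof.
move=> h; apply: (big_ind (ihomog t)) => [|a b ha hb|i _]; [exact: ihomog0| |exact: h].
by rewrite -[b]opprK; apply: ihomogB => //; rewrite -sub0r; exact: ihomogB (ihomog0 _) hb.
Qed.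

Lemma icompMl d t a b : homog g d a -> icomp (d%:Z + t) (a * b) = a * icomp t b.
Proof.
move=> ha; case: t => t; first by rewrite /= (gcompMl _ _ ha) leq_addr addKn.
rewrite [in RHS]/= mulr0; case E: (_ + _) => [s|//] /=.
rewrite (gcompMl _ _ ha) ifN // -ltnNge.
by move: E; rewrite NegzE; case: s => [|s]; lia.
Qed.

Lemma icompMr d t a b : homog g d b -> icomp (t + d%:Z) (a * b) = icomp t a * b.
Proof.
move=> hb; case: t => t; first by rewrite /= (gcompMr _ _ hb) leq_addl addnK.
rewrite [in RHS]/= mul0r; case E: (_ + _) => [s|//] /=.
rewrite (gcompMr _ _ hb) ifN // -ltnNge.
by move: E; rewrite NegzE; case: s => [|s]; lia.
Qed.

Lemma ihomogM t s a b : ihomog t a -> ihomog s b -> ihomog (t + s) (a * b).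
Proof.
case: t => t ha; last first.
  by have -> : a = 0 by [rewrite -ha]; rewrite mul0r => _; exact: ihomog0.
by move=> hb; rewrite /ihomog icompMl // hb.
Qed.

End IntegerGrading.

Lemma paugZ (K : fieldType) (n : nat) (P : presentation K n) c (a : palg P) :
  paug (c *: a) = c * paug a.
Proof.
rewrite -(proj_repr a) -linearZ !paug_proj; exact: TV_mcoeffZ.
Qed.

Section ShiftedFree.
Variables (K : fieldType) (n : nat) (P : presentation K n).
Local Notation S := (palg P).
Variable g : nat_grading S.
Hypothesis pdegP : forall d a, pdeg d a <-> homog g d a.

Lemma rdegP t (a : S) : rdeg t a <-> ihomog g t a.
Proof.
case: t => d; first exact: pdegP.
by split=> [->//|<-].
Qed.

Lemma gcomp0_paug (a : S) : gcomp g 0 a = (paug a)%:A.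
Proof.
have [N hN] := gcomp_bound g a.
have hd d (b : S) : (0 < d)%N -> paug (gcomp g d b) = 0.
  by move=> d0; apply: (paug_pdeg d0); apply/pdegP; exact: homog_gcomp.
have -> : paug a = paug (gcomp g 0 a).
  rewrite [in LHS](gcomp_sum (N := N.+1) (g := g) (x := a)); last first.
    by move=> d /ltnW; exact: hN.
  rewrite raddf_sum big_ord_recl /= big1 ?addr0 // => i _; exact: hd.
have /pdegP[u /tpowP hu <-] := homog_gcomp g 0 a.
have uE : u = (mcoeff one u)%:A by rewrite -{1}hu; exact: TV_gr0.
by rewrite paug_proj {1}uE linearZ /= rmorph1.
Qed.

Lemma paug0P (a : S) : paug a = 0 <-> gcomp g 0 a = 0.
Proof.
rewrite gcomp0_paug; split=> [->|/eqP]; first exact: scale0r.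
by rewrite scaler_eq0 oner_eq0 orbF => /eqP.
Qed.

Lemma homog_palg_scalar (c : K) : homog g 0 (c%:A : S).
Proof.
by rewrite /homog gcomp0_paug paugZ rmorph1 mulr1.
Qed.

Variables (r : nat) (deg : 'I_r -> nat).
Local Notation M := ('rV[S]_r).

Definition row_deg (t : int) : set M :=
  [set u | forall j, ihomog g (t - (deg j)%:Z) (u 0 j)].

Lemma row_deg0 t : row_deg t 0.
Proof. by move=> j; rewrite mxE; exact: ihomog0. Qed.

Lemma row_degB t u v : row_deg t u -> row_deg t v -> row_deg t (u - v).
Proof. by move=> hu hv j; rewrite !mxE; exact: ihomogB (hu j) (hv j). Qed.

Lemma row_deg_act d (a : S) t u : pdeg d a -> row_deg t u -> row_deg (d%:Z + t) (a *: u).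
Proof.
move=> /pdegP ha hu j; rewrite mxE -addrA.
exact: (ihomogM (t := d%:Z)) ha (hu j).
Qed.

Definition row_comp (t : int) (u : M) : M := \row_j icomp g (t - (deg j)%:Z) (u 0 j).

Lemma row_comp_deg t u : row_deg t (row_comp t u).
Proof. by move=> j; rewrite mxE; exact: ihomog_icomp. Qed.

Lemma row_comp_is_additive t : {morph row_comp t : a b / a - b}.
Proof. by move=> a b; apply/rowP => j; rewrite !mxE raddfB. Qed.

HB.instance Definition _ t :=
  GRing.isZmodMorphism.Build M M (row_comp t) (row_comp_is_additive t).

Lemma row_comp_of_deg t s u : row_deg s u -> row_comp t u = if t == s then u else 0.
Proof.
move=> hu; apply/rowP => j; rewrite !mxE (icomp_ihomog _ (hu j)).
by rewrite (inj_eq (addIr _)); case: eqP => _; rewrite ?mxE.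
Qed.

Lemma row_deg_span u : exists (s : seq int) (f : int -> M),
  (forall t, row_deg t (f t)) /\ u = \sum_(t <- s) f t.
Proof.
have [N hN] := gcomp_bound_fin g (fun j => u 0 j).
pose N' := (N + \max_j deg j)%N.
exists [seq Posz i | i <- iota 0 N'], (row_comp^~ u); split=> [t|].
  exact: row_comp_deg.
apply/rowP => j; rewrite big_map summxE; apply: (gcomp_ext (g := g)) => d.
rewrite raddf_sum /=; have dj : (deg j <= \max_j deg j)%N by exact: leq_bigmax.
have [dN|Nd] := ltnP d N; last first.
  rewrite hN // big1_seq // => i /andP[_]; rewrite mem_iota add0n => iN'.
  rewrite mxE; case E: (_ - _) => [s|] /=; last exact: raddf0.
  rewrite gcomp_gcomp; case: eqP => // ds; rewrite -ds hN //.
have dN' : (d + deg j)%N \in iota 0 N'.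
  by rewrite mem_iota add0n; apply: leq_ltn_trans (_ : (d + \max_j deg j < N')%N);
    rewrite ?leq_add2l // ltn_add2r.
rewrite (bigD1_seq _ dN' (iota_uniq _ _)) /=.
rewrite mxE PoszD addrK /= gcomp_gcomp eqxx big1 ?addr0 // => i id.
rewrite mxE; case E: (_ - _) => [s|] /=; last exact: raddf0.
rewrite gcomp_gcomp; case: eqP => // ds; case/eqP: id; apply/eqP.
by rewrite -eqz_nat PoszD ds -E subrK.
Qed.

Lemma row_deg_direct (s : seq int) (f : int -> M) : uniq s ->
  (forall t, row_deg t (f t)) -> \sum_(t <- s) f t = 0 ->
  forall t, t \in s -> f t = 0.
Proof.
move=> us hf h t ts; have := congr1 (row_comp t) h; rewrite raddf0 raddf_sum /=.
rewrite (bigD1_seq t) //= (row_comp_of_deg _ (hf t)) eqxx big1 ?addr0 // => i it.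
by rewrite (row_comp_of_deg _ (hf i)) eq_sym (negbTE it).
Qed.

Definition row_grading : grading (M : lmodType S) :=
  Grading row_deg0 row_degB row_deg_act row_deg_span row_deg_direct.

End ShiftedFree.

Section GradedGorenstein.
Variables (K : fieldType) (n : nat) (P : presentation K n).
Local Notation S := (palg P).
Variable g : nat_grading S.
Hypothesis pdegP : forall d a, pdeg d a <-> homog g d a.
Local Notation gcomp0 := (gcomp0_paug pdegP).
Variables (rk : nat -> nat) (deg : forall i, 'I_(rk i) -> nat).
Variable X : forall i, 'M[S]_(rk i.+1, rk i).
Variable e : nat.
Hypothesis X_homog : forall i a b, X i a b = 0 \/
  (deg b <= deg a)%N /\ homog g (deg a - deg b) (X i a b).
Variables (j0 : 'I_(rk 0)) (l0 : 'I_(rk e.+1)).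
Hypothesis rk0 : forall j, j = j0.
Hypothesis deg0 : deg j0 = 0%N.
Hypothesis rk_top : forall i, (e.+1 < i)%N -> rk i = 0%N.
Hypothesis rk_l0 : forall l, l = l0.
Hypothesis X_complex : forall i, X i.+1 *m X i = 0.
Hypothesis X_exact : forall i (z : 'rV[S]_(rk i.+1)), z *m X i = 0 ->
  exists v, z = v *m X i.+1.
Hypothesis X_pos : forall l j, gcomp g 0 (X 0 l j) = 0.
Hypothesis X_aug : forall z : 'rV[S]_(rk 0), (forall j, gcomp g 0 (z 0 j) = 0) ->
  exists v, z = v *m X 0.
Hypothesis X_inj : forall c : 'cV[S]_(rk 0), X 0 *m c = 0 -> c = 0.
Hypothesis X_right : forall i (c : 'cV[S]_(rk i.+1)), (i < e)%N ->
  X i.+1 *m c = 0 -> exists b, c = X i *m b.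
Hypothesis X_pos_top : forall j, gcomp g 0 (X e l0 j) = 0.
Hypothesis X_right_top : forall c : 'cV[S]_(rk e.+1), gcomp g 0 (c l0 0) = 0 ->
  exists b, c = X e *m b.

Lemma aug_row_subproof :
  linear (fun u : 'rV[S]_(rk 0) => paug (u 0 j0) : (triv K : lmodType S)).
Proof. by move=> a u v; rewrite !mxE rmorphD rmorphM. Qed.

Definition aug_row : {linear 'rV[S]_(rk 0) -> (triv K : lmodType S)} :=
  to_linear aug_row_subproof.

Lemma aug_row_surj y : exists u, aug_row u = y.
Proof.
exists (const_mx (y : K)%:A) => /=; rewrite mxE paugZ rmorph1.
exact: mulr1.
Qed.

Lemma aug_row_exact u : aug_row u = 0 <-> exists v, rowmul (X 0) v = u.
Proof.
split=> [/(paug0P pdegP) hu|[v <-]].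
  by have [|v ->] := X_aug (z := u); [move=> j; rewrite (rk0 j)|exists v].
apply/(paug0P pdegP); rewrite mxE raddf_sum big1 // => l _ /=.
by rewrite gcompM big_ord1 X_pos mulr0.
Qed.

Lemma row_exact i u : rowmul (X i) u = 0 <-> exists v, rowmul (X i.+1) v = u.
Proof.
split=> [/X_exact[v ->]|[y <-]]; first by exists v.
by rewrite !rowmulE -mulmxA X_complex mulmx0.
Qed.

Definition row_resolution : proj_resolution (triv K : lmodType S) :=
  ProjResolution (fun i => @row_projective S (rk i))
    aug_row_surj aug_row_exact row_exact.

Definition row_gradings (i : nat) : grading (row_resolution i) :=
  row_grading pdegP (@deg i).

Lemma icomp_X_row i t (u : 'rV[S]_(rk i.+1)) :
  row_deg g (@deg i.+1) t u -> row_deg g (@deg i) t (u *m X i).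
Proof.
move=> hu j; rewrite mxE; apply: ihomog_sum => l.
have [->|[dl hl]] := X_homog l j; first by rewrite mulr0; exact: ihomog0.
have -> : t - (deg j)%:Z = (t - (deg l)%:Z) + (deg l - deg j)%N%:Z.
  by rewrite -subzn // addrA subrK.
exact: (ihomogM (s := (deg l - deg j)%N%:Z)) (hu l) hl.
Qed.

Lemma row_resolution_graded : graded_resolution (triv_grading P) row_gradings.
Proof.
split=> [t u hu|i t u hu]; last exact: icomp_X_row.
have := hu j0; rewrite deg0 subr0; case: t hu => [[|t]|t] hu ht; first by left.
  by right; apply/(paug0P pdegP); rewrite -ht gcomp_gcomp.
by right; rewrite /= -ht; exact: rmorph0.
Qed.

(** Identifies Hom_S(S^r, S) with columns, so that Ext(K, S) is governed by the matrices acting on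
    columns. *)
Definition cocol i (f : 'rV[S]_(rk i) -> S) : 'cV[S]_(rk i) :=
  \col_l f (delta_mx 0 l).

Lemma cochainE i j f : cochain (C := row_resolution) row_gradings (i := i) j f ->
  forall u, f u = (u *m cocol f) 0 0.
Proof.
move=> [hf _] u; rewrite mxE; pose F := to_linear (hf : linear (f : _ -> S^o)).
rewrite -[LHS]/(F u) [in LHS](row_sum_delta u) linear_sum; apply: eq_bigr => l _.
rewrite linearZ mxE.
by [].
Qed.

Definition col_comp i (j : int) (c : 'cV[S]_(rk i)) : 'cV[S]_(rk i) :=
  \col_l icomp g ((deg l)%:Z + j) (c l 0).

Lemma mul_col_comp i j (b : 'cV[S]_(rk i)) :
  X i *m col_comp j b = col_comp j (X i *m b).
Proof.
apply/colP => l; rewrite !mxE raddf_sum; apply: eq_bigr => a _ /=; rewrite mxE.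
have [->|[da ha]] := X_homog l a; first by rewrite !mul0r raddf0.
rewrite -(icompMl _ _ ha); congr (icomp g _ _).
by rewrite addrA -subzn // subrK.
Qed.

Lemma cocol_deg i j f : cochain (C := row_resolution) row_gradings (i := i) j f ->
  col_comp j (cocol f) = cocol f.
Proof.
move=> [_ hf]; apply/colP => l; rewrite !mxE.
apply/(rdegP pdegP)/hf => a; rewrite mxE eqxx /=; case: eqP => [->|_].
  rewrite subrr; have := gcomp0 1; rewrite rmorph1 scale1r; exact.
exact: ihomog0.
Qed.

Lemma cochain_col i j (c : 'cV[S]_(rk i)) : col_comp j c = c ->
  cochain (C := row_resolution) row_gradings (i := i) j (fun u => (u *m c) 0 0).
Proof.
move=> hc; split=> [a u v|t u hu]; first by rewrite mulmxDl -scalemxAl [LHS]mxE [X in X +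
  _]mxE; exact: erefl.
apply/(rdegP pdegP); rewrite mxE; apply: ihomog_sum => l.
have -> : t + j = (t - (deg l)%:Z) + ((deg l)%:Z + j) by rewrite addrA subrK.
apply: ihomogM (hu l) _; rewrite -hc mxE; exact: ihomog_icomp.
Qed.

Lemma cocycle_col i j f : cocycle (C := row_resolution) row_gradings (i := i) j f ->
  X i *m cocol f = 0.
Proof.
move=> [hf h0]; apply/colP => l; rewrite [RHS]mxE.
apply: etrans (h0 (delta_mx 0 l)); rewrite (cochainE hf).
by rewrite /= -mulmxA -rowE [RHS]mxE.
Qed.

Lemma coboundary_col i j f b :
  cochain (C := row_resolution) row_gradings (i := i.+1) j f ->
  cocol f = X i *m b ->
  coboundary (C := row_resolution) row_gradings (i := i.+1) j f.
Proof.
move=> hf hb; exists (fun u => (u *m col_comp j b) 0 0); split.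
  by apply: cochain_col; apply/colP => l; rewrite !mxE icomp_icomp eqxx.
by move=> u; rewrite /= -mulmxA mul_col_comp -hb (cocol_deg hf) (cochainE hf).
Qed.

Lemma row_Ext_zero i : i != e.+1 -> Ext_zero row_gradings i.
Proof.
move=> ie j f hf; have [hf1 _] := hf; have hX := cocycle_col hf.
case: i ie f hf hf1 hX => [|i] ie f hf hf1 hX.
  by move=> u; rewrite (cochainE hf1) (X_inj hX) mulmx0 mxE.
have [ei|ei] := ltnP i e.
  by have [b hb] := X_right ei hX; exact: coboundary_col hb.
exists (fun=> 0); split.
  split=> [*|t u _]; first by rewrite mulr0 addr0.
  by apply/(rdegP pdegP); exact: ihomog0.
move=> u; rewrite (cochainE hf1) mxE big1 // => l _; exfalso.
move: l; rewrite rk_top ?ltnS; first by case.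
by rewrite ltn_neqAle ei eq_sym andbT -eqSS.
Qed.

(** The top cohomology is S modulo the right ideal of the entries of the last matrix, that is K, and
    [phi] is the augmentation of the value at [l0]. A cochain of degree j takes there a value of
    degree deg l0 + j, whence the shift. *)
Lemma row_Ext_shift : Ext_shift row_gradings e.+1 (deg l0)%:Z.
Proof.
exists (fun _ f => paug (f (delta_mx 0 l0))); split.
- by move=> j c f h _ _; rewrite rmorphD /= paugZ.
- by move=> j f d a _ _; rewrite rmorphM.
- move=> j f hf; have [hf1 _] := hf; split=> [/(paug0P pdegP) h|[h [hl hh]]].
    by have [|b hb] := X_right_top (c := cocol f); [rewrite mxE|exact: coboundary_col hb].
  rewrite hh (cochainE hl) /= -rowE mxE; apply/(paug0P pdegP).
  rewrite raddf_sum big1 // => l _; rewrite mxE /= gcompM big_ord1 X_pos_top.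
  exact: mul0r.
- move=> j; apply/seteqP; split=> [_ [f [hf _] <-]|y].
    have := congr1 (fun c : 'cV_(rk e.+1) => c l0 0) (cocol_deg hf); rewrite !mxE.
    case: (_ + _) => [[|d]|d]; first by left.
      by move=> <-; right; apply/(paug0P pdegP); rewrite gcomp_gcomp.
    by move=> <-; right; exact: rmorph0.
move=> hy; exists (fun u : 'rV[S]_(rk e.+1) => (u *m (const_mx (y : K)%:A : 'cV[S]_(rk e.+1)))
  0 0); last first.
  by rewrite -rowE !mxE paugZ rmorph1 mulr1.
split; last first.
  move=> u; suff -> : u = 0 by rewrite linear0 mul0mx mxE.
  by apply/rowP => l; exfalso; move: l; rewrite rk_top // => -[].
apply: cochain_col; apply/colP => l; rewrite !mxE (rk_l0 l).
case: hy => [->|->]; last by rewrite scale0r raddf0.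
by rewrite /= gcomp0 paugZ rmorph1 mulr1.
Qed.

Lemma row_gorenstein : (forall M : lmodType S, projdim_le M e.+1) ->
  AS_regular P e.+1.
Proof.
move=> pd; have g_scalar (c : K) : homog g 0 c%:A by rewrite /homog gcomp0 paugZ rmorph1 mulr1.
have ge d : injdim_le (S^o : lmodType S) d -> (e < d)%N.
  by apply: (minimal_injdim_ge g_scalar X_complex X_exact (l0 := l0)) => //; exact: rk_top.
have id d : (forall M : lmodType S, projdim_le M d) -> injdim_le (S^o : lmodType S) d.
  by move=> h; exact: projdim_injdim_le.
(* The lower bound on the global dimension passes through the injective dimension of S. *)
split; first by split=> // d /id /ge.
split; first by split=> [|d /ge //]; exact: id.
exists (deg l0)%:Z, row_resolution, row_gradings; split.
- exact: row_resolution_graded.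
- exact: row_Ext_zero.
- exact: row_Ext_shift.
Qed.

End GradedGorenstein.

(** * Homogeneous components in graded modules *)

Section GradingComponents.
Variables (K : fieldType) (n : nat) (P : presentation K n).
Local Notation S := (palg P).
Variables (M : lmodType S) (gM : grading M).

Definition decomposition (u : M) (f : int -> M) : Prop :=
  (forall t, gM t (f t)) /\ exists s : seq int,
    [/\ uniq s, forall t, t \notin s -> f t = 0 & u = \sum_(t <- s) f t].

Lemma gdegD t u v : gM t u -> gM t v -> gM t (u + v).
Proof.
move=> hu hv; rewrite -[v]opprK; apply: gdegB => //.
by rewrite -sub0r; apply: gdegB => //; exact: gdeg0.
Qed.

Lemma gdegMn t u k : gM t u -> gM t (u *+ k).
Proof.
move=> hu; elim: k => [|k ih]; first by rewrite mulr0n; exact: gdeg0.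
by rewrite mulrS; exact: gdegD.
Qed.

Lemma decomposition_exists u : exists f, decomposition u f.
Proof.
have [s [f [hf ->]]] := gdeg_span gM u; exists (fun t => f t *+ count_mem t s).
split=> [t|]; first exact: gdegMn.
exists (undup s); split; first exact: undup_uniq.
  by move=> t; rewrite mem_undup => /count_memPn ->.
rewrite -[LHS]big_undup_iterop_count; apply: eq_bigr => t _.
by rewrite Monoid.iteropE; elim: (count_mem t s) => //= k ->; rewrite mulrS.
Qed.

Lemma decomposition_sub (s s' : seq int) (f : int -> M) :
  uniq s -> uniq s' -> {subset s <= s'} -> (forall t, t \notin s -> f t = 0) ->
  \sum_(t <- s) f t = \sum_(t <- s') f t.
Proof.
move=> us us' ss f0; rewrite [RHS](bigID (mem s)) /= [X in _ + X]big1 ?addr0; last first.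
  by move=> t; exact: f0.
rewrite -[RHS]big_filter; apply: perm_big; apply: uniq_perm; rewrite ?filter_uniq // => t.
by rewrite mem_filter; case: (boolP (t \in s)) => // /ss ->.
Qed.

Lemma decompositionB u v f f' : decomposition u f -> decomposition v f' ->
  decomposition (u - v) (fun t => f t - f' t).
Proof.
move=> [hf [s [us s0 ->]]] [hf' [s' [us' s'0 ->]]]; split=> [t|]; first exact: gdegB.
exists (undup (s ++ s')); split; first exact: undup_uniq.
  by move=> t; rewrite mem_undup mem_cat negb_or => /andP[/s0 -> /s'0 ->]; rewrite subrr.
rewrite big_split sumrN /=; congr (_ - _); apply: decomposition_sub => //;
  rewrite ?undup_uniq // => t ht; by rewrite mem_undup mem_cat ht ?orbT.
Qed.

Lemma decomposition0 f : decomposition 0 f -> forall t, f t = 0.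
Proof.
move=> [hf [s [us s0 /esym h]]] t; have [ts|/s0 //] := boolP (t \in s).
exact: (gdeg_direct us hf h).
Qed.

Lemma decomposition_act d (a : S) u f : pdeg d a -> decomposition u f ->
  decomposition (a *: u) (fun t => a *: f (t - d%:Z)).
Proof.
move=> ha [hf [s [us s0 ->]]]; split=> [t|].
  by have := gdeg_act ha (hf (t - d%:Z)); rewrite addrC subrK.
exists [seq t + d%:Z | t <- s]; split.
- by rewrite map_inj_uniq //; exact: addIr.
- move=> t ht; rewrite s0 ?scaler0 //; apply: contra ht => ht.
  by apply/mapP; exists (t - d%:Z); rewrite ?subrK.
- by rewrite scaler_sumr big_map; apply: eq_bigr => t _; rewrite addrK.
Qed.

Definition gproj_fun (u : M) : int -> M := sval (cid (decomposition_exists u)).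
Definition gproj (t : int) (u : M) : M := gproj_fun u t.

Lemma gprojP u : decomposition u (gproj^~ u).
Proof. exact: (svalP (cid (decomposition_exists u))). Qed.

Lemma gprojE u f : decomposition u f -> forall t, gproj t u = f t.
Proof.
move=> hf t; have := decompositionB (gprojP u) hf; rewrite subrr.
by move/decomposition0/(_ t)/eqP; rewrite subr_eq0 => /eqP.
Qed.

Lemma gproj_deg t u : gM t (gproj t u).
Proof. by have [h _] := gprojP u. Qed.

Lemma gproj_is_additive t : {morph gproj t : u v / u - v}.
Proof. by move=> u v; rewrite (gprojE (decompositionB (gprojP u) (gprojP v))). Qed.

HB.instance Definition _ t :=
  GRing.isZmodMorphism.Build M M (gproj t) (gproj_is_additive t).

Lemma gproj_of_deg t s u : gM s u -> gproj t u = if t == s then u else 0.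
Proof.
move=> hu; apply: (gprojE (f := fun t => if t == s then u else 0)); split.
  by move=> t'; case: eqP => [->|_] //; exact: gdeg0.
exists [:: s]; split=> // [t'|]; last by rewrite big_seq1 eqxx.
by rewrite inE => /negbTE ->.
Qed.

Lemma gproj_act d (a : S) t u : pdeg d a -> gproj (d%:Z + t) (a *: u) = a *: gproj t u.
Proof.
move=> ha; rewrite (gprojE (decomposition_act ha (gprojP u))).
by rewrite addrAC subrr add0r.
Qed.


Variable g : nat_grading S.
Hypothesis pdegP : forall d a, pdeg d a <-> homog g d a.
Local Notation gcomp0 := (gcomp0_paug pdegP).

(** The degree-preserving part of a linear map. A lift of the augmentation obtained from
    projectivity need not be homogeneous, and is replaced by this part. *)
Lemma graded_part (phi : {linear M -> S^o}) : exists psi : {linear M -> S^o},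
  forall d u, gcomp g d (psi u) = gcomp g d (phi (gproj d%:Z u)).
Proof.
have /choice[psi hpsi] : forall u, exists y : S,
    forall d, gcomp g d y = gcomp g d (phi (gproj d%:Z u)).
  move=> u; have [_ [s [us s0 _]]] := gprojP u.
  pose N := (\max_(t <- s) `|t|%N).+1.
  exists (\sum_(i < N) gcomp g i (phi (gproj i%:Z u))) => d.
  rewrite raddf_sum /=; have [dN|Nd] := ltnP d N.
    rewrite (bigD1 (Ordinal dN)) //= gcomp_gcomp eqxx big1 ?addr0 // => i id.
    by rewrite gcomp_gcomp ifN // eq_sym.
  rewrite big1 => [|i _]; last first.
    by rewrite gcomp_gcomp ifN // neq_ltn (leq_trans (ltn_ord i) Nd) orbT.
  suff -> : gproj d%:Z u = 0 by rewrite linear0 raddf0.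
  apply: s0; apply/negP => ds; move: Nd; rewrite leqNgt ltnS.
  by rewrite (leq_bigmax_seq _ (F := fun t : int => `|t|%N) ds).
have hl : linear (psi : M -> S^o).
  move=> a u v; apply: (gcomp_ext (g := g)) => d.
  rewrite hpsi raddfD /= linearD raddfD [RHS]raddfD /= hpsi; congr (_ + _).
  rewrite -[RHS]/(gcomp g d (a * psi u)) gcompM.
  have [N hN] := gcomp_bound g a; pose N' := maxn N d.+1.
  have {1}-> : a = \sum_(i < N') gcomp g i a.
    by apply: gcomp_sum => i hi; apply: hN; apply: leq_trans hi; rewrite leq_maxl.
  rewrite scaler_suml raddf_sum linear_sum raddf_sum /=.
  rewrite (big_ord_widen_cond N' xpredT (fun i => gcomp g i a * gcomp g (d - i) (psi u)));
    last exact: leq_maxr.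
  rewrite [RHS]big_mkcond; apply: eq_bigr => i _.
  have -> : gproj d%:Z (gcomp g i a *: u) = gcomp g i a *: gproj (d%:Z - i%:Z) u.
    have ha : pdeg i (gcomp g i a) by apply/pdegP; exact: homog_gcomp.
    by rewrite -(gproj_act _ _ ha) addrC subrK.
  rewrite linearZ /= [_ *: _]/(_ * _) (gcompMl _ _ (homog_gcomp _ _ _)) ltnS.
  case: (leqP i d) => [id|_]; last exact: erefl.
  by rewrite hpsi subzn.
by exists (to_linear hl).
Qed.

End GradingComponents.

Lemma mul_row_linear (S : pzRingType) m (a : S) (r s : 'rV[S]_m) (c : 'cV[S]_m) :
  ((a *: r + s) *m c) 0 0 = a * (r *m c) 0 0 + (s *m c) 0 0.
Proof. by rewrite mulmxDl -scalemxAl mxE [X in X + _]mxE. Qed.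

(** * Exactness from the vanishing of Ext in degrees 0 and 1 *)

Section LowExt.
Variables (K : fieldType) (n : nat) (P : presentation K n).
Local Notation S := (palg P).
Variable g : nat_grading S.
Hypothesis pdegP : forall d a, pdeg d a <-> homog g d a.
Local Notation gcomp0 := (gcomp0_paug pdegP).
Variables (N : nat) (X : 'cV[S]_N).
Hypothesis X_homog : forall i, homog g 1 (X i 0).
Hypothesis X_gen : forall u, paug u = 0 -> exists r : 'rV_N, u = (r *m X) 0 0.
Variables (C : proj_resolution (triv K : lmodType S)) (gC : forall i, grading (C i)).
Hypothesis gC_graded : graded_resolution (triv_grading P) gC.

Lemma graded_scale d c (a : S) : homog g d a -> homog g d (c *: a).
Proof.
move=> ha; rewrite -mulr_algl -[d]add0n; apply: homogM => //.
by rewrite /homog gcomp0 paugZ rmorph1 mulr1.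
Qed.

Lemma aug_annihilated (a b : S) : (forall i, X i 0 * a = 0) -> b * a = paug b *: a.
Proof.
move=> ha; apply/eqP; rewrite -subr_eq0 -mulr_algl -mulrBl; apply/eqP.
have [|r ->] := X_gen (u := b - (paug b)%:A).
  by rewrite rmorphB /= paugZ rmorph1 mulr1 subrr.
by rewrite mxE mulr_suml big1 // => i _; rewrite -mulrA ha mulr0.
Qed.

(** If all x_i annihilate a homogeneous a', then v |-> aug(v) a' is a cocycle on C_0; it is zero,
    and its value at a lift of 1 is a'. *)
Lemma ext0_torsion_free : Ext_zero gC 0 ->
  forall a, (forall i, X i 0 * a = 0) -> a = 0.
Proof.
move=> ext0 a ha; apply: (gcomp_ext0 (n := g)) => d; set a' := gcomp g d a.
have {ha}ha i : X i 0 * a' = 0.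
  have := congr1 (gcomp g (1 + d)%N) (ha i).
  by rewrite (gcompMl _ _ (X_homog i)) leq_addr addKn raddf0.
have [u hu] := pres_surj C (1 : K).
suff /ext0/(_ u) : cocycle gC d%:Z (fun v : C 0%N => (pres_aug C v : K) *: a').
  by rewrite hu scale1r.
split; last first.
  move=> v; suff -> : pres_aug C (pres_d C 0 v) = 0 by exact: scale0r.
  by apply/pres_exact0; exists v.
split=> [b v w|t v hv].
  have -> : (pres_aug C (b *: v + w) : K) = paug b * (pres_aug C v : K) + pres_aug C w.
    exact: linearP.
  rewrite scalerDl; congr (_ + _).
  rewrite -scalerAr (aug_annihilated b ha) scalerA.
  exact: (congr1 (fun z : K => z *: a') (mulrC _ _)).
apply/(rdegP pdegP); have [h _] := gC_graded; case: (h _ _ hv) => ->.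
  by rewrite add0r; apply: graded_scale; exact: homog_gcomp.
by rewrite scale0r; exact: ihomog0.
Qed.

Variable F : 'M[S]_N.
Variable e : nat.
Hypothesis F_homog : forall i j, homog g e (F i j).
Hypothesis XF_exact : forall u : 'rV_N, u *m X = 0 -> exists v, u = v *m F.

(* As F c = 0, there is a map h from the augmentation ideal with h x_i = c_i;
   composed with a lift C_0 -> A of the augmentation and with d_0 it is a cocycle
   on C_1, and its being a coboundary expresses c as a multiple of X. *)
Lemma ext1_exact_homog d (c : 'cV[S]_N) : Ext_zero gC 1 ->
  (forall i, homog g d (c i 0)) -> F *m c = 0 -> exists y : 'M_1, c = X *m y.
Proof.
move=> ext1 hc Fc.
have /choice[r hr] : forall u, exists r : 'rV[S]_N, paug u = 0 -> u = (r *m X) 0 0.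
  by move=> u; have [/X_gen[r hr]|hu] := pselect (paug u = 0); [exists r|exists 0].
pose h (u : S) : S := (r u *m c) 0 0.
have hE (v : 'rV_N) : h ((v *m X) 0 0) = (v *m c) 0 0.
  have h0 : paug ((v *m X) 0 0) = 0.
    apply/(paug0P pdegP); rewrite mxE raddf_sum big1 // => l _.
    by rewrite /= gcompM big_ord1 /= -(X_homog l) gcomp_gcomp mulr0.
  have [|w hw] := XF_exact (u := r ((v *m X) 0 0) - v).
    apply/matrixP => i j; rewrite !ord1 mulmxBl [LHS]mxE [X in _ + X]mxE.
    apply: (etrans (congr1 (fun z => z - (v *m X) 0 0) (esym (hr _ h0)))).
    by rewrite subrr mxE; exact: erefl.
  apply/eqP; rewrite /h -subr_eq0; apply/eqP.
  have -> : (r ((v *m X) 0 0) *m c) 0 0 - (v *m c) 0 0 = ((r ((v *m X) 0 0) - v) *m c) 0 0.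
    by rewrite mulmxBl [RHS]mxE [X in _ = _ + X]mxE.
  by rewrite hw -mulmxA Fc mulmx0 mxE.
have haug_lin : linear (fun u : S^o => paug (u : S) : (triv K : lmodType S)).
  by move=> a u v; rewrite rmorphD rmorphM.
have [phi hphi] : exists phi : {linear C 0%N -> S^o}, forall u, paug (phi u : S) = pres_aug C u.
  have surj (y : (triv K : lmodType S)) : exists u : S^o, to_linear haug_lin u = y.
    exists (y : K)%:A; rewrite /= paugZ rmorph1; exact: mulr1.
  have [phi hphi] := @pres_projective _ _ C 0%N _ _ (to_linear haug_lin) (pres_aug C) surj.
  by exists phi.
have [psi hpsi] := graded_part (gC 0%N) pdegP phi.
have [hC0 hC1] := gC_graded.
have psi_aug u : paug (psi u : S) = pres_aug C u.
  have E : (paug (psi u : S))%:A = (paug (phi (gproj (gC 0%N) 0 u) : S))%:A :> S.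
    by rewrite -!gcomp0 hpsi.
  have -> : paug (psi u : S) = paug (phi (gproj (gC 0%N) 0 u) : S).
    by move/eqP: E; rewrite -subr_eq0 -scalerBl scaler_eq0 oner_eq0 orbF subr_eq0 => /eqP.
  rewrite hphi; have [_ [s [us s0 hs]]] := gprojP (gC 0%N) u.
  have aug0 t : t != 0 -> pres_aug C (gproj (gC 0%N) t u) = 0.
    move=> /eqP t0; have [t0'|h0] := hC0 _ _ (gproj_deg (gC 0%N) t u); first by case: (t0 t0').
    exact: h0.
  rewrite [in RHS]hs linear_sum; have [s00|s00] := boolP (0 \in s).
    rewrite (bigD1_seq 0 s00 us) big1 /=; first (rewrite addr0; exact: erefl).
    exact: aug0.
  rewrite (s0 _ s00) linear0 big1_seq; first exact: erefl.
  move=> t /andP[_ ts]; apply: aug0.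
  by apply: contraNneq s00 => <-.
have psi_deg t u : gC 0%N t u -> ihomog g t (psi u : S).
  move=> hu; apply: (gcomp_ext (g := g)) => d'.
  have E : gcomp g d' (psi u) = if d'%:Z == t then gcomp g d' (phi u) else 0.
    rewrite hpsi (gproj_of_deg _ hu); case: eqP => _; first exact: erefl.
    by rewrite linear0 raddf0; exact: erefl.
  case: t hu E => [t|t] hu E; last by rewrite E raddf0; exact: erefl.
  rewrite [icomp _ _ _]/= gcomp_gcomp; case: (d' =P t) => [->|/eqP d't]; first exact: erefl.
  by rewrite E eqz_nat (negbTE d't); exact: erefl.
(* Writing u = r X lowers the degree by 1 and replacing X by c raises it by d. *)
have h_deg t u : paug u = 0 -> ihomog g t u -> ihomog g (t - 1 + d%:Z) (h u).
  move=> u0 ut; have E : u = ((\row_i icomp g (t - 1) (r u 0 i)) *m X) 0 0.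
    apply: etrans (esym ut) _; apply: etrans (congr1 (icomp g t) (hr _ u0)) _.
    rewrite [X in icomp g t X]mxE [RHS]mxE raddf_sum; apply: eq_bigr => i _.
    by rewrite /= mxE -(icompMr _ _ (X_homog i)) subrK.
  rewrite E hE mxE; apply: ihomog_sum => i; rewrite mxE.
  by apply: ihomogM; [exact: ihomog_icomp|exact: hc].
pose f (v : C 1%N) : S := h (psi (pres_d C 0 v)).
have psi_d v : paug (psi (pres_d C 0 v) : S) = 0.
  have h0 : (pres_aug C (pres_d C 0%N v) : K) = 0.
    exact: ((pres_exact0 (pres_d C 0%N v)).2 (ex_intro _ v erefl)).
  by rewrite psi_aug h0; exact: erefl.
have f_cocycle : cocycle gC (d%:Z - 1) f.
  split; last first.
    move=> v; rewrite /f (_ : pres_d C 0 _ = 0); last by apply/pres_exact; exists v.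
    have E0 : ((0 : 'rV_N) *m X) 0 0 = 0 by rewrite mul0mx mxE.
    rewrite linear0; apply: etrans (congr1 h (esym E0)) _.
    by rewrite hE mul0mx mxE; exact: erefl.
  split=> [a v w|t v hv]; last first.
    apply/(rdegP pdegP); have -> : t + (d%:Z - 1) = t - 1 + d%:Z by rewrite -[in RHS]addrA [-1
      + _]addrC.
    by apply: h_deg => //; apply/psi_deg/hC1.
  pose pv : S := psi (pres_d C 0%N v); pose pw : S := psi (pres_d C 0%N w).
  have E1 : (psi (pres_d C 0%N (a *: v + w)) : S) = a * pv + pw.
    apply: etrans (congr1 psi (linearP _ _ _ _)) _; exact: (linearP psi).
  have E2 : a * pv + pw = ((a *: r pv + r pw) *m X) 0 0.
    apply: etrans _ (esym (mul_row_linear _ _ _ _)).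
    exact: (f_equal2 (fun y z : S => a * y + z) (hr _ (psi_d v)) (hr _ (psi_d w))).
  apply: etrans (congr1 h (etrans E1 E2)) _; rewrite hE; exact: mul_row_linear.
have [h' [[h'_lin _] hh']] := ext1 _ _ f_cocycle.
have [u0 hu0] := pres_surj C (1 : K).
have [|r0 hr0] := X_gen (u := (psi u0 : S) - 1).
  have hu1 : paug (psi u0 : S) = 1 by exact: etrans (psi_aug _) hu0.
  by rewrite rmorphB rmorph1 /= hu1 subrr; exact: erefl.
have h'Z a u : h' (a *: u) = a * h' u.
  exact: (linearZ_LR (to_linear (h'_lin : linear (h' : _ -> S^o)))).
(* Here psi(u0) = 1 + r0 X. The value of h at x_i psi(u0) is x_i h'(u0), because x_i u0 is in the
   image of d_0, and it is also c_i + x_i r0 c. *)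
exists (h' u0 - (r0 *m c) 0 0)%:M; apply/colP => i; rewrite mul_mx_scalarE mulrBr.
have [y hy] : exists y, pres_d C 0%N y = X i 0 *: u0.
  apply: (pres_exact0 _).1; rewrite linearZ_LR hu0.
  have X0 : paug (X i 0) = 0.
    by apply/(paug0P pdegP); rewrite -(X_homog i) gcomp_gcomp; exact: erefl.
  exact: etrans (congr1 (fun z => z * 1) X0) (mul0r _).
have E0 : h (X i 0 * (psi u0 : S)) = X i 0 * h' u0.
  apply: etrans _ (h'Z _ _); rewrite -hy -[RHS]hh' /f hy; congr (h _).
  exact: esym (linearZ_LR psi _ _).
rewrite -E0.
have E : X i 0 * (psi u0 : S) = ((X i 0 *: r0 + delta_mx 0 i) *m X) 0 0.
  apply: etrans _ (esym (mul_row_linear _ _ _ _)).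
  rewrite -rowE [row i X 0 0]mxE.
  apply: etrans (congr1 (fun z => X i 0 * z) (esym (subrK (1 : S) _))) _.
  rewrite mulrDr mulr1; exact: (congr1 (fun z => X i 0 * z + X i 0) hr0).
apply: etrans _ (esym (congr1 (fun z => z - _) (etrans (congr1 h E) (hE _)))).
rewrite mul_row_linear -rowE [row i c 0 0]mxE.
exact: esym (etrans (congr1 (fun z => z - _) (addrC _ _)) (addrK _ _)).
Qed.

Lemma ext1_exact (c : 'cV[S]_N) : Ext_zero gC 1 ->
  F *m c = 0 -> exists y : 'M_1, c = X *m y.
Proof.
move=> ext1 Fc; pose comp d : 'cV[S]_N := \col_i gcomp g d (c i 0).
have /choice[y hy] : forall d, exists y : 'M_1, comp d = X *m y.
  move=> d; apply: (ext1_exact_homog ext1 (d := d)) => [i|].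
    by rewrite mxE; exact: homog_gcomp.
  apply/colP => i; rewrite [RHS]mxE; have := congr1 (fun m : 'cV_N => gcomp g (e + d)%N (m i
    0)) Fc.
  rewrite [X in gcomp _ _ X = _]mxE [X in _ = gcomp _ _ X]mxE raddf0 raddf_sum => h.
  rewrite mxE; apply: etrans _ h; apply: eq_bigr => j _.
  by rewrite mxE /= (gcompMl _ _ (F_homog i j)) leq_addr addKn; exact: erefl.
have [M hM] := gcomp_bound_fin g (fun i => c i 0).
exists (\sum_(d < M) y d); rewrite mulmx_sumr; apply/colP => i.
rewrite (gcomp_sum (hM i)) summxE; apply: eq_bigr => d _.
by rewrite -hy mxE; exact: erefl.
Qed.

End LowExt.

(** * Superpotentials in the tensor algebra *)

Section HomogeneousSuperpotential.
Variables (K : fieldType) (n : nat) (T : algType K) (fd : free_data n T).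
Variables (w : T) (e : nat) (p q : 'I_n -> K) (c : K).
Local Notation x := (fd_x fd).
Hypothesis w_homog : homog fd e.+3 w.
Hypothesis q_neq0 : forall i, q i != 0.
Hypothesis w_twist : w = \sum_l x l * ((q l)^-1 *: fd_rd fd l w).

Definition hess : 'M[T]_n := \matrix_(i, j) fd_rd fd j (fd_ld fd i w).

Lemma ld_w_homog i : homog fd e.+2 (fd_ld fd i w).
Proof. by rewrite /homog -gcompS_ld w_homog. Qed.

Lemma rdE_homog d u : homog fd d.+1 u -> u = \sum_l fd_rd fd l u * x l.
Proof.
move=> hu; rewrite [LHS](fd_rdE fd) -fd_gr0 -hu gcomp_gcomp add0r.
by [].
Qed.

Lemma ldE_homog d u : homog fd d.+1 u -> u = \sum_l x l * fd_ld fd l u.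
Proof.
move=> hu; rewrite [LHS](fd_ldE fd) -fd_gr0 -hu gcomp_gcomp add0r.
by [].
Qed.

Lemma hess_col i : (hess *m fd_col fd) i 0 = fd_ld fd i w.
Proof.
rewrite [RHS](rdE_homog (ld_w_homog i)) mxE; apply: eq_bigr => l _.
by rewrite !mxE.
Qed.

Lemma hess_homog i j : homog fd e.+1 (hess i j).
Proof.
rewrite /homog mxE; have h := ld_w_homog i.
have : \sum_l gcomp fd e.+1 (fd_rd fd l (fd_ld fd i w)) * x l = fd_ld fd i w.
  apply: etrans _ (etrans (esym (congr1 (gcomp fd e.+2) (rdE_homog h))) h).
  rewrite raddf_sum; apply: eq_bigr => l _ /=.
  by rewrite (gcompMr _ _ (fd_gr1 fd l)) /= subn1.
by move/(congr1 (fd_rd fd j)); rewrite fd_rd_sum.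
Qed.

Lemma rd_mull i j d v : homog fd d.+1 v -> fd_rd fd j (x i * v) = x i * fd_rd fd j v.
Proof.
move=> hv; rewrite {1}(rdE_homog hv) mulr_sumr; under eq_bigr => l _ do rewrite mulrA.
by rewrite fd_rd_sum.
Qed.

Lemma rd_w i : fd_rd fd i w = q i *: fd_ld fd i w.
Proof. by rewrite [in RHS]w_twist fd_ld_sum scalerA mulfV // scale1r. Qed.

(** The left side consists of the right derivatives of w, while [hess *m fd_col fd] consists of the
    left ones; invariance under the twist makes them proportional by q_j. *)
Lemma hess_twist :
  (fd_col fd)^T *m hess = (hess *m fd_col fd)^T *m alg_diag T q.
Proof.
apply/matrixP => i j; rewrite mul_mx_alg_diag [X in _ = _ *: X]mxE ord1 hess_col -rd_w.
rewrite [in RHS](ldE_homog w_homog) linear_sum mxE; apply: eq_bigr => l _.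
by rewrite (rd_mull _ _ (ld_w_homog l)) !mxE.
Qed.

Variable sg : {lrmorphism T -> T}.
Hypothesis p_neq0 : forall i, p i != 0.
Hypothesis sg_x : forall i, sg (x i) = p i *: x i.
Hypothesis sg_w : sg w = c *: w.

Lemma sg_ld_w i : sg (fd_ld fd i w) = (c / p i) *: fd_ld fd i w.
Proof.
have : fd_ld fd i (sg w) = p i *: sg (fd_ld fd i w).
  rewrite {1}(ldE_homog w_homog) raddf_sum.
  under eq_bigr => l _ do rewrite /= rmorphM /= sg_x -scalerAl scalerAr.
  by rewrite fd_ld_sum.
rewrite sg_w linearZ /= => /(congr1 ( *:%R (p i)^-1)).
by rewrite !scalerA mulVf // scale1r mulrC => ->.
Qed.

End HomogeneousSuperpotential.

Section TensorMaps.
Variables (K : fieldType) (n : nat).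
Local Notation T := (TV K n).

Lemma mx_tensor_linear (M : 'M[K]_n) : linear (mx_tensor M).
Proof. exact: lin_ext_is_linear. Qed.

Lemma mx_tensor_word (M : 'M[K]_n) s :
  mx_tensor M (word K s) = \prod_(j <- s) mx_gen M j.
Proof. exact: lin_ext_word. Qed.

Lemma mx_tensorM (M : 'M[K]_n) (u v : T) :
  mx_tensor M (u * v) = mx_tensor M u * mx_tensor M v.
Proof.
apply: (@TV_ext2 K n T (fun u v => mx_tensor M (u * v))
  (fun u v => mx_tensor M u * mx_tensor M v)) => [{}u|{}u|{}v|{}v|s t].
- exact: linear_comp (mx_tensor_linear M) (linear_mull u).
- exact: linear_comp (linear_mull _) (mx_tensor_linear M).
- exact: linear_comp (mx_tensor_linear M) (linear_mulr v).
- exact: linear_comp (linear_mulr _) (mx_tensor_linear M).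
by rewrite -word_cat !mx_tensor_word big_cat.
Qed.

Lemma mx_tensor1 (M : 'M[K]_n) : mx_tensor M 1 = 1.
Proof. by rewrite -word_nil mx_tensor_word big_nil word_nil. Qed.

HB.instance Definition _ (M : 'M[K]_n) :=
  GRing.isLinear.Build K T T *:%R (mx_tensor M) (mx_tensor_linear M).
HB.instance Definition _ (M : 'M[K]_n) :=
  GRing.isMonoidMorphism.Build T T (mx_tensor M) (conj (mx_tensor1 M) (mx_tensorM M)).

Lemma mx_gen_diag (p : 'rV[K]_n) j : mx_gen (diag_mx p) j = p 0 j *: gen K j.
Proof.
rewrite /mx_gen (bigD1 j) //= big1 => [|i ij]; first by rewrite mxE eqxx mulr1n addr0.
by rewrite mxE (negbTE ij) mulr0n; exact: scale0r.
Qed.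

Lemma mx_tensor_diag_gen (p : 'rV[K]_n) j :
  mx_tensor (diag_mx p) (gen K j) = p 0 j *: gen K j.
Proof. by rewrite mx_tensor_word big_seq1 mx_gen_diag. Qed.

Lemma twist_rder (M : 'M[K]_n) (u : T) :
  twist M u = (mcoeff one u)%:A + \sum_l mx_gen (invmx M) l * rder l u.
Proof.
apply: (@TV_ext K n T (twist M)
  (fun u => (mcoeff one u)%:A + \sum_l mx_gen (invmx M) l * rder l u)) => [||s].
- exact: lin_ext_is_linear.
- apply: linear_add (@aug_linear K n) _; apply: linear_big => i.
  exact: linear_comp (linear_mull _) (rder_linear i).
rewrite aug_word; apply: etrans (lin_ext_word _ _) _; case: s => [|j s].
  by rewrite big1 ?addr0 // => l _; rewrite rder_nil mulr0.
rewrite add0r (bigD1 (last j s)) //= lastI rder_rcons eqxx big1 ?addr0 // => l ls.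
by rewrite rder_rcons eq_sym (negbTE ls) mulr0.
Qed.

End TensorMaps.

Section KoszulExactness.
Variables (K : fieldType) (n : nat) (T : algType K) (fd : free_data n T).
Variables (A : algType K) (pi : {lrmorphism T -> A}).
Variables (F : 'M[T]_n) (q : 'I_n -> K) (e : nat).
Local Notation x := (fd_col fd).
Local Notation X := (map_mx pi x).
Local Notation FA := (map_mx pi F).
Hypothesis q_neq0 : forall i, q i != 0.
Hypothesis hF : x^T *m F = (F *m x)^T *m alg_diag T q.
Hypothesis hpi : presented pi (F *m x).
Hypothesis F_homog : forall i j, homog fd e.+1 (F i j).
Variable g : nat_grading A.
Hypothesis hg : compatible fd pi g.
Hypothesis right_exact2 : forall c : 'cV[A]_n, FA *m c = 0 ->
  exists e : 'M[A]_1, c = X *m e.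
Hypothesis right_exact3 : forall a : A, (forall i, X i 0 * a = 0) -> a = 0.
Hypothesis n_gt0 : (0 < n)%N.
Hypothesis pd3 : forall M : lmodType A, projdim_le M 3.

Lemma koszul_left_exact i (u : 'rV[A]_(cone_rk n i.+1)) :
  u *m map_mx pi (cone_d fd F i) = 0 ->
  exists v, u = v *m map_mx pi (cone_d fd F i.+1).
Proof.
case: i u => [|[|[|i]]] u /=; last by move=> _; exists 0; apply/rowP => -[].
- exact: left_exact1.
- move=> /(left_exact2 q_neq0 hF hpi hg right_exact2)[a ->].
  by exists a%:M; rewrite mul_scalar_mx map_trmx.
- rewrite -map_trmx => hu; exists 0; rewrite mul0mx.
  apply/rowP => j; rewrite (ord1 j) [RHS]mxE.
  apply: (left_exact3 q_neq0 hF hpi F_homog hg right_exact2 n_gt0 pd3).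
  by rewrite -mul_scalar_mx -[RHS]hu; congr (_ *m _); apply/matrixP => a b; rewrite !ord1 mxE.
Qed.

Lemma koszul_right_exact i (c : 'cV[A]_(cone_rk n i)) : (i < 3)%N ->
  map_mx pi (cone_d fd F i) *m c = 0 ->
  exists b, c = map_mx pi (cone_d1 fd F i) *m b.
Proof.
case: i c => [|[|[|//]]] c _ /=.
- move=> hc; exists 0; apply/colP => j; rewrite (ord1 j) mulmx0 [RHS]mxE.
  apply: right_exact3 => i; have := congr1 (fun m : 'cV_n => m i 0) hc.
  by rewrite mxE big_ord1 [RHS]mxE.
- exact: right_exact2.
- rewrite -map_trmx; exact: (right_exact1 q_neq0 hF hpi).
Qed.

End KoszulExactness.

Lemma ideal_gen_sub (S : pzRingType) (X Y : set S) u :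
  (forall s, X s -> ideal_gen Y s) -> ideal_gen X u -> ideal_gen Y u.
Proof.
move=> h; elim=> [|a s b z hs _ ih]; first exact: ideal_gen0.
by apply: ideal_genD => //; apply/ideal_genMr/ideal_genMl/h.
Qed.

Lemma ideal_gen_mem (S : pzRingType) (X : set S) s : X s -> ideal_gen X s.
Proof.
move=> hs; rewrite -[s]addr0 -[s in s + 0]mulr1 -[s in s * 1]mul1r.
by apply: ideal_gen_add => //; exact: ideal_gen0.
Qed.

Section PresentedAlgebra.
Variables (K : fieldType) (n : nat) (P : presentation K n).
Local Notation T := (TV K n).
Local Notation fd := (TV_data K n).

Lemma palg_presented N (r : 'cV[T]_N) :
  (forall s, s \in relators P -> ideal_gen [set s | exists i, s = r i 0] s) ->
  (forall i, rel_ideal P (r i 0)) -> presented (proj P) r.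
Proof.
move=> h1 h2; split=> [a|u]; first by exists (repr a); exact: proj_repr.
apply: iff_trans (proj_eq0 P u) _; split; first exact: ideal_gen_sub.
by apply: ideal_gen_sub => _ [i ->]; exact: h2.
Qed.

Variables (N : nat) (r : 'cV[T]_N).
Hypothesis hr : presented (proj P) r.
Variable g : nat_grading (palg P).
Hypothesis hg : compatible fd (proj P) g.

Lemma palg_pdegP d (a : palg P) : pdeg d a <-> homog g d a.
Proof.
split=> [[u hu <-]|ha]; first by apply: (compatible_homog hg); exact/tpowP.
have [u hu] := presented_surj hr a; exists (tcomp d u).
  by apply/tpowP; exact: (homog_gcomp (T_grading K n)).
by rewrite -ha -hu; exact: esym (hg d u).
Qed.

Lemma palg_pos_gen (a : palg P) : paug a = 0 ->
  exists s : 'rV_n, a = (s *m map_mx (proj P) (fd_col fd)) 0 0.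
Proof.
have [u <-] := presented_surj hr a; rewrite paug_proj => hu.
exists (map_mx (proj P) (\row_i rder i u)); rewrite -map_mxM [RHS]mxE; congr (proj P _).
rewrite [LHS]TV_rdE hu [X in X + _](_ : _ = 0); last exact: scale0r.
by rewrite add0r mxE; apply: eq_bigr => i _; rewrite !mxE.
Qed.

End PresentedAlgebra.

(** * Domains and noetherian rings *)

Section Preliminaries.
Variables (S A : pzRingType) (g : nat_grading S) (theta : S -> A).
Hypothesis thetaB : forall x y, theta (x - y) = theta x - theta y.

Lemma subr_morph0 : theta 0 = 0.
Proof. by rewrite -(subrr (0 : S)) thetaB subrr. Qed.

Lemma subr_morphD x y : theta (x + y) = theta x + theta y.
Proof.
by rewrite -[y in LHS]opprK thetaB -[- y in LHS]sub0r thetaB subr_morph0 sub0r opprK.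
Qed.

(** Comparing components in 1 * 1 gives 1_t = 1_t 1_0 for all t; summing over t, 1 = 1_0. *)
Lemma homog1 : homog g 0 1.
Proof.
have [N hN] := gcomp_bound g 1.
have h t : gcomp g t 1 = gcomp g t 1 * gcomp g 0 1.
  have := gcompMl t 1 (homog_gcomp g t 1).
  by rewrite leqnn subnn mulr1 gcomp_gcomp eqxx.
rewrite /homog -[LHS]mul1r {1}(gcomp_sum hN) mulr_suml [RHS](gcomp_sum hN).
by apply: eq_bigr => t _; rewrite -h.
Qed.

End Preliminaries.

Section Domain.
Variables (S A : nzRingType) (g : nat_grading S) (Om : S) (d : nat).
Variable theta : S -> A.
Hypothesis thetaB : forall x y, theta (x - y) = theta x - theta y.
Hypothesis thetaM : forall x y, theta (x * y) = theta x * theta y.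
Hypothesis theta_ker : forall y, theta y = 0 -> exists z, y = Om * z.
Hypothesis Om_homog : homog g d Om.
Hypothesis d_gt0 : (0 < d)%N.
Hypothesis Om_normal : normal_element Om.
Hypothesis Om_regular : regular_element Om.

Lemma homog_factor t y z : homog g t y -> y = Om * z ->
  y = 0 \/ (d <= t)%N /\ exists2 z', homog g (t - d) z' & y = Om * z'.
Proof.
move=> hy yz; have := hy; rewrite /homog {1}yz (gcompMl _ _ Om_homog).
case: leqP => dt E; last by left.
by right; split=> //; exists (gcomp g (t - d) z); [exact: homog_gcomp|].
Qed.

(** One of the factors vanishes in A, so it is a multiple of Om. Cancelling Om, after moving it past
    x when it divides y, lowers the total degree by d > 0. *)
Lemma domain_homog N a b x y : (a + b < N)%N -> domain A ->
  homog g a x -> homog g b y -> x * y = 0 -> x = 0 \/ y = 0.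
Proof.
move=> + dA; have [_ domA] := dA; have [Om_l Om_r] := Om_regular.
elim: N a b x y => // N ih a b x y abN hx hy xy.
have [/theta_ker[z /(homog_factor hx)[->|[da [x' hx' xE]]]]|] :=
    domA _ _ (etrans (esym (thetaM x y)) (etrans (congr1 theta xy) (subr_morph0 thetaB))).
- by left.
- have x'y : x' * y = 0 by apply: Om_l; rewrite mulrA -xE xy mulr0.
  have [||->] := ih _ _ _ _ _ hx' hy x'y; last by right.
    by lia.
  by move=> x'0; left; rewrite xE x'0 mulr0.
move=> /theta_ker[z /(homog_factor hy)[->|[db [y' hy' yE]]]]; first by right.
have [x1 _ x1E] : [set Om * u | u in [set: S]] (x * Om) by rewrite Om_normal; exists x.
pose x' := gcomp g a x1; have x'E : x * Om = Om * x'.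
  have h : homog g (a + d) (x * Om) by exact: homogM.
  rewrite -[LHS]h -x1E addnC (gcompMl _ _ Om_homog) leq_addr addKn.
  by [].
have x'y : x' * y' = 0 by apply: Om_l; rewrite mulrA -x'E -mulrA -yE xy mulr0.
have [|x'0|y'0] := ih _ _ _ _ _ (homog_gcomp g a x1) hy' x'y.
- by lia.
- by left; apply: Om_r; rewrite /= x'E [x']x'0 mulr0 mul0r.
- by right; rewrite yE y'0 mulr0.
Qed.

(** The product of the lowest components of x and y is a component of x y. *)
Lemma domain_extension : domain A -> domain S.
Proof.
move=> dA; split; first by apply/eqP; exact: oner_neq0.
have least u : u != 0 -> exists a, gcomp g a u <> 0 /\ forall i, (i < a)%N -> gcomp g i u = 0.
  move=> /eqP u0; have ex : exists a, gcomp g a u != 0.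
    by apply: contrapT => h; apply/u0/(gcomp_ext0 (n := g)) => i; apply/eqP/negPn/negP => hi;
      apply: h; exists i.
  case: (ex_minnP ex) => a /eqP a0 amin.
  exists a; split=> // i ia; apply/eqP; apply: contraLR ia => /amin.
  by rewrite -leqNgt.
move=> x y xy; have [->|/least[a [xa xmin]]] := eqVneq x 0; first by left.
have [->|/least[b [yb ymin]]] := eqVneq y 0; first by right.
have := congr1 (gcomp g (a + b)) xy; rewrite raddf0 gcompM.
have ab : (a < (a + b).+1)%N by rewrite ltnS leq_addr.
rewrite (bigD1 (Ordinal ab)) //= addKn big1 ?addr0 => [h|i ia].
  by case: (domain_homog (ltnSn _) dA (homog_gcomp _ _ _) (homog_gcomp _ _ _) h).
have [/xmin ->|ai] := ltnP i a; first by rewrite mul0r.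
rewrite ymin ?mulr0 //; have {}ia : i != a :> nat by [].
have := ltn_ord i; lia.
Qed.

End Domain.

Section LeftIdeals.
Variable S : pzRingType.
Implicit Types J : set S.

Lemma left_idealD J x y : left_ideal J -> J x -> J y -> J (x + y).
Proof. by move=> [_ h] hx hy; rewrite -[x]mul1r; exact: h. Qed.

Lemma left_idealM J a x : left_ideal J -> J x -> J (a * x).
Proof. by move=> [h0 h] hx; rewrite -[_ * _]addr0; exact: h. Qed.

Lemma left_idealB J x y : left_ideal J -> J x -> J y -> J (x - y).
Proof.
by move=> hJ hx hy; apply: left_idealD => //; rewrite -mulN1r; exact: left_idealM.
Qed.

Lemma left_ideal_sum J (I : Type) (r : seq I) (Q : pred I) (F : I -> S) :
  left_ideal J -> (forall i, Q i -> J (F i)) -> J (\sum_(i <- r | Q i) F i).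
Proof.
move=> hJ hF; apply: big_ind => [|x y|//]; first by case: hJ.
exact: left_idealD.
Qed.

Lemma chain_mono (J : nat -> set S) : (forall i, J i `<=` J i.+1) ->
  forall i j, (i <= j)%N -> J i `<=` J j.
Proof.
move=> hJ i j /subnKC <-; elim: (j - i)%N => [|l ih]; first by rewrite addn0.
by rewrite addnS; apply: subset_trans ih _.
Qed.

End LeftIdeals.

Section Noetherian.
Variables (S A : pzRingType) (g : nat_grading S) (Om : S) (d : nat).
Variable theta : S -> A.
Hypothesis thetaB : forall x y, theta (x - y) = theta x - theta y.
Hypothesis thetaM : forall x y, theta (x * y) = theta x * theta y.
Hypothesis theta_surj : forall a, exists y, theta y = a.

Lemma noetherian_quotient : left_noetherian S -> left_noetherian A.
Proof.
move=> nS J hJ Jmono.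
have [||N hN] := nS (fun i => theta @^-1` J i).
- move=> i; split=> /= [|a x y hx hy]; first by rewrite (subr_morph0 thetaB); case: (hJ i).
  by rewrite (subr_morphD thetaB) thetaM; case: (hJ i) => _; apply.
- by move=> i x; exact: Jmono.
exists N => i Ni; apply/seteqP; split=> a; have [y <-] := theta_surj a.
  by have /seteqP[h _] := hN i Ni; exact: h.
by have /seteqP[_ h] := hN i Ni; exact: h.
Qed.

Hypothesis theta_ker : forall y, theta y = 0 -> exists z, y = Om * z.
Hypothesis Om_homog : homog g d Om.
Hypothesis d_gt0 : (0 < d)%N.
Hypothesis Om_normal : normal_element Om.

(** The analogue of the ideals of leading coefficients in Hilbert's basis theorem, with the powers
    of Om in place of those of a variable. *)
Definition slice (s : nat) (J : set S) : set A := theta @` [set y | J (Om ^+ s * y)].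

Lemma Om_exp_normal s a : exists b, Om ^+ s * a = b * Om ^+ s.
Proof.
elim: s a => [|s ih] a; first by exists a; rewrite mul1r mulr1.
have [b hb] := ih a; rewrite exprS -mulrA hb mulrA.
have : [set Om * u | u in [set: S]] (Om * b) by exists b.
by rewrite Om_normal => -[c _ <-]; exists c; rewrite mulrA.
Qed.

Lemma slice_ideal s J : left_ideal J -> left_ideal (slice s J).
Proof.
move=> hJ; have [J0 _] := hJ; split.
  by exists 0; [rewrite /= mulr0|exact: subr_morph0].
move=> a _ _ [x hx <-] [y hy <-]; have [c <-] := theta_surj a.
exists (c * x + y); last by rewrite (subr_morphD thetaB) thetaM.
rewrite /= mulrDr; apply: left_idealD => //.
rewrite mulrA; have [b ->] := Om_exp_normal s c; rewrite -mulrA.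
exact: left_idealM.
Qed.

Lemma sliceS s J : left_ideal J -> slice s J `<=` slice s.+1 J.
Proof.
move=> hJ _ [y hy <-]; exists y => //=; rewrite exprS -mulrA; exact: left_idealM.
Qed.

Lemma slice_mono s J J' : J `<=` J' -> slice s J `<=` slice s J'.
Proof. by move=> JJ _ [y hy <-]; exists y => //; exact: JJ. Qed.

Definition graded_ideal (J : set S) : Prop :=
  left_ideal J /\ forall t u, J u -> J (gcomp g t u).

Lemma Om_exp_homog s : homog g (s * d) (Om ^+ s).
Proof.
elim: s => [|s ih]; last by rewrite exprS mulSn; exact: homogM.
by rewrite expr0; exact: homog1.
Qed.

(** An element of J' is corrected by one of J with the same image in A; the difference is Om times
    an element of smaller degree, to which the next slice applies. The argument ends because it runs
    on homogeneous elements, hence the restriction to graded ideals. *)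
Lemma slice_eq J J' : graded_ideal J -> graded_ideal J' -> J `<=` J' ->
  (forall s, slice s J = slice s J') -> J' `<=` J.
Proof.
move=> [hJ gJ] [hJ' gJ'] JJ' hs.
have key N : forall s t y, (t < N)%N -> homog g t y -> J' (Om ^+ s * y) -> J (Om ^+ s * y).
  elim: N => // N ih s t y tN hy hJy.
  have : slice s J' (theta y) by exists y.
  rewrite -hs => -[y1 /= /(gJ (s * d + t)%N)].
  rewrite (gcompMl _ _ (Om_exp_homog s)) leq_addr addKn => hy1 yy1.
  have [|z hz] := theta_ker (y := y - y1); first by rewrite thetaB yy1 subrr.
  have yE : y = gcomp g t y1 + gcomp g t (Om * z).
    by rewrite -raddfD /= -hz addrC subrK hy.
  rewrite yE mulrDr; apply: left_idealD => //.
  rewrite (gcompMl _ _ Om_homog); case: leqP => dt; last by rewrite mulr0; case: hJ.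
  rewrite mulrA -exprSr; apply: (ih _ (t - d)%N); [lia|exact: homog_gcomp|].
  have -> : Om ^+ s.+1 * gcomp g (t - d) z = Om ^+ s * y - Om ^+ s * gcomp g t y1.
    by rewrite exprSr -mulrA -mulrBr -{1}hy -raddfB /= hz (gcompMl _ _ Om_homog) dt.
  by apply: left_idealB => //; exact: JJ'.
move=> u hu; have [N hN] := gcomp_bound g u; rewrite (gcomp_sum hN).
apply: left_ideal_sum => // t _; have := key t.+1 0%N t (gcomp g t u) (ltnSn _).
by rewrite expr0 mul1r; apply; [exact: homog_gcomp|exact: gJ'].
Qed.

(** The diagonal chain [slice i (J i)] is stationary from some M on, which settles all slices of
    index at least M at once; the finitely many others are treated one by one. *)
Lemma graded_chain (J : nat -> set S) : left_noetherian A ->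
  (forall i, graded_ideal (J i)) -> (forall i, J i `<=` J i.+1) ->
  exists N, forall i, (N <= i)%N -> J i = J N.
Proof.
move=> nA gJ Jmono; have hJ i := (gJ i).1.
have mono s s' i i' : (s <= s')%N -> (i <= i')%N -> slice s (J i) `<=` slice s' (J i').
  move=> ss' ii'; apply: (@subset_trans _ (slice s (J i'))).
    by apply: slice_mono; exact: chain_mono.
  by apply: (chain_mono (J := fun s => slice s (J i'))) => // s''; exact: sliceS.
have [|i|M hM] := nA (fun i => slice i (J i)); first by move=> i; exact: slice_ideal.
  exact: mono.
have /choice[c hc] : forall s, exists N, forall i, (N <= i)%N -> slice s (J i) = slice s (J N).
  move=> s; apply: nA => i; first exact: slice_ideal.
  exact: mono.
pose N := maxn M (\max_(s < M) c s); exists N => i Ni.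
apply/seteqP; split; last exact: chain_mono.
apply: slice_eq => // [|s]; first exact: chain_mono.
have [sM|Ms] := ltnP s M.
  have cN : (c s <= N)%N.
    by rewrite leq_max (leq_trans _ (leq_bigmax (Ordinal sM))) ?orbT.
  by rewrite (hc s N) // (hc s i) // (leq_trans cN).
have stab l : (M <= l)%N -> slice s (J l) = slice M (J M).
  move=> Ml; apply/seteqP; split; last exact: mono.
  rewrite -(hM (maxn s l)) ?leq_max ?Ml ?orbT //.
  by apply: mono; rewrite leq_max leqnn ?orbT.
have MN : (M <= N)%N by exact: leq_maxl.
by rewrite (stab i (leq_trans MN Ni)) (stab N MN).
Qed.

(** The associated graded ideal: each component of u is the form of top degree of some element of J,
    or zero. It reduces chains of arbitrary left ideals to chains of graded ones. *)
Definition leading_ideal (J : set S) : set S := [set u | forall t, exists v,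
  [/\ J v, forall i, (t < i)%N -> gcomp g i v = 0 & gcomp g t v = gcomp g t u]].

Lemma leading_graded J : left_ideal J -> graded_ideal (leading_ideal J).
Proof.
move=> hJ; have J0 : J 0 by case: hJ.
have LD u v : leading_ideal J u -> leading_ideal J v -> leading_ideal J (u + v).
  move=> hu hv t; have [u' [h1 h2 h3]] := hu t; have [v' [k1 k2 k3]] := hv t.
  exists (u' + v'); split; first exact: left_idealD.
    by move=> i ti; rewrite raddfD /= h2 // k2 // addr0.
  by rewrite !raddfD /= h3 k3.
split; last first.
  move=> s u hu t; rewrite gcomp_gcomp; case: eqP => [->|_]; first exact: hu.
  by exists 0; split=> // [i _|]; rewrite raddf0.
split=> [t|a u v hu hv]; first by exists 0; split=> // i _; rewrite raddf0.
apply: LD => // t.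
have /choice[v' hv'] := hu.
exists (\sum_(i < t.+1) gcomp g i a * v' (t - i)%N); split.
- apply: left_ideal_sum => // i _; apply: left_idealM => //.
  by have [] := hv' (t - i)%N.
- move=> l tl; rewrite raddf_sum big1 // => i _ /=.
  rewrite (gcompMl _ _ (homog_gcomp g i a)); case: leqP => // il.
  have [_ h _] := hv' (t - i)%N; rewrite h ?mulr0 //.
  have := ltn_ord i; lia.
- rewrite raddf_sum gcompM; apply: eq_bigr => i _ /=.
  rewrite (gcompMl _ _ (homog_gcomp g i a)) -ltnS ltn_ord.
  by have [_ _ ->] := hv' (t - i)%N.
Qed.

Lemma leading_mono J J' : J `<=` J' -> leading_ideal J `<=` leading_ideal J'.
Proof. by move=> JJ u hu t; have [v [/JJ]] := hu t; exists v. Qed.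

Lemma leading_eq J J' : left_ideal J -> left_ideal J' -> J `<=` J' ->
  leading_ideal J = leading_ideal J' -> J' `<=` J.
Proof.
move=> hJ hJ' JJ' hL u; have [N] := gcomp_bound g u.
elim: N u => [|N ih] u hN hu.
  have -> : u = 0 by apply: (gcomp_ext0 (n := g)) => i; exact: hN.
  by case: hJ.
have : leading_ideal J' (gcomp g N u).
  move=> t; rewrite gcomp_gcomp; case: eqP => [->|_].
    by exists u; split=> // i; exact: hN.
  by exists 0; split=> [|i _|]; rewrite ?raddf0 //; case: hJ'.
rewrite -hL => /(_ N)[v [hv h1 h2]]; rewrite gcomp_gcomp eqxx in h2.
rewrite -[u](subrK v); apply: left_idealD => //.
apply: ih => [i Ni|]; last by apply: left_idealB => //; exact: JJ'.
rewrite raddfB /=; have [iN|iN] := eqVneq i N; first by rewrite iN h2 subrr.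
by rewrite hN ?h1 ?subrr // ltn_neqAle eq_sym iN.
Qed.

Lemma noetherian_extension : left_noetherian A -> left_noetherian S.
Proof.
move=> nA J hJ Jmono.
have [|i|N hN] := graded_chain (J := fun i => leading_ideal (J i)) nA.
- by move=> i; exact: leading_graded.
- exact: leading_mono.
exists N => i Ni; apply/seteqP; split; last exact: chain_mono.
by apply: leading_eq => //; [exact: chain_mono|rewrite hN].
Qed.

End Noetherian.

Section ConverseGrading.
Variables (S : pzRingType) (g : nat_grading S).

Definition converse_gcomp (d : nat) : {additive S^c -> S^c} := gcomp g d.

Lemma converse_gcompM d (x y : S^c) : converse_gcomp d (x * y) =
  \sum_(i < d.+1) converse_gcomp i x * converse_gcomp (d - i) y.
Proof.
apply: etrans (gcompM g d (y : S) (x : S)) _; rewrite (reindex_inj rev_ord_inj) /=.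
by apply: eq_bigr => i _; rewrite subSS subKn // -ltnS.
Qed.

Definition converse_grading : nat_grading S^c :=
  @NatGrading S^c converse_gcomp (@gcomp_gcomp S g) (@gcomp_bound S g)
    (@gcomp_ext0 S g) converse_gcompM.

End ConverseGrading.

Lemma noetherian_iff (S A : pzRingType) (g : nat_grading S) (Om : S) (d : nat)
    (theta : {rmorphism S -> A}) :
  (forall a, exists y, theta y = a) ->
  (forall y, theta y = 0 -> exists z, y = Om * z) ->
  homog g d Om -> (0 < d)%N -> normal_element Om ->
  noetherian S <-> noetherian A.
Proof.
move=> hs hk hO d0 nO.
have tB := raddfB theta; have tM := rmorphM theta.
pose theta' : S^c -> A^c := theta.
have tB' (x y : S^c) : theta' (x - y) = theta' x - theta' y by exact: tB.
have tM' (x y : S^c) : theta' (x * y) = theta' x * theta' y by exact: tM.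
have nO' : normal_element (Om : S^c) by exact: esym nO.
(* In [S^c] the factor Om stands on the other side, where normality puts it. *)
have hk' (y : S^c) : theta' y = 0 -> exists z : S^c, y = (Om : S^c) * z.
  move=> /hk[z yz]; have : [set Om * a | a in [set: S]] y by exists z.
  by rewrite nO => -[z' _ <-]; exists z'.
split=> -[h1 h2]; split.
- exact: (noetherian_quotient tB tM).
- exact: (noetherian_quotient (S := S^c) (A := A^c) tB' tM').
- exact: (noetherian_extension tB tM hs hk hO d0 nO).
- exact: (noetherian_extension (S := S^c) (A := A^c) (g := converse_grading g)
    tB' tM' hs hk' hO d0 nO').
Qed.

(** * Growth *)

Section Spans.
Variables (K : fieldType) (V : lmodType K).
Implicit Types (t W : seq V) (a b : V).

Definition in_span t a : Prop := exists c : nat -> K, a = \sum_(i < size t) c i *: t`_i.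

Lemma in_span0 t : in_span t 0.
Proof. by exists (fun=> 0); rewrite big1 // => i _; rewrite scale0r. Qed.

Lemma in_spanD t a b : in_span t a -> in_span t b -> in_span t (a + b).
Proof.
move=> [c ->] [c' ->]; exists (fun i => c i + c' i); rewrite -big_split.
by apply: eq_bigr => i _; rewrite scalerDl.
Qed.

Lemma in_spanZ t k a : in_span t a -> in_span t (k *: a).
Proof.
move=> [c ->]; exists (fun i => k * c i); rewrite scaler_sumr.
by apply: eq_bigr => i _; rewrite scalerA.
Qed.

Lemma in_span_mem t a : a \in t -> in_span t a.
Proof.
move=> at_; exists (fun i => (i == index a t)%:R).
have ia : (index a t < size t)%N by rewrite index_mem.
rewrite (bigD1 (Ordinal ia)) //= eqxx scale1r nth_index // big1 ?addr0 // => i ij.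
by rewrite (_ : (i == _ :> nat) = false) ?scale0r //; apply: negbTE.
Qed.

Lemma in_span_sum t (I : Type) (r : seq I) (Q : pred I) (F : I -> V) :
  (forall i, Q i -> in_span t (F i)) -> in_span t (\sum_(i <- r | Q i) F i).
Proof.
by move=> h; apply: big_ind => //; [exact: in_span0|move=> *; exact: in_spanD].
Qed.

Lemma in_span_trans t W a :
  (forall x, x \in t -> in_span W x) -> in_span t a -> in_span W a.
Proof.
move=> h [c ->]; apply: in_span_sum => i _; apply/in_spanZ/h; exact: mem_nth.
Qed.

End Spans.

Lemma in_span_map (K : fieldType) (V V' : lmodType K) (f : {linear V -> V'}) t a :
  in_span t a -> in_span (map f t) (f a).
Proof.
move=> [c ->]; exists c; rewrite linear_sum size_map; apply: eq_bigr => i _.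
by rewrite linearZ (nth_map 0).
Qed.

Section SpanDimension.
Variables (K : fieldType) (A : algType K).
Implicit Types (t W : seq A).

(** For more than [size W] elements the matrix of coordinates has a non-zero vector in its left
    kernel, which is a linear relation. *)
Lemma span_dim_le t W : (forall x, x \in t -> in_span W x) -> (span_dim t <= size W)%N.
Proof.
move=> h; apply/bigmax_leqP => I /asboolP hI; rewrite leqNgt; apply/negP => lt.
have /choice[c hc] : forall j : 'I_(size t), exists c : nat -> K,
    t`_j = \sum_(i < size W) c i *: W`_i.
  by move=> j; apply: h; exact: mem_nth.
pose C : 'M[K]_(#|I|, size W) := \matrix_(a, b) c (enum_val a) b.
have ker0 : kermx C != 0.
  apply: contraTneq lt => /eqP; rewrite kermx_eq0 -leqNgt => /eqP <-.
  exact: rank_leq_col.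
pose v := nz_row (kermx C).
have v0 : v != 0 by rewrite nz_row_eq0.
have vC : v *m C = 0 by apply/sub_kermxP; exact: nz_row_sub.
have [i0 i0I] : exists i0, i0 \in I.
  by apply/set0Pn; rewrite -card_gt0; exact: leq_ltn_trans lt.
pose d j := v 0 (enum_rank_in i0I j).
have d0 : \sum_(j in I) d j *: t`_j = 0.
  rewrite big_enum_val /=.
  under eq_bigr => a _ do rewrite /d enum_valK_in hc scaler_sumr.
  rewrite exchange_big big1 //= => b _.
  under eq_bigr => a _ do rewrite scalerA.
  rewrite -scaler_suml; have /rowP/(_ b) := vC; rewrite !mxE => E.
  by under eq_bigr => a _ do rewrite -[c _ b](mxE matrix_key (fun a b => c (enum_val a) b)) ;
    rewrite E scale0r.
case/eqP: v0; apply/rowP => a; rewrite [RHS]mxE.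
by have := hI _ d0 _ (enum_valP a); rewrite /d enum_valK_in.
Qed.

Lemma span_basis t : exists W : seq A,
  [/\ size W = span_dim t, {subset W <= t} & forall x, x \in t -> in_span W x].
Proof.
have P0 : (0 < #|[pred I : {set 'I_(size t)} | `[< independent_at I >]]|)%N.
  by apply/card_gt0P; exists finset.set0; apply/asboolP => c _ i; rewrite finset.in_set0.
have [I /asboolP hI maxI] := eq_bigmax_cond (fun I : {set 'I_(size t)} => #|I|) P0.
pose W := [seq t`_i | i : 'I_(size t) <- enum I]; exists W; split.
- by rewrite size_map -cardE [RHS]maxI.
- by move=> _ /mapP[i _ ->]; exact: mem_nth.
move=> x /(nthP 0)[j jt <-]; pose j' := Ordinal jt.
have WI (i : 'I_(size t)) : i \in I -> in_span W t`_i.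
  by move=> iI; apply/in_span_mem/map_f; rewrite mem_enum.
have [/WI //|jI] := boolP (j' \in I).
have [c [c0 [i [iJ ci]]]] : exists c : 'I_(size t) -> K,
    \sum_(i in j' |: I) c i *: t`_i = 0 /\ exists i, i \in j' |: I /\ c i <> 0.
  apply: contrapT => h.
  have hJ : independent_at (j' |: I).
    move=> c c0 i iJ; apply: contrapT => ci; apply: h; exists c; split=> //.
    by exists i.
  have : (#|j' |: I| <= #|I|)%N.
    rewrite -maxI; apply: (leq_bigmax_cond (F := fun I : {set 'I_(size t)} => #|I|)).
    exact/asboolP.
  by rewrite cardsU1 jI ltnn.
rewrite big_setU1 //= in c0.
have cj : c j' != 0.
  apply/eqP => cj; rewrite cj scale0r add0r in c0.
  move: iJ; rewrite in_setU1 => /orP[/eqP ij|iI]; first by rewrite ij in ci.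
  exact/ci/hI.
have -> : t`_j = \sum_(i in I) (- (c j')^-1 * c i) *: t`_i.
  under eq_bigr => l _ do rewrite -scalerA.
  rewrite -scaler_sumr; move/eqP: c0; rewrite addr_eq0 eq_sym eqr_oppLR => /eqP ->.
  by rewrite scalerN scaleNr opprK scalerA mulVf // scale1r.
by apply: in_span_sum => l lI; apply/in_spanZ/WI.
Qed.

End SpanDimension.

Lemma span_dim_map (K : fieldType) (A B : algType K) (f : {linear A -> B}) (t : seq A) :
  (span_dim (map f t) <= span_dim t)%N.
Proof.
have [W [<- _ hW]] := span_basis t; rewrite -(size_map f W).
by apply: span_dim_le => _ /mapP[x xt ->]; apply/in_span_map/hW.
Qed.

Lemma mem_productsS (K : fieldType) (A : algType K) (s : seq A) N y :
  y \in products s N.+1 -> y = 1 \/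
  exists x z, [/\ x \in s, z \in products s N & y = x * z].
Proof.
rewrite /= inE => /orP[/eqP ->|]; first by left.
by move=> /allpairsP[[x z] /= [xs zs ->]]; right; exists x, z.
Qed.

Lemma map_products (K : fieldType) (A B : algType K) (f : {lrmorphism A -> B})
    (s : seq A) N : map f (products s N) = products (map f s) N.
Proof.
elim: N => [|N ih]; first by rewrite /= rmorph1.
rewrite /= rmorph1 map_allpairs allpairs_mapl -ih allpairs_mapr.
by congr (_ :: _); apply: eq_allpairs => x y; rewrite rmorphM.
Qed.

Section Growth.
Variables (K : fieldType) (D A : algType K) (g : nat_grading D).
Variables (theta : {lrmorphism D -> A}) (Om : D) (d : nat) (G : seq D).
Hypothesis theta_ker : forall y, theta y = 0 -> exists z, y = Om * z.
Hypothesis Om_homog : homog g d Om.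
Hypothesis d_gt0 : (0 < d)%N.
Hypothesis g_scalar : forall c : K, homog g 0 c%:A.

Definition deg_le (M : nat) (y : D) : Prop := forall i, (M < i)%N -> gcomp g i y = 0.

Hypothesis G_gen : forall M y, deg_le M y -> in_span (products G M) y.

Lemma graded_linear e c y : gcomp g e (c *: y) = c *: gcomp g e y.
Proof. by rewrite -mulr_algl (gcompMl _ _ (g_scalar c)) subn0 mulr_algl. Qed.

Lemma deg_le_exists y : exists M, deg_le M y.
Proof. by have [M hM] := gcomp_bound g y; exists M => i /ltnW; exact: hM. Qed.

Lemma products_deg (s : seq D) b N y : (forall x, x \in s -> deg_le b x) ->
  y \in products s N -> deg_le (b * N) y.
Proof.
move=> hs; have h1 M : deg_le M 1.
  by move=> i Mi; rewrite (gcomp_homog _ (homog1 g)) gtn_eqF // (leq_ltn_trans _ Mi).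
elim: N y => [|N ih] y; first by rewrite inE => /eqP ->.
case/mem_productsS=> [->//|[x [z [xs zs ->]]]] i hi; rewrite gcompM big1 // => j _.
have [bj|jb] := ltnP b j; first by rewrite (hs _ xs) ?mul0r.
by rewrite (ih _ zs) ?mulr0 //; lia.
Qed.

Lemma map_lift (t : seq D) (W : seq A) : {subset W <= map theta t} ->
  exists V : seq D, map theta V = W.
Proof.
elim: W => [|w W ih] hW; first by exists [::].
have /mapP[v _ vw] := hW w (mem_head _ _).
have [|V hV] := ih; first by move=> x xW; apply: hW; rewrite inE xW orbT.
by exists (v :: V); rewrite /= hV -vw.
Qed.

(* The elements of degree at most M = b * N are spanned by the Om^j v_e with
   j, e <= M, where v runs over lifts of a basis of the quotient in degree at
   most M and v_e is the component of degree e. *)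
Lemma span_dim_extension (s : seq D) b N : (forall x, x \in s -> deg_le b x) ->
  (span_dim (products s N) <=
    (b * N).+1 * ((b * N).+1 * span_dim (products (map theta G) (b * N))))%N.
Proof.
move=> hs; set M := (b * N)%N.
have [W [sW Wt hW]] := span_basis (products (map theta G) M).
have [V VW] : exists V : seq D, map theta V = W.
  by apply: (map_lift (t := products G M)); rewrite map_products.
pose U := [seq gcomp g e v | e <- iota 0 M.+1, v <- V].
pose Z M' := [seq Om ^+ j * u | j <- iota 0 M'.+1, u <- U].
have sZ : size (Z M) = (M.+1 * (M.+1 * span_dim (products (map theta G) M)))%N.
  by rewrite !size_allpairs !size_iota -sW -VW size_map.
rewrite -sZ; apply: span_dim_le => y /(products_deg hs) hy.
suff key M' : (M' <= M)%N -> forall y, deg_le M' y -> in_span (Z M') y by exact: key.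
(* Division by Om in degree at most L: the remainder lifts the image of u in A and is spread over
   the components in [U], and the quotient, cut to the relevant degrees, has degree below L because
   d > 0. *)
have division L u : (L <= M)%N -> deg_le L u -> exists u0 z,
    [/\ u = u0 + Om * z, in_span U u0 & forall i, (L <= i)%N -> gcomp g i z = 0].
  move=> LM hu.
  have [c hc] : in_span W (theta u).
    apply: (in_span_trans hW); rewrite -map_products; apply/in_span_map/G_gen => i Mi.
    apply: hu; exact: leq_ltn_trans Mi.
  pose y0 := \sum_(i < size V) c i *: V`_i.
  have [|z hz] := theta_ker (y := u - y0).
    apply/eqP; rewrite raddfB /= subr_eq0 hc linear_sum -VW size_map; apply/eqP.
    by apply: eq_bigr => i _; rewrite linearZ /= (nth_map 0).
  exists (\sum_(t < L.+1) gcomp g t y0),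
    (\sum_(t < L.+1) (if (d <= t)%N then gcomp g (t - d) z else 0)); split.
  - rewrite [LHS](gcomp_sum (g := g) (N := L.+1)); last by move=> i; exact: hu.
    rewrite mulr_sumr -big_split; apply: eq_bigr => t _ /=.
    rewrite -[u in LHS](subrK y0) hz raddfD /= addrC; congr (_ + _).
    by rewrite (gcompMl _ _ Om_homog); case: ifP; rewrite ?mulr0.
  - apply: in_span_sum => t _; rewrite raddf_sum; apply: in_span_sum => i _ /=.
    rewrite graded_linear; apply/in_spanZ/in_span_mem/allpairsP.
    exists (nat_of_ord t, V`_i); split=> //; last exact: mem_nth.
    by rewrite mem_iota add0n /= ltnS (leq_trans _ LM) // -ltnS.
  - move=> i Li; rewrite raddf_sum big1 // => t _ /=; case: leqP => dt; last exact: raddf0.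
    rewrite gcomp_gcomp ifN //; apply/eqP => it; have := ltn_ord t; lia.
have UZ L u : in_span U u -> in_span (Z L) u.
  apply: in_span_trans => v vU; apply/in_span_mem/allpairsP; exists (0%N, v).
  by split=> //=; rewrite expr0 mul1r.
elim: M' => [|M' ih] M'M {}y {}hy.
  have [u0 [z [-> hu0 hz]]] := division _ _ M'M hy.
  have -> : z = 0 by apply: (gcomp_ext0 (n := g)) => i; exact: hz.
  by rewrite mulr0 addr0; exact: UZ.
have [u0 [z [-> hu0 hz]]] := division _ _ M'M hy.
apply: in_spanD; first exact: UZ.
have lO : linear ( *%R Om : D -> D) by move=> a u v; rewrite mulrDr scalerAr.
apply: in_span_trans (in_span_map (to_linear lO) (ih (ltnW M'M) z hz)).
move=> _ /mapP[x /allpairsP[[j u] [hj hu ->]] ->]; apply/in_span_mem/allpairsP.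
exists (j.+1, u); split=> //; last by rewrite /= exprS mulrA.
by move: hj; rewrite !mem_iota !add0n.
Qed.

End Growth.

Section LogarithmicGrowth.
Variable R : realType.

Lemma ln_nat_ge0 (a : nat) : 0 <= ln a%:R :> R.
Proof. by case: a => [|a]; [rewrite ln0|apply: ln_ge0; rewrite ler1n]. Qed.

Lemma ln_nat_mono (a b : nat) : (a <= b)%N -> ln a%:R <= ln b%:R :> R.
Proof.
case: a => [|a] ab; first by rewrite ln0 // ln_nat_ge0.
by rewrite ler_ln ?posrE ?ltr0n ?ler_nat // (leq_trans _ ab).
Qed.

Lemma ln_natM (a b : nat) : ln (a * b)%:R <= ln a%:R + ln b%:R :> R.
Proof.
case: a => [|a]; first by rewrite mul0n ln0 // add0r ln_nat_ge0.
case: b => [|b]; first by rewrite muln0 [in leLHS]ln0 // addr_ge0 // ln_nat_ge0.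
by rewrite natrM lnM ?posrE ?ltr0n.
Qed.

Lemma limn_esup_le_near (u : nat -> \bar R) (c : \bar R) N :
  (forall n, (N <= n)%N -> (u n <= c)%E) -> (limn_esup u <= c)%E.
Proof.
move=> h; apply: (@le_trans _ _ (ereal_sup (u @` [set n | (N <= n)%N]))).
  by apply: ereal_inf_lbound; exists [set n | (N <= n)%N] => //; exists N.
by apply: ge_ereal_sup => _ [n /= Nn <-]; exact: h.
Qed.

Lemma limn_esup_lt_near (u : nat -> \bar R) (c : \bar R) : (limn_esup u < c)%E ->
  exists N, forall n, (N <= n)%N -> (u n <= c)%E.
Proof.
move=> /ereal_inf_lt[_ [V [N _ hN] <-] hc]; exists N => n Nn; apply: le_trans (ltW hc).
by apply: ereal_sup_ubound; exists n => //; exact: hN.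
Qed.

(** One exponent c has to serve all finite families, while the threshold N0 may depend on the
    family. *)
Lemma GKdim_lty (K : fieldType) (A : algType K) :
  (GKdim A R < +oo)%E <-> exists c : R, forall s : seq A, exists N0, forall N,
    (N0 <= N)%N -> ln (span_dim (products s N))%:R / ln N%:R <= c.
Proof.
split=> [h|[c hc]]; last first.
  apply: le_lt_trans (ltry c); apply: ge_ereal_sup => _ [s _ <-].
  have [N0 h] := hc s; apply: (limn_esup_le_near (N := N0)) => N /h.
  by rewrite lee_fin.
have [c hc] : exists c : R, (GKdim A R < c%:E)%E.
  case: (GKdim A R) h => [r||] // _; last by exists 0; rewrite ltNyr.
  by exists (r + 1); rewrite lte_fin ltrDl.
exists c => s; have /limn_esup_lt_near[N0 h0] : (limn_esup (fun N : nat =>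
    (ln (span_dim (products s N))%:R / ln N%:R)%:E) < c%:E)%E.
  by apply: le_lt_trans hc; apply: ereal_sup_ubound; exists s.
by exists N0 => N /h0; rewrite lee_fin.
Qed.

Lemma GKdim_quotient (K : fieldType) (D A : algType K) (theta : {lrmorphism D -> A}) :
  (forall a, exists y, theta y = a) -> (GKdim D R < +oo)%E -> (GKdim A R < +oo)%E.
Proof.
move=> surj /GKdim_lty[c hc]; apply/GKdim_lty; exists c => s.
have [f hf] := choice surj; have [N0 h0] := hc (map f s).
exists N0 => N /h0; apply: le_trans; rewrite ler_wpM2r ?invr_ge0 ?ln_nat_ge0 //.
apply: ln_nat_mono; have -> : products s N = map theta (products (map f s) N).
  by rewrite map_products -map_comp (eq_map (g := id)) ?map_id.
exact: span_dim_map.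
Qed.

Lemma GKdim_extension (K : fieldType) (D A : algType K) (g : nat_grading D)
    (theta : {lrmorphism D -> A}) (Om : D) (d : nat) (G : seq D) :
  (forall y, theta y = 0 -> exists z, y = Om * z) -> homog g d Om -> (0 < d)%N ->
  (forall c : K, homog g 0 c%:A) ->
  (forall M y, deg_le g M y -> in_span (products G M) y) ->
  (GKdim A R < +oo)%E -> (GKdim D R < +oo)%E.
Proof.
move=> tk hO d0 gs Gg /GKdim_lty[c hc]; apply/GKdim_lty.
(* As b N + 1 <= N^2 for large N, each of the two factors b N + 1 contributes 2 ln N and the growth
   of A contributes 2 max(c, 0) ln N. The maximum allows for a negative c. *)
exists (4 + 2 * Num.max c 0) => s; have [N0 h0] := hc (map theta G).
have /choice[b0 hb0] := @deg_le_exists K D g.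
pose b := (\max_(x <- s) b0 x).+1.
have hb x : x \in s -> deg_le g b x.
  move=> xs i bi; apply: hb0; apply: leq_trans bi; rewrite ltnW // ltnS.
  exact: (leq_bigmax_seq (F := b0)).
exists (maxn N0 b).+2 => N hN.
have N1 : 0 < ln N%:R :> R by rewrite ln_gt0 // ltr1n; lia.
have bN : ((b * N).+1 <= N * N)%N by nia.
rewrite ler_pdivrMr //.
apply: le_trans (ln_nat_mono (span_dim_extension tk hO d0 gs Gg N hb)) _.
set a := span_dim _.
have cmax : c <= Num.max c 0 by rewrite le_max lexx.
have max0 : 0 <= Num.max c 0 by rewrite le_max lexx orbT.
have ha : ln a%:R <= 2 * Num.max c 0 * ln N%:R :> R.
  have hbN : (b * N)%:R <= (N * N)%:R :> R by rewrite ler_nat; lia.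
  have l1 : ln (b * N)%:R <= 2 * ln N%:R :> R.
    by apply: le_trans (ln_nat_mono (ltnW bN)) _; apply: le_trans (ln_natM _ _) _; lra.
  have l0 : 0 < ln (b * N)%:R :> R by rewrite ln_gt0 // ltr1n; nia.
  have := h0 (b * N)%N; rewrite -/a ler_pdivrMr // => h.
  have {}h : ln a%:R <= c * ln (b * N)%:R by apply: h; nia.
  apply: le_trans h _; apply: (@le_trans _ _ (Num.max c 0 * ln (b * N)%:R)).
    by apply: ler_wpM2r; [exact: ltW|exact: cmax].
  by rewrite [2 * _]mulrC -mulrA; apply: ler_wpM2l.
have hl : ln (b * N).+1%:R <= 2 * ln N%:R :> R.
  by apply: le_trans (ln_nat_mono bN) _; apply: le_trans (ln_natM _ _) _; lra.
apply: le_trans (ln_natM _ _) _; have := ln_natM (b * N).+1 a.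
by nra.
Qed.

End LogarithmicGrowth.

Lemma products_generate (K : fieldType) (n : nat) (T : algType K) (fd : free_data n T)
    (A : algType K) (pi : {lrmorphism T -> A}) (g : nat_grading A) N (r : 'cV[T]_N) :
  presented pi r -> compatible fd pi g -> forall M y, deg_le g M y ->
  in_span (products [seq pi (fd_x fd i) | i <- enum 'I_n] M) y.
Proof.
move=> hr hg M y hy; set G := [seq _ | i <- _].
have [u [hu <-]] : exists u, deg_le fd M u /\ pi u = y.
  have [u hu] := presented_surj hr y; exists (\sum_(i < M.+1) gcomp fd i u); split.
    move=> i Mi; rewrite raddf_sum big1 // => j _ /=.
    by rewrite gcomp_gcomp ifN // neq_ltn orbC (leq_trans (ltn_ord j)).
  rewrite raddf_sum [RHS](gcomp_sum (g := g) (N := M.+1)) => [|i Mi]; last exact: hy.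
  by apply: eq_bigr => i _; rewrite -hu hg.
have scal t c : 1 \in t -> in_span t (pi c%:A).
  by move=> t1; rewrite linearZ /= rmorph1; apply/in_spanZ/in_span_mem.
elim: M u hu {y hy} => [|M ih] u hu.
  have -> : u = (fd_aug fd u)%:A.
    by rewrite -fd_gr0 [LHS](gcomp_sum (g := fd) (N := 1)) ?big_ord1.
  by apply: scal; rewrite inE.
rewrite (fd_ldE fd u) raddfD raddf_sum; apply: in_spanD.
  by apply: scal; rewrite inE eqxx.
apply: in_span_sum => i _; rewrite /= rmorphM /=.
have hl : linear ( *%R (pi (fd_x fd i)) : A -> A) by move=> a v w; rewrite mulrDr scalerAr.
have hv : in_span (products G M) (pi (fd_ld fd i u)).
  by apply: ih => j Mj; rewrite -gcompS_ld hu ?linear0.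
apply: in_span_trans (in_span_map (to_linear hl) hv) => _ /mapP[v vG ->].
apply: in_span_mem; rewrite /= inE; apply/orP; right; apply/allpairsP.
exists (pi (fd_x fd i), v); split=> //.
by apply: map_f; rewrite mem_enum.
Qed.

(** * The theorem *)

Section NormalExtensionOfRegular.
Variables (K : fieldType) (n e : nat).
Local Notation T := (TV K n).
Local Notation fd := (TV_data K n).
Variables (A : presentation K n) (A_reg : AS_regular A 3).
Variables (hm : (2 <= e.+2)%N) (w : T) (hw : tpow e.+3 w).
Variables (q p : 'rV[K]_n) (k : 'I_n).
Hypothesis hQ : diag_mx q \in unitmx.
Hypothesis w_sup : twist (diag_mx q) w = w.
Hypothesis A_w : rel_ideal A = rel_ideal (superpotential_algebra hm hw).
Hypothesis p_neq0 : forall i, p 0 i != 0.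
Hypothesis p_good : good q k w p.
Local Notation D := (D_algebra hm hw k p).
Local Notation F := (hess fd w).
Local Notation x := (fd_col fd).

Lemma diag_unit_neq0 i : q 0 i != 0.
Proof.
move: hQ; rewrite unitmxE det_diag unitfE => /prodf_neq0; exact.
Qed.

Lemma superpotential_homog : homog fd e.+3 w.
Proof. exact/tpowP. Qed.

Lemma invmx_diag : invmx (diag_mx q) = diag_mx (\row_i (q 0 i)^-1).
Proof.
have h : diag_mx q *m diag_mx (\row_i (q 0 i)^-1) = 1%:M.
  apply/matrixP => i j; rewrite mul_diag_mx !mxE.
  by case: eqP => [->|_]; rewrite ?mulr1n ?mulr0n ?mulr0 // mulfV // diag_unit_neq0.
by rewrite -[RHS]mul1mx -(mulVmx hQ) -mulmxA h mulmx1.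
Qed.

Lemma superpotential_rder : w = \sum_l fd_x fd l * ((q 0 l)^-1 *: fd_rd fd l w).
Proof.
rewrite -[LHS]w_sup twist_rder.
have -> : mcoeff one w = 0.
  have h := fd_gr0 fd w; rewrite -superpotential_homog gcomp_gcomp superpotential_homog in h.
  by have /eqP := esym h; rewrite scaler_eq0 oner_eq0 orbF => /eqP.
rewrite [X in X + _](_ : _ = 0); last exact: scale0r.
rewrite add0r; apply: eq_bigr => l _; rewrite invmx_diag mx_gen_diag mxE.
by rewrite -scalerAl scalerAr.
Qed.

Lemma hess_pder i : (F *m x) i 0 = pder i w.
Proof. exact: (hess_col superpotential_homog). Qed.

Lemma superpotential_hess : x^T *m F = (F *m x)^T *m alg_diag T (fun i => q 0 i).
Proof. exact: (hess_twist superpotential_homog diag_unit_neq0 superpotential_rder). Qed.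

Lemma superpotential_hess_homog i j : homog fd e.+1 (F i j).
Proof. exact: (hess_homog superpotential_homog). Qed.

Lemma A_presented : presented (proj A) (F *m x).
Proof.
apply: palg_presented => [s hs|i].
  have : rel_ideal A s by exact: ideal_gen_mem.
  rewrite A_w; apply: ideal_gen_sub => _ /mapP[i _ ->].
  by apply: ideal_gen_mem; exists i; rewrite hess_pder.
rewrite A_w hess_pder; apply: ideal_gen_mem; apply/mapP; exists i => //.
by rewrite mem_enum.
Qed.

Local Notation pf := (fun i => p 0 i).
Local Notation qf := (fun i => q 0 i).

Lemma D_presented : presented (proj D) (ext_rel fd F pf k).
Proof.
apply: palg_presented => [s|i].
  rewrite mem_cat => /orP[] /mapP[i]; rewrite mem_filter => /andP[/negbTE ik _] ->.
    apply: ideal_gen_mem; exists (lshift n i); rewrite /ext_rel col_mxEu mxE ik.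
    exact: esym (hess_pder i).
  apply: ideal_gen_mem; exists (rshift n i); rewrite /ext_rel col_mxEd !mxE ik.
  have E := hess_pder k; rewrite mxE in E; rewrite E; exact: erefl.
rewrite /ext_rel; case: (split_ordP i) => j ->; rewrite ?col_mxEu ?col_mxEd mxE;
  case: eqP => [_|/eqP jk]; try exact: ideal_gen0; apply: ideal_gen_mem.
  rewrite hess_pder /= mem_cat; apply/orP; left; apply/mapP; exists j => //.
  by rewrite mem_filter jk mem_enum.
rewrite hess_pder /= mem_cat; apply/orP; right; apply/mapP; exists j.
  by rewrite mem_filter jk mem_enum.
rewrite !mxE; exact: erefl.
Qed.

Definition scaling : {lrmorphism T -> T} := mx_tensor (diag_mx p).
Definition scaling_inv : {lrmorphism T -> T} := mx_tensor (diag_mx (\row_i (p 0 i)^-1)).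

Lemma scaling_gen i : scaling (x i 0) = p 0 i *: x i 0.
Proof. by rewrite mxE; exact: mx_tensor_diag_gen. Qed.

Lemma scaling_inv_gen i : scaling_inv (x i 0) = (p 0 i)^-1 *: x i 0.
Proof. by rewrite mxE; apply: etrans (mx_tensor_diag_gen _ _) _; rewrite mxE. Qed.

Lemma scaling_pder i : scaling ((F *m x) i 0) = (q 0 k / p 0 i) *: (F *m x) i 0.
Proof.
rewrite hess_pder; have [_ sgw] := p_good.
apply: (sg_ld_w superpotential_homog (sg := scaling) p_neq0 _ sgw) => j.
by have := scaling_gen j; rewrite mxE.
Qed.

Lemma A_grading : exists g : nat_grading (palg A), compatible fd (proj A) g.
Proof.
apply: (quotient_grading A_presented) => i; exists e.+2; rewrite hess_pder.
exact/tpowP/tpow_pder.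
Qed.

Lemma D_grading : exists g : nat_grading (palg D), compatible fd (proj D) g.
Proof.
have hf i : homog fd e.+2 (pder i w) by exact/tpowP/tpow_pder.
apply: (quotient_grading D_presented) => i; rewrite /ext_rel.
case: (split_ordP i) => j ->; rewrite ?col_mxEu ?col_mxEd mxE;
  case: eqP => _; try by exists 0%N; exact: homog0.
  by exists e.+2; rewrite hess_pder.
exists e.+3; rewrite hess_pder; have hx : homog fd 1 (x j 0) by rewrite mxE; exact: fd_gr1.
apply: homogB; first exact: (homogM hx (hf k)).
by rewrite -addn1; apply: homogZ; exact: (homogM (hf k) hx).
Qed.

Lemma A_right_exact : (forall a : palg A, (forall i, map_mx (proj A) x i 0 * a = 0) -> a = 0) /\
  (forall c : 'cV[palg A]_n, map_mx (proj A) F *m c = 0 ->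
     exists y : 'M_1, c = map_mx (proj A) x *m y).
Proof.
have [g hg] := A_grading; have [_ [_ [l [C [gC [hC ext0 _]]]]]] := A_reg.
have pdegP := palg_pdegP A_presented hg.
have Xh := gens_homog hg; have Xg := palg_pos_gen A_presented.
split; first exact: (ext0_torsion_free pdegP Xh Xg hC (ext0 0%N isT)).
move=> c; apply: (ext1_exact pdegP Xh Xg hC (e := e.+1)) => //.
- by move=> i j; rewrite mxE; apply: (compatible_homog hg); exact: superpotential_hess_homog.
- exact: (left_exact1 A_presented).
- exact: ext0.
Qed.

Definition A_right_exact3 := proj1 A_right_exact.
Definition A_right_exact2 := proj2 A_right_exact.

Lemma A_left_exact i (u : 'rV[palg A]_(cone_rk n i.+1)) :
  u *m map_mx (proj A) (cone_d fd F i) = 0 ->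
  exists v, u = v *m map_mx (proj A) (cone_d fd F i.+1).
Proof.
have [g hg] := A_grading; have [[pd3 _] _] := A_reg.
apply: (koszul_left_exact diag_unit_neq0 superpotential_hess A_presented
  superpotential_hess_homog hg A_right_exact2) => //.
exact: leq_ltn_trans (ltn_ord k).
Qed.

Lemma A_koszul_right_exact i (c : 'cV[palg A]_(cone_rk n i)) : (i < 3)%N ->
  map_mx (proj A) (cone_d fd F i) *m c = 0 ->
  exists b, c = map_mx (proj A) (cone_d1 fd F i) *m b.
Proof.
exact: (koszul_right_exact diag_unit_neq0 superpotential_hess A_presented A_right_exact2
  A_right_exact3).
Qed.

Local Notation pk := (proj1 p_good).

Lemma D_theta : exists theta : {lrmorphism palg D -> palg A},
  [/\ forall u, theta (proj D u) = proj A u, forall a, exists y, theta y = a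
    & forall y, theta y = 0 <-> exists z, y = proj D (pder k w) * z].
Proof.
rewrite -hess_pder; exact: (exists_theta (p := pf) (q := qf) pk superpotential_hess A_presented
  scaling_gen D_presented).
Qed.

Lemma D_Om_normal : normal_element (proj D (pder k w)).
Proof.
rewrite -hess_pder; exact: (Om_normal (p := pf) (q := qf) p_neq0 pk superpotential_hess
  scaling_gen scaling_inv_gen D_presented).
Qed.

Lemma D_Om_regular : regular_element (proj D (pder k w)).
Proof.
have [g hg] := D_grading; rewrite -hess_pder.
exact: (Om_regular (p := pf) (q := qf) p_neq0 diag_unit_neq0 pk superpotential_hess A_presented
  scaling_gen scaling_inv_gen scaling_pder
  D_presented A_right_exact2 hg).
Qed.

(** The definition refers to the two-sided ideal generated by Om, which by normality is Om D, the
    kernel found in [D_theta]. *)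
Lemma D_normal_extension : normal_extension A (proj D (pder k w)).
Proof.
split; [exact: D_Om_normal|exact: D_Om_regular|].
have [theta [h1 _ h3]] := D_theta; exists theta; split=> // y; apply: iff_trans (h3 y) _.
split=> [[z ->]|].
  by apply: ideal_genMr; apply: ideal_gen_mem.
elim=> [|a s b z -> _ [z' ->]]; first by exists 0; rewrite mulr0.
have : [set a' * proj D (pder k w) | a' in [set: palg D]] (a * proj D (pder k w)) by exists a.
rewrite -D_Om_normal => -[a' _ <-]; exists (a' * b + z').
by rewrite mulrDr mulrA.
Qed.

Local Notation X := (@cone_mx _ _ _ fd F qf k scaling_inv _ (proj D)).

Lemma D_AS_regular : AS_regular D 4.
Proof.
have [g hg] := D_grading; have pdegP := palg_pdegP D_presented hg.
have X_homog := cone_mx_homog (p := pf) (q := qf) (k := k) p_neq0 diag_unit_neq0 scaling_gen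
  scaling_inv_gen scaling_pder hg superpotential_hess_homog.
have X_complex := cone_complex (p := pf) (q := qf) p_neq0 diag_unit_neq0 pk superpotential_hess
  scaling_gen scaling_inv_gen scaling_pder D_presented.
have X_exact := cone_left_exact (p := pf) (q := qf) p_neq0 diag_unit_neq0 pk
  superpotential_hess A_presented scaling_gen scaling_inv_gen scaling_pder
  D_presented A_right_exact2 hg A_left_exact.
have X_right := cone_right_exact (p := pf) (q := qf) p_neq0 diag_unit_neq0 pk
  superpotential_hess A_presented scaling_gen scaling_inv_gen scaling_pder
  D_presented A_right_exact2 hg A_koszul_right_exact.
have X_aug := cone_left_aug qf scaling_inv D_presented hg.
have X_top := cone_right_top qf p_neq0 scaling_inv_gen D_presented hg.
pose rk i := (cone_rk n i + cone_rk1 n i)%N.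
have X0 i (a : 'I_(rk i.+1)) (b : 'I_(rk i)) :
    (cone_deg e b < cone_deg e a)%N -> gcomp g 0 (X i a b) = 0.
  move=> ab; have [->|[_ h]] := X_homog i a b; first exact: raddf0.
  rewrite (gcomp_homog _ h) ifN // eq_sym subn_eq0 -ltnNge //.
pose j0 : 'I_(rk 0) := ord0; pose l0 : 'I_(rk 4) := ord0.
have rk0 (j : 'I_(rk 0)) : j = j0 by exact: (ord1 (j : 'I_1)).
have rk4 (l : 'I_(rk 4)) : l = l0 by exact: (ord1 (l : 'I_1)).
have deg0 (j : 'I_(rk 0)) : cone_deg e j = 0%N.
  by rewrite /cone_deg; case: (split_ordP j) => -[].
have deg1 (l : 'I_(rk 1)) : (0 < cone_deg e l)%N.
  by rewrite /cone_deg; case: (fintype.split l).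
have deg4 (l : 'I_(rk 4)) : cone_deg e l = (e.+3 + e.+2)%N.
  by rewrite /cone_deg; case: (split_ordP l) => -[] //= ? ? _.
have deg3 (j : 'I_(rk 3)) : (cone_deg e j < e.+3 + e.+2)%N.
  by rewrite /cone_deg; case: (fintype.split j) => _; rewrite [X in (X < _)%N]/=; lia.
have rk_top i : (4 < i)%N -> rk i = 0%N by case: i => [|[|[|[|[|i]]]]].
have X_pos l (j : 'I_(rk 0)) : gcomp g 0 (X 0%N l j) = 0 by apply: X0; rewrite deg0.
have X_pos_top (j : 'I_(rk 3)) : gcomp g 0 (X 3 l0 j) = 0 by apply: X0; rewrite deg4.
have X_aug' (z : 'rV[palg D]_(rk 0)) : (forall j, gcomp g 0 (z 0 j) = 0) ->
    exists v, z = v *m X 0%N.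
  by move=> h; apply: X_aug; exact: h.
have X_top' (c : 'cV[palg D]_(rk 4)) : gcomp g 0 (c l0 0) = 0 -> exists b, c = X 3 *m b.
  by move=> h; apply: X_top; exact: h.
(* The last row of [X 0] is the single entry Om, which is left regular. *)
have X_inj (c : 'cV[palg D]_(rk 0)) : X 0%N *m c = 0 -> c = 0.
  have [Om_l _] := D_Om_regular; rewrite -hess_pder in Om_l.
  rewrite -[c]vsubmxK mul_block_col => h0.
  have [_ h] := eq_col_mx (etrans h0 (esym (col_mx0 _ _ _ _))).
  rewrite [dsubmx c]flatmx0 mulmx0 addr0 mul_scalar_mx in h *.
  rewrite [usubmx c](_ : _ = 0) ?col_mx0 //; apply/matrixP => a b.
  have := congr1 (fun y : 'M_(_, _) => y a b) h; rewrite mxE [RHS]mxE => h'.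
  by rewrite [RHS]mxE; apply: Om_l; rewrite mulr0; exact: h'.
apply: (row_gorenstein pdegP (deg := fun i => @cone_deg n e i) X_homog (j0 := j0) (l0 := l0))
  => //.
apply: (graded_projdim_le (g := g) (deg := fun i => @cone_deg n e i) (X := X) (j0 := j0)) => //.
- exact: (compatible_gcomp0 D_presented hg).
- exact: (homog_palg_scalar pdegP).
- move=> i l j; rewrite mxE; have [->|[h1 h2]] := X_homog i l j.
    by case: ifP => // _; exact: homog0.
  by rewrite h1.
Qed.

Lemma D_Om_homog (g : nat_grading (palg D)) : compatible fd (proj D) g ->
  homog g e.+2 (proj D (pder k w)).
Proof. by move=> hg; apply: (compatible_homog hg); exact/tpowP/tpow_pder. Qed.

Lemma D_noetherian : noetherian (palg D) <-> noetherian (palg A).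
Proof.
have [g hg] := D_grading; have [theta [_ surj ker]] := D_theta.
apply: (noetherian_iff (theta := theta) surj _ (D_Om_homog hg) _ D_Om_normal) => // y.
by case: (ker y).
Qed.

Lemma D_domain : domain (palg A) -> domain (palg D).
Proof.
have [g hg] := D_grading; have [theta [_ surj ker]] := D_theta.
apply: (domain_extension (theta := theta) (raddfB theta) (rmorphM theta) _ (D_Om_homog hg) _
  D_Om_normal D_Om_regular) => // y.
by case: (ker y).
Qed.

Lemma D_GKdim (R : realType) : (GKdim (palg D) R < +oo)%E <-> (GKdim (palg A) R < +oo)%E.
Proof.
have [g hg] := D_grading; have [theta [_ surj ker]] := D_theta.
split; first exact: (GKdim_quotient surj).
apply: (GKdim_extension (theta := theta) _ (D_Om_homog hg)
  (G := [seq proj D (fd_x fd i) | i <- enum 'I_n])) => //.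
- by move=> y; case: (ker y).
- exact: (homog_palg_scalar (palg_pdegP D_presented hg)).
- exact: (products_generate D_presented hg).
Qed.

End NormalExtensionOfRegular.

Theorem theorem1p1 (R : realType) (K : fieldType) (n m : nat)
    (hm : (2 <= m)%N)
    (A : presentation K n)
    (A_rel : forall r, r \in relators A -> tpow m r)
    (A_reg : AS_regular A 3)
    (w : TV K n) (hw : tpow m.+1 w)
    (Q : 'M[K]_n) (hQ : Q \in unitmx)
    (w_sup : twisted_superpotential Q m.+1 w)
    (A_w : rel_ideal A = rel_ideal (superpotential_algebra hm hw))
    (q : 'rV[K]_n) (Q_diag : Q = diag_mx q)
    (k : 'I_n) (p : 'rV[K]_n)
    (p_neq0 : forall i, p 0 i != 0)
    (p_good : good q k w p) :
  let D := D_algebra hm hw k p in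
  let Omega := proj D (pder k w) in
  [/\ AS_regular D 4 /\ normal_extension A Omega,
      noetherian (palg D) <-> noetherian (palg A),
      (GKdim (palg D) R < +oo)%E <-> (GKdim (palg A) R < +oo)%E
    & domain (palg A) -> domain (palg D)].
Proof.
move=> D Omega; rewrite {}/Omega {}/D; subst Q; have [_ w_tw] := w_sup.
(* Setting m = e + 2 makes the degree m - 1 of F the successor e + 1 and keeps subtraction out of
   the degrees. *)
case: m hm A_rel hw w_sup A_w => [|[|e]] hm;
  [by case: (notF hm)|by case: (notF hm)|move=> A_rel hw w_sup A_w].
split.
- split; first exact: (D_AS_regular A_reg hQ w_tw A_w p_neq0 p_good).
  exact: (D_normal_extension A_reg hQ w_tw A_w p_neq0 p_good).
- exact: (D_noetherian hQ w_tw A_w p_neq0 p_good).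
- exact: (D_GKdim hQ w_tw A_w p_good).
- exact: (D_domain A_reg hQ w_tw A_w p_neq0 p_good).
Qed.
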